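(* Let $\alpha,\beta,\gamma>0$, $\delta\in\mathbb N$ ($\delta\ge1$), and let $T>0$. Then the boundary controlled generalized Burgers--Huxley system $$\begin{cases}u_t=u_{xx}-\alpha u^\delta u_x+\beta u(1-u^\delta)(u^\delta-\gamma) & \text{in }(0,T)\times(0,1),\\ u(t,0)=f_1(t),\quad u(t,1)=f_2(t), & t\in(0,T),\\ u(0,x)=u_0(x), & x\in(0,1),\end{cases}$$ is not $L^2(0,1)$-approximately controllable (in time $T$) with respect to the set of controls $f_1,f_2\in L^2(0,T)$.
   Context: Approximate controllability: the system is $L^2(0,1)$-approximately controllable in time $T$ if for every $u_0,u_T\in L^2(0,1)$ and every $\epsilon>0$ there exist controls $f_1,f_2\in L^2(0,T)$ and a corresponding solution $u$ with initial datum $u_0$ such that $\|u(T)-u_T\|_{L^2(0,1)}\le\epsilon$. Solution: a function $u\in L^\infty(0,T;L^2(0,1))\cap L^2(0,T;H^1(0,1))\cap L^{2(\delta+1)}(0,T;L^{2(\delta+1)}(0,1))$ with $u_t\in L^{1+\frac1{2\delta-1}}(0,T;H^{-1}(0,1))$, with boundary traces $u(t,0)=f_1(t)$, $u(t,1)=f_2(t)$ for a.e. $t\in(0,T)$, such that for all $\varphi\in H_0^1(0,1)$ and a.e. $t\in(0,T)$ $$\langle u_t,\varphi\rangle+\int_0^1u_x\varphi_x\,dx+\alpha\int_0^1u^\delta u_x\varphi\,dx=\beta\int_0^1u(1-u^\delta)(u^\delta-\gamma)\varphi\,dx,$$ and $\lim_{t\to0^+}\int_0^1u(t,x)\varphi(x)\,dx=\int_0^1u_0\varphi\,dx$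 for all $\varphi\in H_0^1(0,1)$ (weakly continuous representative, also used to define $u(T)$). *)

(* Defs.v *)
From HB Require Import structures.
From mathcomp Require Import all_boot all_order all_algebra.
From mathcomp Require Import all_classical all_reals all_analysis.

Set Implicit Arguments.
Unset Strict Implicit.
Unset Printing Implicit Defensive.

Import Order.TTheory GRing.Theory Num.Theory.
Import numFieldNormedType.Exports.

Local Open Scope classical_set_scope.
Local Open Scope ring_scope.

(** Lebesgue measure restricted to the open interval (a, b). Elements of function
    spaces on (a, b) are represented by Borel functions on the whole line; only
    their values on (a, b), up to null sets, matter. *)
Definition leb (R : realType) (a b : R) :
    {measure set (measurableTypeR R) -> \bar R} :=
  mrestr (@lebesgue_measure R) (measurable_itv `]a, b[).

Section Sobolev.
Context {R : realType}.
Implicit Types f g phi psi : R -> R.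

Definition smooth f := forall n x, derivable (derive1n n f) x 1.

Definition test_fun (a b : R) psi := smooth psi /\
  exists c d : R, [/\ a < c, d < b & forall x, psi x != 0 -> c <= x <= d].

Definition Lp (a b : R) (p : \bar R) : set (R -> R) :=
  [set` Lfun (leb a b) p].

Definition Lpnorm (a b : R) (p : \bar R) f : \bar R :=
  ('N[leb a b]_p[EFin \o f])%E.

Definition weak_deriv (a b : R) f g := forall psi, test_fun a b psi ->
  \int[leb a b]_x (f x * derive1 psi x) = - \int[leb a b]_x (g x * psi x).

Definition H1 : set (R -> R) :=
  [set f | Lp 0 1 2 f /\ exists2 g, Lp 0 1 2 g & weak_deriv 0 1 f g].

(** A chosen weak derivative: unique up to null sets when [H1 f], and the
    default 0 otherwise. *)
Definition wderiv f : R -> R :=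
  xget (cst 0) [set g | Lp 0 1 2 g /\ weak_deriv 0 1 f g].

Definition H1norm f : \bar R :=
  ((Lpnorm 0 1 2 f ^+ 2 + Lpnorm 0 1 2 (wderiv f) ^+ 2) `^ 2^-1)%E.

Definition H10 : set (R -> R) :=
  [set phi | H1 phi /\ forall e : R, 0 < e -> exists psi,
     test_fun 0 1 psi /\ (H1norm (phi - psi)%R <= e%:E)%E].

(** Boundary value at [a] (with [a = 0] or [a = 1]) of an element of H^1(0,1),
    read off its representative continuous on [0, 1]. *)
Definition has_trace f (a c : R) := exists v : R -> R,
  [/\ {within `[0, 1], continuous v},
      {ae leb 0 1, forall x, v x = f x} & v a = c].

(** H^{-1}(0,1), the dual of H^1_0(0,1): a functional is represented by a map
    on all functions, of which only the restriction to [H10] matters. *)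
Definition Hm1norm (l : (R -> R) -> R) : \bar R :=
  ereal_sup [set (`|l phi|)%:E | phi in
    [set phi | H10 phi /\ (H1norm phi <= 1)%E]].

Definition Hm1 : set ((R -> R) -> R) :=
  [set l | (forall (c : R) phi psi, H10 phi -> H10 psi ->
              l (c *: phi + psi) = c * l phi + l psi) /\
           (Hm1norm l < +oo)%E].

Definition strongly_measurable (V : zmodType) (X : set V) (N : V -> \bar R)
    (T : R) (w : R -> V) := exists s : nat -> R -> V,
  (forall n, [/\ finite_set (range (s n)), range (s n) `<=` X &
      forall v, measurable (s n @^-1` [set v] : set (measurableTypeR R))]) /\
  {ae leb 0 T, forall t, N (w t - s n t) @[n --> \oo] --> 0%E}.

(** The Bochner space L^p(0, T; X), for X a (semi)normed space with carrier [X]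
    inside [V] and norm [N]. *)
Definition Bochner (V : zmodType) (X : set V) (N : V -> \bar R)
    (T : R) (p : \bar R) : set (R -> V) :=
  [set w | [/\ {ae leb 0 T, forall t, X (w t)},
               strongly_measurable X N T w &
               (('N[leb 0 T]_p[N \o w])%E < +oo)%E]].

(** [w] is the derivative of [u] in the sense of H^{-1}-valued distributions on
    (0, T), L^2 being embedded in H^{-1} by the L^2 pairing. *)
Definition time_deriv (T : R) (u : R -> R -> R) (w : R -> (R -> R) -> R) :=
  forall phi psi, H10 phi -> test_fun 0 T psi ->
  \int[leb 0 T]_t (derive1 psi t * \int[leb 0 1]_x (u t x * phi x)) =
  - \int[leb 0 T]_t (psi t * w t phi).

(** The function [t |-> u t] is the weakly continuous representative, on all of
    [0, T], of the solution; in particular [u T] is its final state. *)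
Definition solution (alpha beta gamma : R) (delta : nat) (T : R)
    (f1 f2 u0 : R -> R) (u : R -> R -> R) :=
  let q : \bar R := ((2 * delta.+1)%:R)%:E in
  [/\ Bochner (Lp 0 1 2) (Lpnorm 0 1 2) T +oo%E u,
      Bochner H1 H1norm T 2 u,
      Bochner (Lp 0 1 q) (Lpnorm 0 1 q) T q u,
      (forall t, t \in `[0, T] -> Lp 0 1 2 (u t)) /\
      (forall phi, Lp 0 1 2 phi ->
         {within `[0, T], continuous
            (fun t => \int[leb 0 1]_x (u t x * phi x))}) &
  [/\ {ae leb 0 T, forall t, has_trace (u t) 0 (f1 t)},
      {ae leb 0 T, forall t, has_trace (u t) 1 (f2 t)},
      (exists ut : R -> (R -> R) -> R,
        [/\ Bochner Hm1 Hm1norm T (1 + (2 * delta%:R - 1)^-1)%:E ut,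
            time_deriv T u ut &
            forall phi, H10 phi -> {ae leb 0 T, forall t,
              ut t phi
              + \int[leb 0 1]_x (wderiv (u t) x * wderiv phi x)
              + alpha *
                \int[leb 0 1]_x (u t x ^+ delta * wderiv (u t) x * phi x)
              = beta *
                \int[leb 0 1]_x (u t x * (1 - u t x ^+ delta)
                                 * (u t x ^+ delta - gamma) * phi x)}]) &
      forall phi, H10 phi ->
        \int[leb 0 1]_x (u t x * phi x) @[t --> 0^'+] -->
        \int[leb 0 1]_x (u0 x * phi x)]].

Definition approximately_controllable (alpha beta gamma : R) (delta : nat)
    (T : R) :=
  forall u0 uT, Lp 0 1 2 u0 -> Lp 0 1 2 uT -> forall e : R, 0 < e ->
  exists f1 f2 (u : R -> R -> R),
    [/\ Lp 0 T 2 f1, Lp 0 T 2 f2,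
        solution alpha beta gamma delta T f1 f2 u0 u &
        (Lpnorm 0 1 2 (u T - uT)%R <= e%:E)%E].

End Sobolev.

(* Main.v *)
Require Import Defs.
From HB Require Import structures.
From mathcomp Require Import all_boot all_order all_algebra.
From mathcomp Require Import all_classical all_reals all_analysis.
From mathcomp Require Import measurable_realfun lebesgue_integral_under.
From mathcomp Require Import ring lra.
Set Implicit Arguments.
Unset Strict Implicit.
Unset Printing Implicit Defensive.
Import Order.TTheory GRing.Theory Num.Theory.
Import numFieldNormedType.Exports.
Local Open Scope classical_set_scope.
Local Open Scope ring_scope.

(** The superlinear absorption [- beta u^(2 delta + 1)] bounds the solution inside
    the domain whatever enters through the boundary. Take a weight [rho = s^4] with
    [s] vanishing at the ends of the interval [1/4, 3/4]. Multiplying the equation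
    by [rho u] and integrating by parts, Young's inequality absorbs the terms
    with derivatives of [rho] into [rho u_x^2] and [beta rho u^(2 delta + 2)], so
    that [d/dt \int rho u^2 <= C] with [C] independent of the controls.
    Starting from [u_0 = 0], the weighted norm of [u(T)] is thus bounded
    independently of the controls, and a large constant [u_T] cannot be approached.

    As [u_t] only acts on fixed functions of [H^1_0], the computation is done for
    the mollification [c_y(t) = <u(t), phi_(h,y)>]: for each [y] it is absolutely
    continuous in [t], so that [c_y(T)^2 - c_y(0)^2 = 2 \int c_y c_y']; one then
    integrates in [y] and lets [h] tend to 0, the energy flux being dominated by
    [1 + \int u_x^2 + \int u^(2 delta + 2)], which is integrable in time. *)

(** * Smooth bump functions *)

(** Pairing [u_t] with [rho u] directly is not possible: for [delta >= 2] the exponent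
    [1 + 1/(2 delta - 1)] is below 2 and does not match the mere [L^2] integrability in time of [u]
    with values in [H^1]. Against a fixed [moll h y] the equation is a scalar identity for a.e. [t],
    but the exceptional null set depends on [y]; the integration in [y] therefore uses only
    countably many centres. Mollification commutes with the nonlinear terms up to an error tending
    to 0 for each [t], at a rate that depends on [t]. Hence two upper bounds of the flux: a constant
    plus an error, for [h] small depending on [t], and an integrable function of time, uniform in
    [h]. A one-sided dominated convergence combines them. The energy itself is never passed to the
    limit: one small [h] is enough, since the lower bound for a state close to a large constant
    holds for every [h <= 1/8]. This 1/8 keeps the mollifiers centred in [1/4, 3/4] supported inside
    (0, 1), away from the controls. *)

Section Bump.
Context {R : realType}.
Implicit Types (f g : R -> R) (p : {poly R}) (x y : R).

(** Coinduction for [smooth]: a class of functions closed under differentiation replaces a formula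
    for the n-th derivative. *)
Lemma smooth_coind (P : (R -> R) -> Prop) :
  (forall f, P f -> exists2 g, P g & forall x, is_derive x 1 f (g x)) ->
  forall f, P f -> smooth f.
Proof.
move=> H f Pf n x.
suff [g Pg ->] : exists2 g, P g & derive1n n f = g.
  by have [k _ /(_ x) kP] := H _ Pg; apply/ex_derive.
elim: n => [|n [g Pg IH]]; first by exists f.
have [k Pk kP] := H _ Pg; exists k => //.
rewrite derive1nS IH; apply/funext => z.
by rewrite derive1E; apply/derive_val.
Qed.

(** Serves at the points with [|x| >= 1], where the bump vanishes and its formula cannot be
    differentiated. *)
Lemma is_derive_quadratic f x K :
  (forall y, `|f y - f x| <= K * `|y - x| ^+ 2) -> is_derive x 1 f 0.
Proof.
move=> H.
have K0 : 0 <= K.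
  have := H (x + 1); rewrite addrAC subrr add0r normr1 expr1n mulr1.
  exact: le_trans.
suff C : h^-1 *: (f (h *: (1:R) + x) - f x) @[h --> 0^'] --> (0 : R).
  apply: DeriveDef; first by apply/cvg_ex; exists 0.
  by rewrite /derive; apply/cvg_lim.
apply/cvgrPdist_le => e e0; near=> h.
rewrite sub0r normrN normrM normfV.
have h0 : `|h| > 0 by rewrite normr_gt0; near: h; exact: nbhs_dnbhs_neq.
rewrite mulrC ler_pdivrMr//.
apply: (le_trans (H _)); rewrite scaler1 addrK expr2 mulrA ler_wpM2r//.
have hs : `|h| <= e / (K + 1).
  by near: h; apply: dnbhs0_le; rewrite divr_gt0// ltr_wpDl.
apply: (le_trans (ler_wpM2l K0 hs)).
have K1 : 0 < K + 1 by rewrite ltr_wpDl.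
by rewrite mulrA ler_pdivrMr// [leLHS]mulrC; apply: ler_wpM2l; [exact: ltW|rewrite lerDl].
Unshelve. all: by end_near. Qed.

Lemma poly_bounded01 p : exists2 C : R, 0 <= C &
  forall x, `|x| <= 1 -> `|p.[x]| <= C.
Proof.
exists (\sum_(i < size p) `|p`_i|); first exact: sumr_ge0.
move=> x x1; rewrite horner_coef; apply: (le_trans (ler_norm_sum _ _ _)).
apply: ler_sum => i _; rewrite normrM normrX -[leRHS]mulr1.
by rewrite ler_wpM2l// exprn_ile1.
Qed.

(* This family is closed under differentiation, which makes its members smooth. *)
Definition bumpp p (k : nat) x : R :=
  if `|x| < 1 then p.[x] * ((1 - x ^+ 2)^-1) ^+ k * expR (- (1 - x ^+ 2)^-1)
  else 0.

(** The exponential beats the poles: with [s = 1 - x^2], the bound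
    [1 + s^-(k+2) / (k+2)! <= expR (1/s)] gives [s^-k * expR (- 1/s) <= (k+2)! * s^2]. The power 2
    is what [is_derive_quadratic] asks for at the end points. *)
Lemma bumpp_quad p k : exists2 C : R, 0 <= C &
  forall x, `|bumpp p k x| <= C * (Num.max 0 (1 - x ^+ 2)) ^+ 2.
Proof.
have [C C0 HC] := poly_bounded01 p.
exists (C * (k.+2)`!%:R) => [|x]; first by rewrite mulr_ge0.
rewrite /bumpp; case: ifPn => x1; last first.
  by rewrite normr0; apply: mulr_ge0; [rewrite mulr_ge0|rewrite sqr_ge0].
have s0 : 0 < 1 - x ^+ 2.
  by rewrite subr_gt0 -real_normK ?num_real// exprn_ilt1.
rewrite (max_idPr (ltW s0)); set s := 1 - x ^+ 2 in s0 *.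
rewrite !normrM -!mulrA; apply: ler_pM => //; first by rewrite HC// ltW.
rewrite normrX normfV (gtr0_norm s0).
rewrite ger0_norm ?expR_ge0// expRN.
have := @expR_ge1Dxn R s^-1 k.+1 (ltW _); rewrite invr_gt0 => /(_ s0) H.
have F0 : 0 < (k.+2)`!%:R :> R by rewrite ltr0n fact_gt0.
have E0 := expR_gt0 s^-1.
rewrite ler_pdivrMr// -ler_pdivrMl ?mulr_gt0 ?exprn_gt0//.
apply: le_trans H; rewrite invfM -exprVn mulrAC -mulrA -exprD addn2 mulrC.
by rewrite lerDr.
Qed.

Lemma bumpp_bounded p k : exists2 C : R, 0 <= C & forall x, `|bumpp p k x| <= C.
Proof.
have [C C0 HC] := bumpp_quad p k; exists C => // x.
apply: (le_trans (HC x)); rewrite -[leRHS]mulr1 ler_wpM2l//.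
rewrite exprn_ile1// ?le_max ?lexx// ge_max ler01 lerBlDr lerDl.
exact: sqr_ge0.
Qed.

Lemma bumpp_out p k x : 1 <= `|x| -> bumpp p k x = 0.
Proof. by rewrite /bumpp ltNge => ->. Qed.

(** Put [q = 1 / (1 - x^2)], so that [q' = 2 x q^2]. This is the polynomial left when
    [q^(k+2) expR (- q)] is factored out of the derivative of [p q^k expR (- q)]. *)
Definition dbump p (k : nat) : {poly R} :=
  p^`() * (1 - 'X^2) ^+ 2 + (2 * k%:R)%:P * 'X * p * (1 - 'X^2) - 2%:P * 'X * p.

Lemma is_derive_bumpp p k x : is_derive x 1 (bumpp p k) (bumpp (dbump p k) k.+2 x).
Proof.
have [x1|x1] := ltP `|x| 1; last first.
  rewrite bumpp_out//; have [C C0 HC] := bumpp_quad p k.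
  apply: (@is_derive_quadratic _ _ (C * (`|x| + 1) ^+ 2)) => y.
  rewrite (bumpp_out _ _ x1) subr0.
  have [y1|y1] := ltP `|y| 1; last by rewrite bumpp_out// normr0 !mulr_ge0// ?exprn_ge0// ?addr_ge0.
  apply: (le_trans (HC y)); rewrite -mulrA ler_wpM2l// -exprMn.
  have K0 : 0 <= (`|x| + 1) * `|y - x| by rewrite mulr_ge0// addr_ge0.
  apply: lerXn2r; rewrite ?nnegrE ?le_max ?lexx//.
  rewrite ge_max K0/=.
  (* Since [x^2 >= 1], [1 - y^2 <= x^2 - y^2], which has the factor [y - x]; the bound on [bumpp]
     becomes quadratic in the distance to [x]. *)
  have x2 : 1 <= x ^+ 2 by rewrite -real_normK ?num_real// exprn_ege1.
  apply: (@le_trans _ _ (`|(y - x) * (y + x)|)).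
    by rewrite -subr_sqr distrC ler_normr; apply/orP; left; lra.
  rewrite normrM mulrC ler_wpM2r// (le_trans (ler_normD _ _))//; lra.
have s0 : 0 < 1 - x ^+ 2.
  by rewrite subr_gt0 -real_normK ?num_real// exprn_ilt1.
pose F z : R := p.[z] * ((1 - z ^+ 2)^-1) ^+ k * expR (- (1 - z ^+ 2)^-1).
have nF : \near x, F x = bumpp p k x.
  have : \forall z \near x, `|z| < 1.
    apply: (@cvgr_lt _ _ (nbhs x) _ (fun z => `|z|) `|x|) => //.
    exact: (@norm_continuous _ R).
  by apply: filterS => z z1; rewrite /bumpp z1.
suff : is_derive x 1 F (bumpp (dbump p k) k.+2 x) by exact: near_eq_is_derive.
have neq : 1 - x ^+ 2 != 0 by rewrite gt_eqF.
rewrite /bumpp x1 (exprS _ k.+1) (exprS _ k).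
have dq : is_derive x 1 (fun z : R => 1 - z ^+ 2) (- (2 * x)).
  apply: is_derive_eq; rewrite /GRing.scale/=. ring.
have dV : is_derive x 1 (fun z : R => (1 - z ^+ 2)^-1) (2 * x / (1 - x ^+ 2) ^+ 2).
  have := is_deriveV (f := fun z : R => 1 - z ^+ 2) neq.
  by move=> H; apply: is_derive_eq; rewrite /GRing.scale/=; field.
have de : is_derive x 1 (fun z : R => expR (- (1 - z ^+ 2)^-1))
   (- (2 * x / (1 - x ^+ 2) ^+ 2) * expR (- (1 - x ^+ 2)^-1)).
  have dN : is_derive x 1 (fun z : R => - (1 - z ^+ 2)^-1) (- (2 * x / (1 - x ^+ 2) ^+ 2)).
    by apply: is_deriveN.
  have := @is_derive1_comp _ _ (fun z : R => - (1 - z ^+ 2)^-1) x _ _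
    (is_derive_expR (- (1 - x ^+ 2)^-1)) dN.
  by rewrite mulrC.
have dk : is_derive x 1 (fun z : R => ((1 - z ^+ 2)^-1) ^+ k)
    (k%:R * (1 - x ^+ 2)^-1 ^+ k.-1 * (2 * x / (1 - x ^+ 2) ^+ 2)).
  have -> : (fun z : R => (1 - z ^+ 2)^-1 ^+ k) = (fun z : R => (1 - z ^+ 2)^-1) ^+ k.
    by rewrite exprfctE.
  exact: (is_deriveX k dV).
have := is_deriveM (is_deriveM (is_derive_poly p x) dk) de.
move=> H; apply: (is_derive_eq H); rewrite /GRing.scale/= -[(_ * _)%R x]/(p.[x] * (1 - x ^+ 2)^-1 ^+ k).
rewrite /dbump 6!(hornerD, hornerN, hornerM) !hornerE/=.
(* For [k = 0] the truncated [k.-1] does no harm: both sides are 0. *)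
have kE : k%:R * (1 - x ^+ 2)^-1 ^+ k.-1 = k%:R * (1 - x ^+ 2)^-1 ^+ k * (1 - x ^+ 2).
  by case: (k) => [|n]; rewrite ?mul0r// (exprSr _ n) -!mulrA mulVf// mulr1.
rewrite -!(mulrA _ k%:R) kE; set E := expR _; set q := _^-1 ^+ k.
by field.
Qed.

(** Still closed under differentiation, and large enough to contain [moll h y], [dmoll h y], and
    [dmoll] as a function of its centre. *)
Definition abump p k (c m d : R) : R -> R := fun x => c * bumpp p k (m * x + d).

Lemma is_derive_abump p k c m d x :
  is_derive x 1 (abump p k c m d) (abump (dbump p k) k.+2 (c * m) m d x).
Proof.
have da : is_derive x 1 (fun x : R => m * x + d) m.
  by apply: is_derive_eq; rewrite /GRing.scale/= ; ring.
have H := @is_derive1_comp _ _ (fun x : R => m * x + d) x _ _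
  (is_derive_bumpp p k (m * x + d)) da.
apply: (is_derive_eq (is_deriveZ c H)).
rewrite /abump /GRing.scale/=; ring.
Qed.

Lemma smooth_abump p k c m d : smooth (abump p k c m d).
Proof.
apply: (@smooth_coind (fun f => exists p k c, f = abump p k c m d)); last by exists p, k, c.
move=> _ [p1 [k1 [c1 ->]]]; exists (abump (dbump p1 k1) k1.+2 (c1 * m) m d).
  by do 3!eexists.
by move=> x; apply: is_derive_abump.
Qed.

Lemma derive1n_is_derive f g n : (forall x, is_derive x 1 f (g x)) ->
  derive1n n.+1 f = derive1n n g.
Proof.
move=> H; rewrite derive1Sn; congr derive1n.
by apply/funext => x; rewrite derive1E; apply/derive_val.
Qed.

Lemma smooth_antiderivative f g : (forall x, is_derive x 1 f (g x)) ->
  smooth g -> smooth f.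
Proof.
move=> H sg [|n] x; first exact: (@ex_derive _ _ _ _ _ _ _ (H x)).
by rewrite (derive1n_is_derive _ H).
Qed.

Lemma smoothD f g : smooth f -> smooth g -> smooth (f \+ g).
Proof.
move=> sf sg; apply: (@smooth_coind (fun h => exists f g, [/\ smooth f, smooth g & h = f \+ g])); last by exists f, g.
have sd (k : R -> R) : smooth k -> smooth (derive1 k) by move=> sk n x; rewrite -derive1Sn.
have isd k : smooth k -> forall x, is_derive x 1 k (derive1 k x).
  by move=> sk x; rewrite derive1E; apply/derivableP/(sk 0%N).
move=> _ [f1 [g1 [sf1 sg1 ->]]]; exists (derive1 f1 \+ derive1 g1).
  by exists (derive1 f1), (derive1 g1); split; [exact: sd sf1|exact: sd sg1|].
by move=> x; apply: is_deriveD; exact: isd.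
Qed.

Notation mu := (@lebesgue_measure R).

Definition bump0 : R -> R := abump 1 0 1 1 0.

Lemma bump0E x : bump0 x = if `|x| < 1 then expR (- (1 - x ^+ 2)^-1) else 0.
Proof.
rewrite /bump0 /abump /bumpp !mul1r addr0; case: ifP => // _.
by rewrite -polyC1 hornerC expr0 !mul1r.
Qed.

Lemma bump0_ge0 x : 0 <= bump0 x.
Proof. by rewrite bump0E; case: ifPn => // _; exact: expR_ge0. Qed.

Lemma abump_continuous p k c m d : continuous (abump p k c m d).
Proof.
move=> x; apply/differentiable_continuous/derivable1_diffP.
exact: (@ex_derive _ _ _ _ _ _ _ (is_derive_abump p k c m d x)).
Qed.

Lemma bump0_integrable a b : mu.-integrable `[a, b] (EFin \o bump0).
Proof.
apply: continuous_compact_integrable; first exact: segment_compact.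
by apply: continuous_subspaceT; exact: abump_continuous.
Qed.

(** Any base point up to -1 gives the same function. With -2 the two regimes of the derivative, the
    fundamental theorem and the locally zero function, overlap, and -1 needs no one-sided
    argument. *)
Definition step0 x : R := \int[mu]_(t in `[-2, x]) bump0 t.

Lemma is_derive_step0 x : is_derive x 1 step0 (bump0 x).
Proof.
have [x2|x2] := ltP (-2) x.
  have H := @continuous_FTC1_closed R bump0 (-2) x (x + 1).
  have [] := H _ (bump0_integrable _ _) x2.
  - by rewrite ltrDl.
  - exact: abump_continuous.
  - by move=> d1 d2; rewrite -d2 derive1E; apply/derivableP.
have -> : bump0 x = 0.
  rewrite bump0E ifF//; apply/negbTE; rewrite -leNgt ler_normr; apply/orP; right; lra.
suff : is_derive x 1 (cst (0:R)) 0.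
  apply: near_eq_is_derive; near=> y.
  rewrite /step0; apply/esym; under eq_Rintegral.
    move=> t; rewrite inE/= in_itv/= => /andP[_ ty].
    have y1 : y < -1 by near: y; apply: lt_nbhsl; lra.
    rewrite bump0E ifF; last first.
      by apply/negbTE; rewrite -leNgt ler_normr; apply/orP; right; lra.
    over.
  by rewrite Rintegral_cst//= mul0r.
exact: is_derive_cst.
Unshelve. all: by end_near. Qed.

Lemma step0_le x : x <= -1 -> step0 x = 0.
Proof.
move=> x1; rewrite /step0; under eq_Rintegral.
  move=> t; rewrite inE/= in_itv/= => /andP[_ ty].
  rewrite bump0E ifF; last first.
    by apply/negbTE; rewrite -leNgt ler_normr; apply/orP; right; lra.
  over.
by rewrite Rintegral_cst//= mul0r.
Qed.

Lemma step0_mono : {homo step0 : x y / x <= y}.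
Proof.
move=> x y xy.
have D z : derivable step0 z 1 by exact: (@ex_derive _ _ _ _ _ _ _ (is_derive_step0 z)).
apply: (@ger0_derive1_ndecr _ _ x y) => // [z _|].
  by rewrite derive1E (@derive_val _ _ _ _ _ _ _ (is_derive_step0 z)) bump0_ge0.
by apply: derivable_within_continuous => z _.
Qed.

Lemma step0_ge x : 1 <= x -> step0 x = step0 1.
Proof.
rewrite le_eqVlt => /predU1P[<-//|x1].
have [||c cx] := @MVT _ step0 bump0 _ _ x1.
- by move=> z _; exact: is_derive_step0.
- apply: derivable_within_continuous => z _.
  exact: (@ex_derive _ _ _ _ _ _ _ (is_derive_step0 z)).
rewrite bump0E ifF ?mul0r => [/eqP|]; first by rewrite subr_eq0 => /eqP.
by apply/negbTE; rewrite -leNgt ler_normr; move: cx; rewrite in_itv/= => /andP[/ltW ->].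
Qed.

Lemma step01_gt0 : 0 < step0 1.
Proof.
(* On [-1/2, 1/2] [bump0] is given by its positive formula, so the mean value theorem yields a
   strict increase. *)
have [|||c cx] := @MVT _ step0 bump0 (-2^-1) 2^-1.
- lra.
- by move=> z _; exact: is_derive_step0.
- apply: derivable_within_continuous => z _.
  exact: (@ex_derive _ _ _ _ _ _ _ (is_derive_step0 z)).
have E : step0 (-2^-1) < step0 2^-1 -> 0 < step0 1.
  move=> H; apply: (@le_lt_trans _ _ (step0 (-2^-1))).
    by rewrite -(@step0_le (-1))//; apply: step0_mono; lra.
  by apply: (lt_le_trans H); apply: step0_mono; lra.
move=> H; apply: E; rewrite -subr_gt0 H; apply: mulr_gt0; last lra.
rewrite bump0E ifT ?expR_gt0//.
by rewrite ltr_norml; move: cx; rewrite in_itv/= => /andP[? ?]; apply/andP; split; lra.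
Qed.

(** [step0 1] is the total mass of [bump0]; thus [bump] has integral 1 and [step] is its
    distribution function. *)
Definition bump : R -> R := abump 1 0 (step0 1)^-1 1 0.
Definition dbump1 : R -> R := abump (dbump 1 0) 2 (step0 1)^-1 1 0.
Definition step x : R := (step0 1)^-1 * step0 x.

Lemma bumpE x : bump x = (step0 1)^-1 * bump0 x.
Proof. by rewrite /bump /bump0 /abump (mul1r (bumpp _ _ _)). Qed.

Lemma bump_ge0 x : 0 <= bump x.
Proof. by rewrite bumpE mulr_ge0 ?bump0_ge0// invr_ge0 ltW// step01_gt0. Qed.

Lemma bump_out x : 1 <= `|x| -> bump x = 0.
Proof. by move=> x1; rewrite bumpE bump0E ltNge x1 mulr0. Qed.

Lemma is_derive_bump x : is_derive x 1 bump (dbump1 x).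
Proof. by rewrite /bump; have := is_derive_abump 1 0 (step0 1)^-1 1 0 x; rewrite mulr1. Qed.

Lemma is_derive_step x : is_derive x 1 step (bump x).
Proof. by rewrite bumpE; apply: is_deriveZ; exact: is_derive_step0. Qed.

Lemma step_le x : x <= -1 -> step x = 0.
Proof. by move=> x1; rewrite /step (step0_le x1) mulr0. Qed.

Lemma step_ge x : 1 <= x -> step x = 1.
Proof. by move=> x1; rewrite /step step0_ge// mulVf// gt_eqF// step01_gt0. Qed.

Lemma step_mono : {homo step : x y / x <= y}.
Proof. by move=> x y xy; rewrite ler_wpM2l ?step0_mono// invr_ge0 ltW// step01_gt0. Qed.

Lemma step_ge0 x : 0 <= step x.
Proof.
have [x1|x1] := leP x (-1); first by rewrite step_le.
by rewrite -(@step_le (-1))//; apply/step_mono/ltW.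
Qed.

Lemma step_le1 x : step x <= 1.
Proof.
have [x1|x1] := leP 1 x; first by rewrite step_ge.
by rewrite -(@step_ge 1)//; apply/step_mono/ltW.
Qed.

End Bump.

(** * Integration and mollification *)

Section MeasureBasics.
Context {R : realType}.
Notation mu := (@lebesgue_measure R).

Import HBNNSimple.

Lemma proj_nnsfunE d (T : measurableType d) (h : {nnsfun T >-> R}) (A : set T)
  (mA : measurable A) x : proj_nnsfun h mA x = h x * (x \in A)%:R.
Proof. by []. Qed.

(** Cutting [h] to [A] changes only the level set of 0 beyond intersecting with [A], and that one
    has weight 0. Used to restrict the measure to an interval and to discard a null set. *)
Lemma sintegral_proj d (T : measurableType d) (m1 m2 : {measure set T -> \bar R})
    (h : {nnsfun T >-> R}) (A : set T) (mA : measurable A) :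
  (forall B, measurable B -> m1 B = m2 (B `&` A)) ->
  sintegral m1 h = sintegral m2 (proj_nnsfun h mA).
Proof.
move=> H; apply: eq_fsbigr => x _.
have [->|x0] := eqVneq x 0; first by rewrite !mul0e.
rewrite H//; congr (_ * m2 _)%E; apply/seteqP; split=> y; rewrite /preimage/set1/mkset proj_nnsfunE/=.
  by move=> [<- Ay]; rewrite mem_set// mulr1.
case: (boolP (y \in A)) => yA; last first.
  by rewrite mulr0 => x00; rewrite -x00 eqxx in x0.
by rewrite mulr1 => <-; split => //; exact: set_mem.
Qed.

(* Stated without measurability because [t |-> N (w t)], for [w] in a Bochner
   space, is not assumed to be measurable. *)
Lemma ae_le_integral_nonmeas d (T : measurableType d) (m : {measure set T -> \bar R})
    (D : set T) (f g : T -> \bar R) :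
  (forall x, D x -> 0 <= f x)%E -> (forall x, D x -> 0 <= g x)%E ->
  {ae m, forall x, D x -> (f x <= g x)%E} ->
  (\int[m]_(x in D) f x <= \int[m]_(x in D) g x)%E.
Proof.
move=> f0 g0 [N [mN N0 HN]].
have fD0 x : (0 <= (f \_ D) x)%E by rewrite patchE; case: ifPn => // /set_mem/f0.
have gD0 x : (0 <= (g \_ D) x)%E by rewrite patchE; case: ifPn => // /set_mem/g0.
rewrite /integral.
have E0 : (forall h : T -> \bar R, (forall x, 0 <= h x) -> h^\- = cst 0)%E.
  by move=> h h0; apply/funext => x; rewrite (@ge0_funenegE _ _ setT) ?in_setT.
have E1 : (forall h : T -> \bar R, (forall x, 0 <= h x) -> h^\+ = h)%E.
  by move=> h h0; apply/funext => x; rewrite (@ge0_funeposE _ _ setT) ?in_setT.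
rewrite !E0// !E1// leeB// ge_ereal_sup => //= _ [h hf <-].
have mNC : measurable (~` N) by exact: measurableC.
rewrite (@sintegral_proj _ _ m m h (~` N) mNC).
  apply: ereal_sup_ubound; exists (proj_nnsfun h mNC) => // x.
  rewrite proj_nnsfunE; case: (boolP (x \in ~` N)) => xN; last by rewrite mulr0 gD0.
  rewrite mulr1; apply: (le_trans (hf x)); rewrite !patchE; case: ifPn => // /set_mem Dx.
  move/set_mem : xN => xN.
  by have := contrapT (fun k => xN (HN x k)); exact.
move=> B mB; rewrite [LHS](@measureDI _ _ _ m B N)// setDE.
rewrite [X in (_ + X)%E](_ : _ = 0%E) ?adde0//.
apply/eqP; rewrite eq_le measure_ge0 andbT -N0.
by apply: le_measure; rewrite ?inE//; exact: measurableI.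
Qed.

Lemma ae_eq_integral_nonmeas d (T : measurableType d) (m : {measure set T -> \bar R})
    (D : set T) (f g : T -> \bar R) :
  {ae m, forall x, D x -> f x = g x} ->
  (\int[m]_(x in D) f x = \int[m]_(x in D) g x)%E.
Proof.
move=> fg.
have fg' : {ae m, forall x, D x -> g x = f x} by apply: filterS fg => x + Dx => ->.
rewrite integralE [RHS]integralE; congr (_ - _)%E; apply/eqP; rewrite eq_le; apply/andP; split;
  (apply: ae_le_integral_nonmeas => //; apply: filterS fg => x /[apply]; rewrite ?funeposE ?funenegE => ->; exact: lexx).
Qed.

(** The identity is checked on the simple functions below the positive and negative parts, so [f] is
    arbitrary; norms of Bochner maps are not known to be measurable. *)
Lemma leb_integral (a b : R) (f : R -> \bar R) :
  (\int[leb a b]_x f x = \int[mu]_(x in `]a, b[) f x)%E.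
Proof.
have key (g : R -> \bar R) : (forall x, 0 <= g x)%E ->
  ereal_sup [set sintegral (leb a b) h | h in [set h : {nnsfun measurableTypeR R >-> R} | forall x, (h x)%:E <= g x]]%E
  = ereal_sup [set sintegral mu h | h in [set h : {nnsfun measurableTypeR R >-> R} | forall x, (h x)%:E <= (g \_ `]a, b[) x]]%E.
  move=> g0; have mI : measurable (`]a, b[ : set (measurableTypeR R)) by [].
  have S (h : {nnsfun measurableTypeR R >-> R}) :
      sintegral (leb a b) h = sintegral mu (proj_nnsfun h mI).
    exact: sintegral_proj.
  congr ereal_sup; apply/seteqP; split => _ [h hg <-]; rewrite ?S.
    exists (proj_nnsfun h mI) => // x; rewrite patchE proj_nnsfunE.
    by case: ifPn => _; rewrite ?mulr1 ?mulr0 ?hg.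
  exists h => //=.
    by move=> x; apply: (le_trans (hg x)); rewrite patchE; case: ifPn.
  rewrite S; apply: eq_sintegral => x; rewrite proj_nnsfunE.
  case: (boolP (x \in _)) => xD; rewrite ?mulr1// mulr0.
  apply/eqP; rewrite eq_le fun_ge0/= -lee_fin.
  by apply: (le_trans (hg x)); rewrite patchE ifF//; apply/negbTE.
rewrite /integral patch_setT; congr (_ - _)%E.
  by rewrite key ?funepos_ge0//; do 2!f_equal; rewrite funepos_restrict.
by rewrite key ?funeneg_ge0//; do 2!f_equal; rewrite funeneg_restrict.
Qed.

Lemma leb_Rintegral (a b : R) (f : R -> R) :
  \int[leb a b]_x f x = \int[mu]_(x in `]a, b[) f x.
Proof. by rewrite /Rintegral leb_integral. Qed.

Lemma leb_ae (a b : R) (P : R -> Prop) :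
  {ae leb a b, forall x, P x} <-> {ae mu, forall x, `]a, b[%classic x -> P x}.
Proof.
split=> -[A [mA A0 H]].
  exists (A `&` `]a, b[); split => //; first exact: measurableI.
  by move=> x /= /not_implyP[xD nP]; split => //; exact: H.
have mI : measurable (`]a, b[ : set (measurableTypeR R)) by [].
exists (A `|` ~` `]a, b[); split.
- by apply: measurableU => //; exact: measurableC.
- change (mu ((A `|` ~` `]a, b[) `&` `]a, b[) = 0%E); rewrite setIUl setICl setU0; apply/eqP; rewrite -measure_le0.
  by rewrite -A0 le_measure ?inE//; exact: measurableI.
- move=> x nP; case: (pselect (`]a, b[%classic x)) => xD; last by right.
  by left; apply: H => /= /(_ xD).
Qed.
End MeasureBasics.

(** * Mollifiers and smooth plateaus *)

Section Moll.
Context {R : realType}.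
Implicit Types (h x y z a b : R).
Notation mu := (@lebesgue_measure R).

Definition moll h y z : R := h^-1 * bump ((z - y) / h).
Definition dmoll h y z : R := h^-1 * (h^-1 * dbump1 ((z - y) / h)).

Lemma is_derive_scaled (f g : R -> R) (m d x : R) : (forall x, is_derive x 1 f (g x)) ->
  is_derive x 1 (fun x => f (m * x + d)) (m * g (m * x + d)).
Proof.
move=> H.
have da : is_derive x 1 (fun x : R => m * x + d) m.
  by apply: is_derive_eq; rewrite /GRing.scale/= ; ring.
by have := @is_derive1_comp _ _ (fun x : R => m * x + d) x _ _ (H (m * x + d)) da; rewrite mulrC.
Qed.

Lemma is_derive_moll h y z : is_derive z 1 (moll h y) (dmoll h y z).
Proof.
have -> : moll h y = h^-1 \*: (fun z => bump (h^-1 * z + - y / h)).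
  by apply/funext => x; rewrite /moll/=; congr (_ * bump _); ring.
apply: is_deriveZ; have := @is_derive_scaled bump dbump1 h^-1 (- y / h) z is_derive_bump.
by congr is_derive; congr (_ * dbump1 _); ring.
Qed.

Lemma is_derive_moll_center h y z : is_derive y 1 (fun y => moll h y z) (- dmoll h y z).
Proof.
have -> : (fun y => moll h y z) = h^-1 \*: (fun y => bump (- h^-1 * y + z / h)).
  by apply/funext => x; rewrite /moll/=; congr (_ * bump _); ring.
have -> : - dmoll h y z = h^-1 *: (- h^-1 * dbump1 (- h^-1 * y + z / h)).
  rewrite /dmoll /GRing.scale/= mulNr mulrN; congr (- (_ * (_ * dbump1 _))); ring.
apply: is_deriveZ; exact: (@is_derive_scaled bump dbump1 (- h^-1) (z / h) y is_derive_bump).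
Qed.

Lemma mollE h y : moll h y = abump 1 0 (h^-1 * (step0 1)^-1) h^-1 (- y / h).
Proof.
apply/funext => z; rewrite /moll /bump /abump [LHS]mulrA; congr (_ * bumpp _ _ _); ring.
Qed.

Lemma dmollE h y : dmoll h y = abump (dbump 1 0) 2 (h^-1 * (h^-1 * (step0 1)^-1)) h^-1 (- y / h).
Proof.
apply/funext => z; rewrite /dmoll /dbump1 /abump !mulrA; congr (_ * bumpp _ _ _); ring.
Qed.

Lemma moll_ge0 h y z : 0 < h -> 0 <= moll h y z.
Proof. by move=> h0; rewrite mulr_ge0 ?bump_ge0// invr_ge0 ltW. Qed.

Lemma moll_out h y z : 0 < h -> h <= `|z - y| -> moll h y z = 0.
Proof.
move=> h0 hz; rewrite /moll bump_out ?mulr0// normrM normfV (gtr0_norm h0).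
by rewrite ler_pdivlMr// mul1r.
Qed.

Lemma abump_bounded p k (c m d : R) : exists2 C : R, 0 <= C & forall x, `|abump p k c m d x| <= C.
Proof.
have [C C0 HC] := bumpp_bounded p k; exists (`|c| * C) => [|x]; first exact: mulr_ge0.
by rewrite normrM ler_wpM2l.
Qed.

Lemma moll_bounded h : exists2 C : R, 0 <= C & forall y z, `|moll h y z| <= C.
Proof.
have [C C0 HC] := @abump_bounded 1 0 (step0 1)^-1 1 0; exists (`|h^-1| * C) => [|y z]; first exact: mulr_ge0.
by rewrite normrM ler_wpM2l//; exact: HC.
Qed.

Lemma dmoll_bounded h : exists2 C : R, 0 <= C & forall y z, `|dmoll h y z| <= C.
Proof.
have [C C0 HC] := @abump_bounded (dbump 1 0) 2 (step0 1)^-1 1 0.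
exists (`|h^-1| * (`|h^-1| * C)) => [|y z]; first by rewrite !mulr_ge0.
by rewrite normrM ler_wpM2l// normrM ler_wpM2l//; exact: HC.
Qed.

Lemma moll_continuous h y : continuous (moll h y).
Proof. by rewrite mollE; exact: abump_continuous. Qed.

Lemma dmoll_continuous h y : continuous (dmoll h y).
Proof. by rewrite dmollE; exact: abump_continuous. Qed.

Lemma smooth_moll h y : smooth (moll h y).
Proof. by rewrite mollE; exact: smooth_abump. Qed.

Lemma derive1_moll h y : derive1 (moll h y) = dmoll h y.
Proof. by apply/funext => z; rewrite derive1E; apply/derive_val/is_derive_moll. Qed.

Lemma test_moll a b h y : 0 < h -> a < y - h -> y + h < b -> test_fun a b (moll h y).
Proof.
move=> h0 ah hb; split; first exact: smooth_moll.
exists (y - h), (y + h); split => // x; apply: contraR => nx.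
apply/eqP; apply: moll_out => //; rewrite leNgt; apply: contra nx.
by rewrite ltr_distl => /andP[/ltW-> /ltW->].
Qed.

Lemma Rintegral_oo_cc (a b : R) (f : R -> R) : mu.-integrable `[a, b] (EFin \o f) ->
  \int[mu]_(x in `]a, b[) f x = \int[mu]_(x in `[a, b]) f x.
Proof.
move=> H; rewrite Rintegral_itv_bndo_bndc.
  rewrite Rintegral_itv_obnd_cbnd//; apply: integrableS H => //.
  exact: subset_itv_oc_cc.
by apply: integrableS H => //; exact: subset_itv_oo_cc.
Qed.

Lemma continuous_integrable a b (f : R -> R) : {within `[a, b], continuous f} ->
  mu.-integrable `[a, b] (EFin \o f).
Proof. by move=> cf; apply: continuous_compact_integrable => //; exact: segment_compact. Qed.

Lemma continuous_integrable_oo a b (f : R -> R) : {within `[a, b], continuous f} ->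
  mu.-integrable `]a, b[ (EFin \o f).
Proof.
by move=> cf; apply: integrableS (continuous_integrable cf) => //; exact: subset_itv_oo_cc.
Qed.

Lemma RFTC2 (F f : R -> R) a b : a <= b -> (forall x, is_derive x 1 F (f x)) ->
  {within `[a, b], continuous f} ->
  \int[mu]_(x in `[a, b]) f x = F b - F a.
Proof.
rewrite le_eqVlt => /predU1P[<- _ _|ab dF cf].
  by rewrite set_itv1 Rintegral_set1 subrr.
rewrite /Rintegral (@continuous_FTC2 _ f F)//.
- split.
  + by move=> x _; exact: (@ex_derive _ _ _ _ _ _ _ (dF x)).
  + apply/cvg_at_right_filter/differentiable_continuous/derivable1_diffP.
    exact: (@ex_derive _ _ _ _ _ _ _ (dF a)).
  + apply/cvg_at_left_filter/differentiable_continuous/derivable1_diffP.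
    exact: (@ex_derive _ _ _ _ _ _ _ (dF b)).
- by move=> x _; rewrite derive1E; apply/derive_val.
Qed.

Lemma moll_integral h y a b : 0 < h -> a <= y - h -> y + h <= b ->
  \int[mu]_(x in `]a, b[) moll h y x = 1.
Proof.
move=> h0 ah hb; have ab : a <= b by lra.
have cm : {within `[a, b], continuous (moll h y)} by apply: continuous_subspaceT; exact: moll_continuous.
rewrite Rintegral_oo_cc; last exact: continuous_integrable.
have ds x : is_derive x 1 (fun z => step ((z - y) / h)) (moll h y x).
  have -> : (fun z => step ((z - y) / h)) = (fun z => step (h^-1 * z + - y / h)).
    by apply/funext => z; congr step; ring.
  have := @is_derive_scaled step bump h^-1 (- y / h) x is_derive_step.
  by congr is_derive; rewrite /moll; congr (_ * bump _); ring.
rewrite (RFTC2 ab ds cm) step_ge ?step_le ?subr0//; first by rewrite ler_pdivrMr//; lra.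
by rewrite ler_pdivlMr//; lra.
Qed.

Lemma moll_integrable h y a b : mu.-integrable `]a, b[ (EFin \o moll h y).
Proof. apply: continuous_integrable_oo; apply: continuous_subspaceT; exact: moll_continuous. Qed.

(** A smooth approximation of the indicator of ]s, t[, rising on [s + e, s + 3e] and falling on
    [t - 3e, t - e]. The shift by [2 e] keeps it a test function even when [s] and [t] are the ends
    of the ambient interval, and its derivative is a difference of two mollifiers. *)
Definition plateau e s t z : R := step ((z - s) / e - 2) - step ((z - t) / e + 2).

Lemma is_derive_plateau e s t z : 0 < e ->
  is_derive z 1 (plateau e s t) (moll e (s + 2 * e) z - moll e (t - 2 * e) z).
Proof.
move=> e0; have e0' : e != 0 by rewrite gt_eqF.
apply: is_deriveB.
  have := @is_derive_scaled step bump e^-1 (- s / e - 2) z is_derive_step.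
  have -> : (fun x => step (e^-1 * x + (- s / e - 2))) = (fun x => step ((x - s) / e - 2)).
    by apply/funext => x; congr step; ring.
  by congr is_derive; rewrite /moll; congr (_ * bump _); field.
have := @is_derive_scaled step bump e^-1 (- t / e + 2) z is_derive_step.
have -> : (fun x => step (e^-1 * x + (- t / e + 2))) = (fun x => step ((x - t) / e + 2)).
  by apply/funext => x; congr step; ring.
by congr is_derive; rewrite /moll; congr (_ * bump _); field.
Qed.

Lemma smooth_plateau e s t : 0 < e -> smooth (plateau e s t).
Proof.
move=> e0; apply: (smooth_antiderivative (fun z => is_derive_plateau s t z e0)).
have -> : (fun z => moll e (s + 2 * e) z - moll e (t - 2 * e) z) =
    moll e (s + 2 * e) \+ abump 1 0 (- (e^-1 * (step0 1)^-1)) e^-1 (- (t - 2 * e) / e).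
  by apply/funext => z /=; congr (_ + _); rewrite mollE /abump [RHS]mulNr.
by apply: smoothD; [exact: smooth_moll|exact: smooth_abump].
Qed.

Lemma plateau_in e s t z : 0 < e -> s + 3 * e <= z -> z <= t - 3 * e -> plateau e s t z = 1.
Proof.
move=> e0 sz zt; rewrite /plateau step_ge ?step_le ?subr0//.
  by rewrite -lerBrDr ler_pdivrMr//; lra.
by rewrite lerBrDr ler_pdivlMr//; lra.
Qed.

Lemma plateau_out e s t z : 0 < e -> 4 * e <= t - s -> (z <= s + e) || (t - e <= z) -> plateau e s t z = 0.
Proof.
move=> e0 st; rewrite /plateau => /orP[zs|zt].
  rewrite !step_le ?subr0//.
    by rewrite -lerBrDr ler_pdivrMr//; lra.
  by rewrite lerBlDr ler_pdivrMr//; lra.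
rewrite !step_ge ?subrr//.
  by rewrite -lerBlDr ler_pdivlMr//; lra.
by rewrite lerBrDr ler_pdivlMr//; lra.
Qed.

Lemma plateau_le1 e s t z : `|plateau e s t z| <= 1.
Proof.
rewrite ler_norml; have := step_ge0 ((z - s) / e - 2); have := step_ge0 ((z - t) / e + 2).
have := step_le1 ((z - s) / e - 2); have := step_le1 ((z - t) / e + 2).
by rewrite /plateau; lra.
Qed.

Lemma test_plateau e s t a b : 0 < e -> 4 * e <= t - s -> a <= s -> t <= b ->
  test_fun a b (plateau e s t).
Proof.
move=> e0 st as_ tb; split; first exact: smooth_plateau.
exists (s + e), (t - e); split; [lra|lra|move=> x; apply: contraR => nx].
apply/eqP; apply: plateau_out => //; move: nx; rewrite negb_and -!ltNge.
by move=> /orP[/ltW ->//|/ltW ->]; rewrite orbT.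
Qed.

Lemma derive1_plateau e s t : 0 < e ->
  derive1 (plateau e s t) = fun z => moll e (s + 2 * e) z - moll e (t - 2 * e) z.
Proof. by move=> e0; apply/funext => z; rewrite derive1E; apply/derive_val/is_derive_plateau. Qed.
End Moll.

(** * Integrability and dominated convergence for real-valued functions *)

Section Rdct.
Context d (T : measurableType d) {R : realType} (m : {measure set T -> \bar R}).
Variables (D : set T) (mD : measurable D).
Implicit Types f g : T -> R.

Lemma Rintegrable_measurable f : m.-integrable D (EFin \o f) -> measurable_fun D f.
Proof. by move=> /measurable_int/measurable_EFinP. Qed.

Lemma RintegrableB f g : m.-integrable D (EFin \o f) -> m.-integrable D (EFin \o g) ->
  m.-integrable D (EFin \o (fun x => f x - g x)).
Proof. by move=> i1 i2; have := integrableB mD i1 i2; apply: eq_integrable. Qed.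

Lemma RintegrableD f g : m.-integrable D (EFin \o f) -> m.-integrable D (EFin \o g) ->
  m.-integrable D (EFin \o (fun x => f x + g x)).
Proof. by move=> i1 i2; have := integrableD mD i1 i2; apply: eq_integrable. Qed.

Lemma RintegrableZ (c : R) f : m.-integrable D (EFin \o f) ->
  m.-integrable D (EFin \o (fun x => c * f x)).
Proof. by move=> i1; have := integrableZl mD c i1; apply: eq_integrable. Qed.

Lemma Rintegrable_norm f : m.-integrable D (EFin \o f) ->
  m.-integrable D (EFin \o (fun x => `|f x|)).
Proof. by move=> i1; have := integrable_norm i1. Qed.

Lemma Rdominated_convergence (f_ : nat -> T -> R) f g :
  (forall n, measurable_fun D (f_ n)) -> measurable_fun D f ->
  {ae m, forall x, D x -> f_ n x @[n --> \oo] --> f x} ->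
  m.-integrable D (EFin \o g) ->
  {ae m, forall x, D x -> forall n, `|f_ n x| <= g x} ->
  m.-integrable D (EFin \o f) /\
  \int[m]_(x in D) f_ n x @[n --> \oo] --> \int[m]_(x in D) f x.
Proof.
move=> mf_ mf cf ig fg.
have [||||intf _ cv] := @dominated_convergence _ _ _ m D mD
    (fun n x => (f_ n x)%:E) (EFin \o f) (EFin \o g) _ _ _ ig.
- by move=> n; apply/measurable_EFinP.
- exact/measurable_EFinP.
- by apply: filterS cf => x H Dx; apply: cvg_EFin; [exact: nearW|exact: H].
- by apply: filterS fg => x H n Dx; rewrite lee_fin H.
split => //.
apply: fine_cvg; rewrite fineK; first exact: cv.
exact: integrable_fin_num.
Qed.

Lemma integrable_bounded_mul f g C : measurable_fun D f ->
  (forall x, D x -> `|f x| <= C) -> m.-integrable D (EFin \o g) ->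
  m.-integrable D (EFin \o (fun x => f x * g x)).
Proof.
move=> mf fC ig.
have mg : measurable_fun D g by exact: Rintegrable_measurable ig.
apply: (@le_integrable _ _ _ m D mD _ (fun x => (C * `|g x|)%:E)).
- by apply/measurable_EFinP/measurable_funM.
- move=> x Dx /=; rewrite lee_fin normrM (ger0_norm (_ : 0 <= C * `|g x|)) ?ler_wpM2r ?fC//.
  by rewrite mulr_ge0// (le_trans _ (fC x Dx)).
- under eq_fun do rewrite EFinM.
  by apply: integrableZl => //; exact: (integrable_norm ig).
Qed.

Lemma le_integrableR f g : measurable_fun D f ->
  (forall x, D x -> `|f x| <= g x) -> m.-integrable D (EFin \o g) ->
  m.-integrable D (EFin \o f).
Proof.
move=> mf fg ig; apply: (le_integrable _ _ _ ig) => //.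
  exact/measurable_EFinP.
by move=> x Dx /=; rewrite lee_fin (le_trans (fg x Dx))// ler_norm.
Qed.
Lemma ae_eq_Rintegral f g :
  {ae m, forall x, D x -> f x = g x} ->
  \int[m]_(x in D) f x = \int[m]_(x in D) g x.
Proof.
move=> H; congr fine; apply: ae_eq_integral_nonmeas.
by apply: filterS H => x /[apply] ->.
Qed.
End Rdct.

(** * From weak derivatives to increments *)

Section WeakFTC.
Context {R : realType}.
Implicit Types (h x y z a b s t e : R) (f g c : R -> R).
Notation mu := (@lebesgue_measure R).

Lemma moll_mul_integrable a b h y f : mu.-integrable `]a, b[ (EFin \o f) ->
  mu.-integrable `]a, b[ (EFin \o (fun z => moll h y z * f z)).
Proof.
have [C C0 HC] := moll_bounded h.
apply: (@integrable_bounded_mul _ _ _ _ _ _ _ _ C) => //.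
apply: measurable_funTS; apply: continuous_measurable_fun; exact: moll_continuous.
Qed.

Lemma dmoll_mul_integrable a b h y f : mu.-integrable `]a, b[ (EFin \o f) ->
  mu.-integrable `]a, b[ (EFin \o (fun z => dmoll h y z * f z)).
Proof.
have [C C0 HC] := dmoll_bounded h.
apply: (@integrable_bounded_mul _ _ _ _ _ _ _ _ C) => //.
apply: measurable_funTS; apply: continuous_measurable_fun; exact: dmoll_continuous.
Qed.

(** As the mollifier has mass 1, the deviation is an average of [f - C] over the window
    [|z - y| < h]. *)
Lemma moll_avg a b h y f (C e : R) : 0 < h -> a <= y - h -> y + h <= b ->
  mu.-integrable `]a, b[ (EFin \o f) ->
  (forall z, a < z < b -> `|z - y| < h -> `|f z - C| <= e) ->
  `|\int[mu]_(z in `]a, b[) (moll h y z * f z) - C| <= e.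
Proof.
move=> h0 ah hb intf H.
have I1 := moll_integrable h y a b.
have I2 := moll_mul_integrable h y intf.
have I3 : mu.-integrable `]a, b[ (EFin \o (fun z => moll h y z * C)).
  have -> : (fun z => moll h y z * C) = (fun z => C * moll h y z) by apply/funext => z; rewrite mulrC.
  exact: (integrableZl _ C I1).
have I4 : mu.-integrable `]a, b[ (EFin \o (fun z => moll h y z * e)).
  have -> : (fun z => moll h y z * e) = (fun z => e * moll h y z) by apply/funext => z; rewrite mulrC.
  exact: (integrableZl _ e I1).
have -> : C = \int[mu]_(z in `]a, b[) (moll h y z * C).
  by rewrite RintegralZr// moll_integral// mul1r.
rewrite -RintegralB//.
have I5 : mu.-integrable `]a, b[ (EFin \o (fun z => moll h y z * f z - moll h y z * C)) by exact: RintegrableB.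
apply: (le_trans (le_normr_Rintegral _ I5)) => //.
have -> : e = \int[mu]_(z in `]a, b[) (moll h y z * e).
  by rewrite RintegralZr// moll_integral// mul1r.
apply: le_Rintegral => //.
  exact: (integrable_norm I5).
move=> z /=; rewrite in_itv/= => zab.
rewrite -mulrBr normrM (ger0_norm (moll_ge0 _ _ h0)).
have [zh|zh] := ltP `|z - y| h; last by rewrite moll_out// !mul0r.
by rewrite ler_wpM2l ?moll_ge0// H.
Qed.

Lemma within_continuous_le a b c x e : {within `[a, b], continuous c} -> 0 < e ->
  a <= x <= b -> exists2 d : R, 0 < d & forall z, a <= z <= b -> `|z - x| < d -> `|c z - c x| <= e.
Proof.
move=> /subspace_continuousP H e0 xab.
have := H x; rewrite /= in_itv/= => /(_ xab) /cvgrPdist_le /(_ e e0).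
rewrite near_withinE near_simpl => -[d /= d0 Hd]; exists d => // z zab zx.
by rewrite distrC; apply: Hd; rewrite /= ?in_itv//= distrC.
Qed.

(** Heine's theorem, from compactness in its near-covering form; the radius is halved so that a
    nearby centre still controls the whole ball. *)
Lemma segment_unif_continuous a b c e : {within `[a, b], continuous c} -> 0 < e ->
  exists2 d : R, 0 < d & forall x z, a <= x <= b -> a <= z <= b -> `|z - x| < d -> `|c z - c x| <= e.
Proof.
move=> cc e0.
have := @segment_compact R a b => /compact_near_coveringP.
move=> /(_ _ (0^'+ : set_system R) (fun d x => a <= x <= b -> forall z, a <= z <= b -> `|z - x| < d -> `|c z - c x| <= e)).
case=> [|d /= d0 Hd].
  move=> x; rewrite /= in_itv/= => xab.
  have [d d0 Hd] := within_continuous_le cc (divr_gt0 e0 (ltr0n R 2)) xab.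
  exists (ball x (d / 2), [set y | y <= d / 2]) => /=.
    split; first by apply: nbhsx_ballx; rewrite divr_gt0.
    by apply: nbhs_right_le; rewrite divr_gt0.
  move=> [x' i] [/= xx' id] x'ab z zab zx'.
  rewrite -(subrKA (c x)) (le_trans (ler_normD _ _))// (splitr e) lerD//.
    apply: Hd => //; rewrite -(subrKA x') (le_lt_trans (ler_normD _ _))//.
    by rewrite [ltRHS]splitr ltrD// ?(lt_le_trans zx')// distrC.
  rewrite distrC; apply: Hd => //; rewrite distrC (lt_trans xx')//.
  by rewrite ltr_pdivrMr// ltr_pMr// ltr1n.
exists (d / 2); first by rewrite divr_gt0.
move=> x z xab zab zx; apply: (Hd (d / 2)) => //=.
- rewrite sub0r normrN gtr0_norm ?divr_gt0// ltr_pdivrMr// ltr_pMr// ltr1n//.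
- by rewrite divr_gt0.
Qed.

(** Test with plateaus: the derivative of a plateau consists of two mollifiers, whose pairings with
    the continuous [c] tend to [c s] and [c t], while the plateau itself tends boundedly to the
    indicator of ]s, t[. *)
Lemma weak_ftc a b c g : {within `[a, b], continuous c} ->
  mu.-integrable `]a, b[ (EFin \o g) ->
  (forall psi, test_fun a b psi ->
    \int[mu]_(x in `]a, b[) (derive1 psi x * c x) = - \int[mu]_(x in `]a, b[) (psi x * g x)) ->
  forall s t, a <= s -> s < t -> t <= b -> c t - c s = \int[mu]_(x in `]s, t[) g x.
Proof.
move=> cc ig H s t as_ st tb.
have ab : a < b by lra.
have ic := continuous_integrable_oo cc.
(* The offset 6 gives [4 * e n <= t - s] already for [n = 0], as the plateau requires. *)
pose e n : R := (t - s) / (n%:R + 6).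
have n6 n : 0 < n%:R + 6 :> R by rewrite ltr_wpDl.
have e0 n : 0 < e n by rewrite divr_gt0// subr_gt0.
have e4 n : 4 * e n <= t - s.
  rewrite /e mulrA ler_pdivrMr// mulrC ler_wpM2l ?subr_ge0 ?ltW//.
  by have := ler0n R n; lra.
have ecvg (r : R) : 0 < r -> \forall n \near \oo, e n < r.
  move=> r0; near=> n; rewrite /e ltr_pdivrMr// mulrC -ltr_pdivrMr//.
  apply: (@lt_le_trans _ _ n%:R); last lra.
  by near: n; exact: nbhs_infty_gtr.
have E n : \int[mu]_(x in `]a, b[) (moll (e n) (s + 2 * e n) x * c x) -
           \int[mu]_(x in `]a, b[) (moll (e n) (t - 2 * e n) x * c x) =
    - \int[mu]_(x in `]a, b[) (plateau (e n) s t x * g x).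
  rewrite -H; last exact: test_plateau.
  rewrite derive1_plateau// -RintegralB//; [|exact: moll_mul_integrable..].
  by apply: eq_Rintegral => x _; rewrite mulrBl.
have c1 : \int[mu]_(x in `]a, b[) (moll (e n) (s + 2 * e n) x * c x) @[n --> \oo] --> c s.
  apply/cvgrPdist_le => r r0; have [|d d0 Hd] := within_continuous_le cc r0 (x := s); first lra.
  near=> n; have n1 := e0 n; have n4 := e4 n.
  have nd : e n < d / 4 by near: n; apply: ecvg; rewrite divr_gt0.
  rewrite distrC; apply: moll_avg => //; [lra|lra|move=> z zab].
  by rewrite ltr_distl => zs; apply: Hd; [lra|rewrite ltr_distl; lra].
have c2 : \int[mu]_(x in `]a, b[) (moll (e n) (t - 2 * e n) x * c x) @[n --> \oo] --> c t.
  apply/cvgrPdist_le => r r0; have [|d d0 Hd] := within_continuous_le cc r0 (x := t); first lra.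
  near=> n; have n1 := e0 n; have n4 := e4 n.
  have nd : e n < d / 4 by near: n; apply: ecvg; rewrite divr_gt0.
  rewrite distrC; apply: moll_avg => //; [lra|lra|move=> z zab].
  by rewrite ltr_distl => zs; apply: Hd; [lra|rewrite ltr_distl; lra].
have mI : measurable (`]s, t[ : set (measurableTypeR R)) by [].
have mg : measurable_fun `]a, b[ g by exact: Rintegrable_measurable ig.
have mJ : measurable (`]a, b[ : set (measurableTypeR R)) by [].
have h1 n : measurable_fun `]a, b[ (fun x => plateau (e n) s t x * g x).
  apply: measurable_funM => //; apply: measurable_funTS.
  apply: continuous_measurable_fun => x; apply/differentiable_continuous/derivable1_diffP.
  exact: (@ex_derive _ _ _ _ _ _ _ (is_derive_plateau s t x (e0 n))).
have h2 : measurable_fun `]a, b[ (g \_ `]s, t[).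
  apply: (measurable_restrict _ mI mJ).1.
  by apply: measurable_funS mg => // x [].
have h3 : {ae mu, forall x, `]a, b[%classic x -> plateau (e n) s t x * g x @[n --> \oo] --> (g \_ `]s, t[) x}.
  apply: aeW => x xab; apply/cvgrPdist_le => r r0.
  rewrite patchE; case: ifPn => [|xst].
    rewrite inE/= in_itv/= => /andP[sx xt].
    have sx3 : 0 < (x - s) / 3 by rewrite divr_gt0// subr_gt0.
    have tx3 : 0 < (t - x) / 3 by rewrite divr_gt0// subr_gt0.
    near=> n.
    have es : e n < (x - s) / 3 by near: n; exact: ecvg.
    have et : e n < (t - x) / 3 by near: n; exact: ecvg.
    by rewrite plateau_in ?mul1r ?subrr ?normr0 ?ltW//; lra.
  apply: nearW => n; rewrite plateau_out ?mul0r ?normr0//; last first.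
    have := e0 n; move: xst; rewrite notin_setE/= in_itv/= => /negP.
    by rewrite negb_and -!leNgt => /orP[?|?] ?; apply/orP; [left|right]; lra.
  (* Off the interval the restriction takes the default [point], which is 0 in [R]. *)
  by rewrite -[point]/(0 : R) subrr normr0 ltW.
have h5 : {ae mu, forall x, `]a, b[%classic x -> forall n, `|plateau (e n) s t x * g x| <= `|g x|}.
  by apply: aeW => x _ n; rewrite normrM -[leRHS]mul1r ler_wpM2r// plateau_le1.
have [_ c3] := Rdominated_convergence mJ h1 h2 h3 (Rintegrable_norm ig) h5.
have c4 : \int[mu]_(x in `]a, b[) (g \_ `]s, t[) x = \int[mu]_(x in `]s, t[) g x.
  rewrite -Rintegral_mkcondr; congr (Rintegral _ _ _); apply/seteqP; split=> x /=; first by case.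
  by rewrite !in_itv/= => /[dup] ? /andP[? ?]; split => //; lra.
rewrite -c4 -opprB; apply/eqP; rewrite eqr_oppLR; apply/eqP.
have c5 := cvgB c1 c2 _.
have c6 := cvgN c3 _.
apply: (@cvg_unique _ (@norm_hausdorff _ _) _ _ _ _ (c5 _)).
suff -> : (fun n => \int[mu]_(x in `]a, b[) (moll (e n) (s + 2 * e n) x * c x)) -
  (fun n => \int[mu]_(x in `]a, b[) (moll (e n) (t - 2 * e n) x * c x)) =
  - (fun n => \int[mu]_(x in `]a, b[) (plateau (e n) s t x * g x)) by exact: c6.
by apply/funext => n; rewrite -[LHS]/(_ - _) E.
Unshelve. all: by end_near. Qed.

(** The primitive vanishes identically, and by Lebesgue differentiation its derivative is [g] almost
    everywhere. *)
Lemma interval_null_ae0 a b g : a < b -> mu.-integrable `]a, b[ (EFin \o g) ->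
  (forall t, a < t -> t < b -> \int[mu]_(x in `]a, t[) g x = 0) ->
  {ae mu, forall x, a < x < b -> g x = 0}.
Proof.
move=> ab ig H.
have mg : measurable_fun `]a, b[ g by exact: Rintegrable_measurable ig.
pose G := g \_ `]a, b[.
have iG : mu.-integrable setT (EFin \o G).
  have mI : measurable (`]a, b[ : set (measurableTypeR R)) by [].
  by have := (@integrable_mkcond _ _ R mu _ (EFin \o g) mI).1 ig; rewrite restrict_EFin.
have lG : locally_integrable setT G by exact: integrable_locally ig.
apply: (@filterS _ _ (ae_filter_ringOfSetsType mu) _ _ _ (lebesgue_differentiation lG)) => x Lx /andP[ax xb].
have [|||dF F'] := @FTC1_lebesgue_pt R G (BRight a) x b xb.
- by apply: integrableS iG.
- by first [exact: ax | rewrite ltBSide/= ax | rewrite ltEbnd/= ax | apply: ax].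
- exact: Lx.
have -> : g x = G x by rewrite /G patchE ifT// inE/= in_itv/= ax xb.
rewrite -F'; transitivity (derive1 (cst (0 : R)) x); last by rewrite derive1_cst.
rewrite !derive1E; apply: near_eq_derive.
near=> y.
have ay : a < y by near: y; exact: lt_nbhsr.
have yb : y < b by near: y; exact: lt_nbhsl.
rewrite -[RHS](H y)// -Rintegral_itv_bndo_bndc; last by apply: integrableS iG.
apply: eq_Rintegral => z; rewrite inE/= in_itv/= => /andP[az zy].
by rewrite /G patchE ifT// inE/= in_itv/= az (lt_trans zy).
Unshelve. all: by end_near. Qed.

(** The hypothesis says that [g] is a weak derivative of the constant 0; by [weak_ftc] all its
    integrals over subintervals vanish. *)
Lemma fundamental_lemma a b g : a < b -> mu.-integrable `]a, b[ (EFin \o g) ->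
  (forall psi, test_fun a b psi -> \int[mu]_(x in `]a, b[) (psi x * g x) = 0) ->
  {ae mu, forall x, a < x < b -> g x = 0}.
Proof.
move=> ab ig H; apply: interval_null_ae0 => // t at_ tb.
rewrite -(@weak_ftc a b (cst 0) g) ?subrr//; last exact: ltW.
  by apply: continuous_subspaceT => x; exact: cst_continuous.
move=> psi tpsi; rewrite H// oppr0.
under eq_Rintegral do rewrite mulr0.
by rewrite Rintegral_cst// mul0r.
Qed.
End WeakFTC.

(** * Mollification on the unit interval *)

Section Mollify.
Context {R : realType}.
Implicit Types (h x y z a b s t e : R) (f g c v w : R -> R).
Notation mu := (@lebesgue_measure R).
Let D : set (measurableTypeR R) := `]0, 1[.
Let mD : measurable (`]0, 1[ : set (measurableTypeR R)). Proof. by []. Qed.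

Definition mollify h f y := \int[mu]_(z in `]0, 1[) (moll h y z * f z).
Definition dmollify h f y := \int[mu]_(z in `]0, 1[) (dmoll h y z * f z).

(** Differentiation under the integral sign, dominated by [C * |f|]. The sign comes from moving the
    derivative from the centre to the variable [z]. *)
Lemma is_derive_mollify h f y : mu.-integrable `]0, 1[ (EFin \o f) ->
  is_derive y 1 (mollify h f) (- dmollify h f y).
Proof.
move=> ifD.
have [C C0 HC] := dmoll_bounded h.
have d1 x z : is_derive x 1 (fun x => moll h x z * f z) (- dmoll h x z * f z).
  have -> : (fun x => moll h x z * f z) = f z \*: (fun x => moll h x z).
    by apply/funext => r; rewrite /= mulrC.
  by rewrite mulrC; apply: is_deriveZ; exact: is_derive_moll_center.
have E x z : partial1of2 (fun x z => moll h x z * f z) x z = - dmoll h x z * f z.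
  by rewrite partial1of2E; apply/derive_val.
pose G z := C * `|f z|.
have iG : mu.-integrable D (EFin \o G) by apply: RintegrableZ => //; exact: Rintegrable_norm.
have y1 : `]y - 1, y + 1[%classic y by rewrite /= in_itv/=; apply/andP; split; lra.
have Gb x z : `]y - 1, y + 1[%classic x -> D z -> `|partial1of2 (fun x z => moll h x z * f z) x z| <= G z.
  by move=> _ _; rewrite E normrM normrN ler_wpM2r.
have im x : `]y - 1, y + 1[%classic x -> mu.-integrable D (EFin \o (fun z => moll h x z * f z)).
  by move=> _; exact: moll_mul_integrable.
have dm x z : `]y - 1, y + 1[%classic x -> D z -> derivable (fun x => moll h x z * f z) x 1.
  by move=> _ _; exact: (@ex_derive _ _ _ _ _ _ _ (d1 x z)).
have G0 z : 0 <= G z by rewrite mulr_ge0.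
have H1 := @derivable_under_integral R _ _ mu _ D mD y _ _ y1 im dm G G0 iG Gb.
have H2 := @differentiation_under_integral R _ _ mu _ D mD y _ _ y1 im dm G G0 iG Gb.
apply: DeriveDef; first exact: H1.
rewrite -derive1E.
etransitivity; first exact: H2.
rewrite -[RHS]mulN1r -RintegralZl//; last exact: dmoll_mul_integrable.
by apply: eq_Rintegral => z _; rewrite E mulN1r mulNr.
Qed.

Lemma mollify_continuous h f : mu.-integrable `]0, 1[ (EFin \o f) ->
  continuous (mollify h f).
Proof.
move=> ifD y; apply/differentiable_continuous/derivable1_diffP.
exact: (@ex_derive _ _ _ _ _ _ _ (is_derive_mollify h y ifD)).
Qed.

Lemma dmoll_center_continuous h z : continuous (fun x => dmoll h x z).
Proof.
have -> : (fun x => dmoll h x z) = abump (dbump 1 0) 2 (h^-1 * (h^-1 * (step0 1)^-1)) (- h^-1) (z / h).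
  apply/funext => r; rewrite /dmoll /dbump1 /abump !mulrA; congr (_ * bumpp _ _ _); ring.
exact: abump_continuous.
Qed.

Lemma dmollify_continuous h f : mu.-integrable `]0, 1[ (EFin \o f) ->
  continuous (dmollify h f).
Proof.
move=> ifD y.
have [C C0 HC] := dmoll_bounded h.
pose G z := C * `|f z|.
have iG : mu.-integrable D (EFin \o G) by apply: RintegrableZ => //; exact: Rintegrable_norm.
have H := @continuity_under_integral R _ _ mu (fun x z => dmoll h x z * f z) D mD (y - 1) (y + 1) _ _ G iG _.
apply: (H _ _ _ y).
- by move=> x _; exact: dmoll_mul_integrable.
- apply: aeW => z _ x _; apply: cvgM; last exact: cvg_cst.
  exact: dmoll_center_continuous.
- by move=> x _; apply: aeW => z _; rewrite normrM ler_wpM2r.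
- by rewrite inE/= in_itv/=; apply/andP; split; lra.
Qed.

Lemma mollify_const h y (k : R) : 0 < h -> 0 <= y - h -> y + h <= 1 ->
  \int[mu]_(z in `]0, 1[) (moll h y z * k) = k.
Proof.
by move=> *; rewrite RintegralZr// ?moll_integral ?mul1r//; exact: moll_integrable.
Qed.

Lemma le_mollify h y f g : 0 < h -> mu.-integrable `]0, 1[ (EFin \o f) ->
  mu.-integrable `]0, 1[ (EFin \o g) ->
  (forall z, 0 < z < 1 -> `|z - y| < h -> f z <= g z) -> mollify h f y <= mollify h g y.
Proof.
move=> h0 i1 i2 H; apply: le_Rintegral => //; [exact: moll_mul_integrable..|].
move=> z /=; rewrite in_itv/= => z01.
have [zh|zh] := ltP `|z - y| h; last by rewrite moll_out// !mul0r.
by rewrite ler_wpM2l ?moll_ge0// H.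
Qed.

Lemma mollifyD h y f g : mu.-integrable `]0, 1[ (EFin \o f) ->
  mu.-integrable `]0, 1[ (EFin \o g) ->
  mollify h (fun z => f z + g z) y = mollify h f y + mollify h g y.
Proof.
move=> i1 i2; rewrite /mollify -RintegralD//; [|exact: moll_mul_integrable..].
by apply: eq_Rintegral => z _; rewrite mulrDr.
Qed.

Lemma mollifyZ h y (k : R) f : mu.-integrable `]0, 1[ (EFin \o f) ->
  mollify h (fun z => k * f z) y = k * mollify h f y.
Proof.
move=> i1; rewrite /mollify -RintegralZl//; last exact: moll_mul_integrable.
by apply: eq_Rintegral => z _; rewrite mulrCA.
Qed.

Lemma mollify_cst h y (k : R) : 0 < h -> 0 <= y - h -> y + h <= 1 -> mollify h (cst k) y = k.
Proof. exact: mollify_const. Qed.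

Lemma cst_integrable (k : R) : mu.-integrable `]0, 1[ (EFin \o cst k).
Proof. by apply: continuous_integrable_oo; apply: continuous_subspaceT => x; exact: cst_continuous. Qed.

Lemma mollify_abs h y f : 0 < h -> mu.-integrable `]0, 1[ (EFin \o f) ->
  `|mollify h f y| <= mollify h (fun z => `|f z|) y.
Proof.
move=> h0 i1; rewrite ler_norml; apply/andP; split.
  rewrite -mulN1r -mollifyZ; last exact: Rintegrable_norm.
  apply: le_mollify => //; first by apply: RintegrableZ => //; exact: Rintegrable_norm.
  by move=> z _ _; rewrite mulN1r lerNl -normrN ler_norm.
by apply: le_mollify => //; [exact: Rintegrable_norm|move=> z _ _; exact: ler_norm].
Qed.

(** Jensen's inequality: with [m] the mean, average the tangent line [2 m f - m^2 <= f^2]. *)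
Lemma mollify_sqr h y f : 0 < h -> 0 <= y - h -> y + h <= 1 ->
  mu.-integrable `]0, 1[ (EFin \o f) -> mu.-integrable `]0, 1[ (EFin \o (fun z => f z ^+ 2)) ->
  mollify h f y ^+ 2 <= mollify h (fun z => f z ^+ 2) y.
Proof.
move=> h0 h1 h2 i1 i2; set m := mollify h f y.
have : mollify h (fun z => 2 * m * f z + - m ^+ 2) y <= mollify h (fun z => f z ^+ 2) y.
  apply: le_mollify => //; first by apply: RintegrableD => //; [exact: RintegrableZ|exact: cst_integrable].
  move=> z _ _; rewrite -subr_ge0.
  have -> : f z ^+ 2 - (2 * m * f z - m ^+ 2) = (f z - m) ^+ 2 by ring.
  exact: sqr_ge0.
rewrite mollifyD ?mollifyZ -/m//; [|exact: RintegrableZ|exact: cst_integrable].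
rewrite [X in _ + X](_ : _ = - m ^+ 2); last exact: mollify_cst.
by apply: le_trans; lra.
Qed.
End Mollify.

(** * Averages over the centre and pointwise inequalities *)

Section Static.
Context {R : realType}.
Implicit Types (h x y z a b s t e : R) (f g c v w : R -> R).
Notation mu := (@lebesgue_measure R).
Let mD : measurable (`]0, 1[ : set (measurableTypeR R)). Proof. by []. Qed.
Let mJ : measurable (`[4^-1, 3 / 4] : set (measurableTypeR R)). Proof. by []. Qed.

(** In the centre [y], [- step ((z - y) / h)] is an antiderivative, and [step] takes values in
    [0, 1]. The integral falls short of 1 when the window around [z] leaves [1/4, 3/4]. *)
Lemma moll_center_integral h z : 0 < h -> \int[mu]_(y in `[4^-1, 3 / 4]) moll h y z <= 1.
Proof.
move=> h0.
have ds x : is_derive x 1 (fun y => - step ((z - y) / h)) (moll h x z).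
  have -> : (fun y => - step ((z - y) / h)) = - (fun y => step (- h^-1 * y + z / h)).
    by apply/funext => y; rewrite fctE; congr (- step _); ring.
  have := is_deriveN (@is_derive_scaled _ step bump (- h^-1) (z / h) x is_derive_step).
  by congr is_derive; rewrite /moll mulNr opprK; congr (_ * bump _); ring.
rewrite (RFTC2 _ ds); first by rewrite opprK addrC lerBlDr (le_trans (step_le1 _))// lerDl step_ge0.
  lra.
apply: continuous_subspaceT => x; apply/differentiable_continuous/derivable1_diffP.
exact: (@ex_derive _ _ _ _ _ _ _ (is_derive_moll_center h x z)).
Qed.

(** Exchanging the integrals leaves, for each [z], the mass of the mollifier in its centre. Tonelli
    applies because the kernel is explicit and [f] depends on [z] alone. *)
Lemma mollify_Tonelli h f : 0 < h -> (forall z, 0 <= f z) ->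
  mu.-integrable `]0, 1[ (EFin \o f) ->
  \int[mu]_(y in `[4^-1, 3 / 4]) mollify h f y <= \int[mu]_(z in `]0, 1[) f z.
Proof.
move=> h0 f0 i1.
have mf : measurable_fun setT (f \_ `]0, 1[).
  by apply: (measurable_restrict _ mD _).1 => //; rewrite setTI; exact: Rintegrable_measurable i1.
pose F (p : measurableTypeR R * measurableTypeR R) : \bar R :=
  (\1_(`[4^-1, 3 / 4]) p.1 * (moll h p.1 p.2 * (f \_ `]0, 1[) p.2))%:E.
have fD0 z : 0 <= (f \_ `]0, 1[) z by rewrite patchE; case: ifPn.
have mF : measurable_fun setT F.
  apply/measurable_EFinP; apply: measurable_funM.
    by apply: measurableT_comp => //; exact: measurable_indic.
  apply: measurable_funM; last by apply: measurableT_comp.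
  apply: measurable_funM => //.
  have mb : measurable_fun setT (@bump R) by apply: continuous_measurable_fun; exact: abump_continuous.
  apply: (measurableT_comp mb); apply: measurable_funM => //.
  by apply: measurable_funB.
have F0 p : (0 <= F p)%E by rewrite lee_fin mulr_ge0// mulr_ge0// moll_ge0.
have Tn := @fubini_tonelli _ _ _ _ R mu mu F mF F0.
have E1 : (\int[mu]_(y in `[4^-1%R, (3 / 4)%R]) (mollify h f y)%:E = \int[mu]_y \int[mu]_z F (y, z))%E.
  rewrite integral_mkcond; apply: eq_integral => y _; rewrite patchE.
  case: ifPn => yJ; last first.
    rewrite integral0_eq// => z _; rewrite /F/= indicE.
    by move: yJ => /negbTE ->; rewrite mul0r.
  rewrite /mollify /Rintegral fineK; last first.
    by apply: integrable_fin_num => //; exact: moll_mul_integrable.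
  rewrite integral_mkcond; apply: eq_integral => z _; rewrite /F/= indicE yJ mul1r !patchE.
  by case: ifPn => // _; rewrite mulr0.
have E2 : (\int[mu]_z \int[mu]_y F (y, z) <= \int[mu]_(z in `]0%R, 1%R[) (f z)%:E)%E.
  rewrite [leRHS]integral_mkcond; apply: ge0_le_integral => //.
  - by move=> z _; apply: integral_ge0.
  - exact: measurable_fun_fubini_tonelli_G.
  - by rewrite restrict_EFin; apply/measurable_EFinP.
  - move=> z _; rewrite restrict_EFin/=.
    rewrite /F/=; move: (fD0 z); set fz := (f \_ _) z => fz0.
    have -> : (\int[mu]_y (\1_(`[4^-1%R, (3 / 4)%R]) y * (moll h y z * fz))%:E = \int[mu]_(y in `[4^-1%R, (3 / 4)%R]) (fz * moll h y z)%:E)%E.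
      rewrite [RHS]integral_mkcond; apply: eq_integral => y _; rewrite indicE patchE.
      by case: ifPn => _; rewrite ?mul0r// mul1r mulrC.
    have ic : mu.-integrable `[4^-1, 3 / 4] (EFin \o (fun y => moll h y z)).
      apply: continuous_integrable; apply: continuous_subspaceT => x; apply/differentiable_continuous/derivable1_diffP.
      exact: (@ex_derive _ _ _ _ _ _ _ (is_derive_moll_center h x z)).
    under eq_integral do rewrite EFinM.
    rewrite integralZl// -[X in (_ * X)%E]fineK; last exact: integrable_fin_num.
    rewrite -EFinM lee_fin -[leRHS]mulr1 ler_wpM2l//.
    exact: moll_center_integral.
have := E2; rewrite -Tn -E1 => E3.
rewrite /Rintegral fine_le//.
- apply: integrable_fin_num => //; apply: continuous_integrable; apply: continuous_subspaceT.
  exact: mollify_continuous.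
- exact: integrable_fin_num.
Qed.

(* Here [s] is a weight vanishing at the ends of an interval and [s'] its
   derivative: the power 4 lets Young's inequality absorb the terms carrying [s']
   into the dissipation [- s^4 A^2] and the reaction
   [- beta s^4 V^(2 delta + 2)], uniformly in [V] and [A]. *)
Lemma energy_pointwise (alpha beta gamma : R) (delta : nat) :
  0 < alpha -> 0 < beta -> 0 < gamma -> (1 <= delta)%N ->
  exists2 C : R, 0 <= C & forall s s' V A : R, 0 <= s <= 1 -> `|s'| <= 2^-1 ->
    - (4 * s ^+ 3 * s') * (V * A) - s ^+ 4 * A ^+ 2
    + alpha / delta.+2%:R * (4 * s ^+ 3 * s') * V ^+ delta.+2
    + beta * s ^+ 4 * (V * (V * (1 - V ^+ delta) * (V ^+ delta - gamma))) <= C.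
Proof.
move=> a0 b0 g0 d1.
(* [kappa] collects the coefficients of the intermediate power in convection and reaction. [L] is
   such that [beta * L = beta + 1 + kappa]: for [x >= L >= 1] this makes [beta x^2 >= 1 + kappa x],
   and the absorption wins. *)
pose kappa := alpha + beta * (1 + gamma); pose L := 1 + (1 + kappa) / beta.
have k0 : 0 < kappa by rewrite addr_gt0// mulr_gt0// addr_gt0.
have L1 : 1 <= L.
  by rewrite lerDl; apply: divr_ge0; [apply: addr_ge0; [exact: ler01|exact: ltW]|exact: ltW].
have bL : beta * L = beta + 1 + kappa by rewrite /L mulrDr mulr1 mulrC divfK ?gt_eqF//; ring.
have L0 : 0 <= L by exact: le_trans L1.
have [a0' b0' g0' k0'] := And4 (ltW a0) (ltW b0) (ltW g0) (ltW k0).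
have kL : 0 <= 1 + kappa * L by rewrite addr_ge0 ?mulr_ge0.
exists ((1 + kappa * L) * L ^+ 2); first by rewrite mulr_ge0 ?sqr_ge0.
move=> s s' V A /andP[s0 s1] hs'.
set p := `|V|; have p0 : 0 <= p by exact: normr_ge0.
set P := p ^+ delta; have P0 : 0 <= P by exact: exprn_ge0.
have VP : V ^+ 2 = p ^+ 2 by rewrite /p real_normK// num_real.
(* Complete the square in [A]; the remainder [4 s^2 s'^2 V^2] is at most [s^2 V^2] because
   [|s'| <= 1/2]. *)
have T1 : - (4 * s ^+ 3 * s') * (V * A) - s ^+ 4 * A ^+ 2 <= s ^+ 2 * p ^+ 2.
  apply: (@le_trans _ _ (4 * s ^+ 2 * s' ^+ 2 * V ^+ 2)).
    rewrite -subr_ge0.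
    have -> : 4 * s ^+ 2 * s' ^+ 2 * V ^+ 2 - (- (4 * s ^+ 3 * s') * (V * A) - s ^+ 4 * A ^+ 2)
      = (2 * s * s' * V + s ^+ 2 * A) ^+ 2 by ring.
    exact: sqr_ge0.
  have s2 : s' ^+ 2 <= (2^-1) ^+ 2.
    by rewrite -real_normK ?num_real// lerXn2r// ?nnegrE// invr_ge0.
  rewrite VP ler_wpM2r ?sqr_ge0// -[leRHS]mul1r mulrAC ler_wpM2r ?sqr_ge0//; lra.
have Vd2 : `|V ^+ delta.+2| = P * p ^+ 2 by rewrite normrX -addn2 exprD.
have T2 : alpha / delta.+2%:R * (4 * s ^+ 3 * s') * V ^+ delta.+2 <= alpha * s ^+ 3 * (P * p ^+ 2).
  rewrite -Vd2 (le_trans (ler_norm _))// normrM ler_wpM2r//.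
  have -> : alpha / delta.+2%:R * (4 * s ^+ 3 * s') = alpha * s ^+ 3 * ((4 * s') / delta.+2%:R) by ring.
  rewrite normrM (ger0_norm (_ : 0 <= alpha * _)) ?mulr_ge0 ?exprn_ge0//.
  rewrite -[leRHS]mulr1 ler_wpM2l ?mulr_ge0 ?exprn_ge0//.
  rewrite !normrM normfV !normr_nat ler_pdivrMr ?ltr0n// mul1r.
  apply: (@le_trans _ _ 2); first lra.
  by rewrite (ler_nat R 2).
have T3 : beta * s ^+ 4 * (V * (V * (1 - V ^+ delta) * (V ^+ delta - gamma))) <=
    beta * (1 + gamma) * s ^+ 3 * (P * p ^+ 2) - beta * s ^+ 4 * (P ^+ 2 * p ^+ 2).
  have Wd : V ^+ delta <= P by rewrite /P /p -normrX ler_norm.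
  have W2 : (V ^+ delta) ^+ 2 = P ^+ 2 by rewrite -real_normK ?num_real// normrX.
  set W := V ^+ delta in Wd W2 *.
  apply: (@le_trans _ _ (beta * s ^+ 4 * ((1 + gamma) * (P * p ^+ 2) - P ^+ 2 * p ^+ 2))).
    rewrite ler_wpM2l ?mulr_ge0 ?exprn_ge0//.
    have -> : V * (V * (1 - W) * (W - gamma)) = (1 + gamma) * (W * V ^+ 2) - W ^+ 2 * V ^+ 2 - gamma * V ^+ 2 by ring.
    rewrite W2 VP.
    have : (1 + gamma) * (W * p ^+ 2) <= (1 + gamma) * (P * p ^+ 2).
      by rewrite ler_wpM2l ?addr_ge0// ler_wpM2r ?sqr_ge0.
    have : 0 <= gamma * p ^+ 2 by rewrite mulr_ge0 ?sqr_ge0.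
    lra.
  have -> : beta * s ^+ 4 * ((1 + gamma) * (P * p ^+ 2) - P ^+ 2 * p ^+ 2) =
    s * (beta * (1 + gamma) * s ^+ 3 * (P * p ^+ 2)) - beta * s ^+ 4 * (P ^+ 2 * p ^+ 2) by ring.
  by rewrite lerD2r ler_piMl// !mulr_ge0 ?exprn_ge0 ?addr_ge0.
(* All powers of [s] fit: the three bounds share the factor [s^2 p^2], and the rest is a quadratic
   polynomial in [x = s P] with leading coefficient [- beta]. *)
apply: (@le_trans _ _ (s ^+ 2 * p ^+ 2 * (1 + kappa * (s * P) - beta * (s * P) ^+ 2))).
  have -> : s ^+ 2 * p ^+ 2 * (1 + kappa * (s * P) - beta * (s * P) ^+ 2) =
   s ^+ 2 * p ^+ 2 + alpha * s ^+ 3 * (P * p ^+ 2) + (beta * (1 + gamma) * s ^+ 3 * (P * p ^+ 2) - beta * s ^+ 4 * (P ^+ 2 * p ^+ 2)).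
    by rewrite /kappa; ring.
  by rewrite !lerD.
set x := s * P; have x0 : 0 <= x by rewrite mulr_ge0.
have [xL|xL] := leP L x.
  apply: (@le_trans _ _ 0); last by rewrite mulr_ge0 ?sqr_ge0.
  rewrite mulr_ge0_le0 ?mulr_ge0 ?sqr_ge0// subr_le0.
  have : beta * L * x <= beta * x ^+ 2 by rewrite expr2 -mulrA ler_wpM2l// ler_wpM2r.
  have bx : 0 <= beta * x by rewrite mulr_ge0.
  rewrite bL; nra.
apply: (@le_trans _ _ (s ^+ 2 * p ^+ 2 * (1 + kappa * L))).
  rewrite ler_wpM2l ?mulr_ge0 ?sqr_ge0//.
  have : 0 <= beta * x ^+ 2 by rewrite mulr_ge0 ?sqr_ge0.
  have : kappa * x <= kappa * L by rewrite ler_wpM2l// ltW.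
  lra.
rewrite mulrC ler_wpM2l// -exprMn lerXn2r ?nnegrE ?mulr_ge0//.
(* It remains to see [s p <= L]. If [p > 1], then [p <= p^delta] as [delta >= 1], whence
   [s p <= x < L]. *)
have [p1|p1] := leP p 1; first by rewrite (le_trans _ L1)// mulr_ile1.
apply: (le_trans _ (ltW xL)); rewrite ler_wpM2l//.
by rewrite /P -[leLHS]expr1 ler_weXn2l// ltW.
Qed.

(** With [m = max(1, |a|, |b|)] the reaction term has size [m^(2 delta + 2)], and the convection
    term [m^(delta + 1) |g|] splits by Young's inequality. The letters [a] and [b] differ because
    they will be a mollified value and a local value of the same function. *)
Lemma scalar_dom (alpha beta gamma : R) (delta : nat) :
  0 < alpha -> 0 < beta -> 0 < gamma ->
  exists2 C : R, 0 <= C & forall a b g : R,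
    `|a| * `|alpha * (b ^+ delta * g) - beta * (b * (1 - b ^+ delta) * (b ^+ delta - gamma))|
    <= C * (1 + g ^+ 2 + b ^+ (2 * delta.+1) + a ^+ (2 * delta.+1)).
Proof.
move=> a0 b0 g0; exists (alpha + 8 * beta * (1 + gamma)).
  by rewrite addr_ge0 ?mulr_ge0 ?addr_ge0// ltW.
have [a0' b0' g0'] := And3 (ltW a0) (ltW b0) (ltW g0).
move=> a b g.
pose m := Num.max 1 (Num.max `|a| `|b|).
have m1 : 1 <= m by rewrite le_max lexx.
have m0 : 0 <= m by exact: le_trans m1.
have am : `|a| <= m by rewrite !le_max lexx orbT.
have bm : `|b| <= m by rewrite !le_max lexx !orbT.
have ev (x : R) : x ^+ (2 * delta.+1) = `|x| ^+ (2 * delta.+1).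
  by rewrite !exprM real_normK// num_real.
have q0 (x : R) : 0 <= x ^+ (2 * delta.+1) by rewrite ev exprn_ge0.
have mq : m ^+ (2 * delta.+1) <= 1 + b ^+ (2 * delta.+1) + a ^+ (2 * delta.+1).
  rewrite /m (ev a) (ev b); have := exprn_ge0 (2 * delta.+1) (normr_ge0 a); have := exprn_ge0 (2 * delta.+1) (normr_ge0 b).
  move=> ? ?; case: (leP 1 (Num.max `|a| `|b|)) => _; last by rewrite expr1n; lra.
  by case: (leP `|a| `|b|) => _; lra.
set Q := 1 + b ^+ _ + a ^+ _ in mq.
have Q0 : 0 <= Q by rewrite !addr_ge0.
have -> : 1 + g ^+ 2 + b ^+ (2 * delta.+1) + a ^+ (2 * delta.+1) = g ^+ 2 + Q by rewrite /Q; ring.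
have bd : `|b ^+ delta| <= m ^+ delta by rewrite normrX lerXn2r ?nnegrE.
have md1 : 1 <= m ^+ delta by rewrite exprn_ege1.
have md0 : 0 <= m ^+ delta by exact: le_trans md1.
have Eq : m ^+ (2 * delta.+1) = (m * m ^+ delta) ^+ 2 by rewrite -exprS -exprM mulnC.
have K1 : `|a| * `|alpha * (b ^+ delta * g)| <= alpha * (g ^+ 2 + Q).
  rewrite normrM (gtr0_norm a0) mulrCA ler_wpM2l//.
  rewrite normrM mulrA.
  apply: (@le_trans _ _ (m * m ^+ delta * `|g|)); first by rewrite ler_wpM2r// ler_pM.
  have : 0 <= (m * m ^+ delta - `|g|) ^+ 2 by exact: sqr_ge0.
  rewrite sqrrB -Eq real_normK ?num_real//.
  have : 0 <= m * m ^+ delta * `|g| by rewrite !mulr_ge0.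
  have := sqr_ge0 g.
  rewrite mulr2n; lra.
have K2 : `|a| * `|beta * (b * (1 - b ^+ delta) * (b ^+ delta - gamma))| <= 8 * beta * (1 + gamma) * (g ^+ 2 + Q).
  rewrite normrM (gtr0_norm b0) mulrCA.
  have -> : 8 * beta * (1 + gamma) * (g ^+ 2 + Q) = beta * (8 * (1 + gamma) * (g ^+ 2 + Q)) by ring.
  rewrite ler_wpM2l// !normrM.
  have n1 : `|1 - b ^+ delta| <= 2 * m ^+ delta.
    by rewrite (le_trans (ler_normB _ _))// normr1; lra.
  have n2 : `|b ^+ delta - gamma| <= (1 + gamma) * m ^+ delta.
    rewrite (le_trans (ler_normB _ _))// (gtr0_norm g0) mulrDl mul1r lerD// ler_peMr//.
  apply: (@le_trans _ _ (m * (m * (2 * m ^+ delta) * ((1 + gamma) * m ^+ delta)))).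
    by rewrite ler_pM ?mulr_ge0//; rewrite ler_pM ?mulr_ge0//; rewrite ler_pM.
  have -> : m * (m * (2 * m ^+ delta) * ((1 + gamma) * m ^+ delta)) = 2 * (1 + gamma) * m ^+ (2 * delta.+1).
    by rewrite Eq; ring.
  have g1 : 0 <= 1 + gamma by rewrite addr_ge0 .
  apply: (@le_trans _ _ (2 * (1 + gamma) * (g ^+ 2 + Q))).
    by rewrite ler_wpM2l ?mulr_ge0// (le_trans mq)// lerDr sqr_ge0.
  by rewrite ler_wpM2r ?addr_ge0 ?sqr_ge0// ler_wpM2r// ler_nat.
apply: (le_trans (ler_wpM2l (normr_ge0 a) (ler_normB _ _))).
by rewrite mulrDr mulrDl lerD.
Qed.
End Static.

(** * The energy flux of a time slice *)

Section Flux.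
Context {R : realType}.
Implicit Types (h x y z a b s t e : R) (f g c v w V A : R -> R).
Notation mu := (@lebesgue_measure R).
Let mD : measurable (`]0, 1[ : set (measurableTypeR R)). Proof. by []. Qed.
Let mJ : measurable (`[4^-1, 3 / 4] : set (measurableTypeR R)). Proof. by []. Qed.

Lemma ctsD f g : continuous f -> continuous g -> continuous (fun y => f y + g y).
Proof. by move=> cf cg y; apply: cvgD; [exact: cf|exact: cg]. Qed.
Lemma ctsN f : continuous f -> continuous (fun y => - f y).
Proof. by move=> cf y; apply: cvgN; exact: cf. Qed.
Lemma ctsM f g : continuous f -> continuous g -> continuous (fun y => f y * g y).
Proof. by move=> cf cg y; apply: cvgM; [exact: cf|exact: cg]. Qed.
Lemma cts_cst (k : R) : continuous (fun y : R => k).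
Proof. by move=> y; exact: cst_continuous. Qed.
Lemma cts_id : continuous (fun y : R => y).
Proof. by move=> y; exact: cvg_id. Qed.
Lemma ctsX f n : continuous f -> continuous (fun y => f y ^+ n).
Proof.
move=> cf; elim: n => [|n IH]; first by under eq_fun do rewrite expr0; exact: cts_cst.
by under eq_fun do rewrite exprS; exact: ctsM.
Qed.

Lemma wctsD (S : set R) f g : {within S, continuous f} -> {within S, continuous g} -> {within S, continuous (fun y => f y + g y)}.
Proof. by move=> cf cg y; apply: cvgD; [exact: cf|exact: cg]. Qed.
Lemma wctsN (S : set R) f : {within S, continuous f} -> {within S, continuous (fun y => - f y)}.
Proof. by move=> cf y; apply: cvgN; exact: cf. Qed.
Lemma wctsM (S : set R) f g : {within S, continuous f} -> {within S, continuous g} -> {within S, continuous (fun y => f y * g y)}.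
Proof. by move=> cf cg y; apply: cvgM; [exact: cf|exact: cg]. Qed.
Lemma wcts_cst (S : set R) (k : R) : {within S, continuous (fun y : R => k)}.
Proof. by apply: continuous_subspaceT; exact: cts_cst. Qed.
Lemma wctsX (S : set R) f n : {within S, continuous f} -> {within S, continuous (fun y => f y ^+ n)}.
Proof.
move=> cf; elim: n => [|n IH]; first by under eq_fun do rewrite expr0; exact: wcts_cst.
by under eq_fun do rewrite exprS; exact: wctsM.
Qed.

(** The function [s] of the weight: on [1/4, 3/4] it is at most 1 with slope at most 1/2, as
    [energy_pointwise] demands. It is not cut off outside, all integrals in [y] being over that
    segment. *)
Definition sig y : R := (y - 4^-1) * (3 / 4 - y).
Definition dsig y : R := 1 - 2 * y.

Lemma sig_continuous : continuous sig.
Proof. by apply: ctsM; apply: ctsD; first [exact: cts_id|exact: cts_cst|apply: ctsN; exact: cts_id]. Qed.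

Lemma dsig_continuous : continuous dsig.
Proof. by apply: ctsD; [exact: cts_cst|apply: ctsN; apply: ctsM; [exact: cts_cst|exact: cts_id]]. Qed.

Lemma sig01 y : 4^-1 <= y <= 3 / 4 -> 0 <= sig y <= 1.
Proof.
move=> /andP[y1 y2]; rewrite /sig mulr_ge0 ?subr_ge0//= mulr_ile1 ?subr_ge0//; lra.
Qed.

Lemma dsig_le y : 4^-1 <= y <= 3 / 4 -> `|dsig y| <= 2^-1.
Proof. by move=> /andP[y1 y2]; rewrite /dsig ler_norml; apply/andP; split; lra. Qed.

Lemma is_derive_sig y : is_derive y 1 sig (dsig y).
Proof. by apply: is_derive_eq; rewrite /GRing.scale/= /dsig; field. Qed.

Lemma is_derive_pow f y (d : R) n : is_derive y 1 f d ->
  is_derive y 1 (fun x => f x ^+ n.+1) (n.+1%:R * f y ^+ n * d).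
Proof.
move=> H; have -> : (fun x => f x ^+ n.+1) = f ^+ n.+1 by rewrite exprfctE.
exact: (is_deriveX n.+1 H).
Qed.

Lemma is_derive_mul f g y (df dg : R) : is_derive y 1 f df -> is_derive y 1 g dg ->
  is_derive y 1 (fun x => f x * g x) (df * g y + f y * dg).
Proof.
move=> Hf Hg; apply: (is_derive_eq (is_deriveM Hf Hg)); rewrite /GRing.scale/=; ring.
Qed.

(** The exact derivative behind the integration by parts: it contains [sig^4 V A'], the diffusion
    part of the flux, together with the dissipation [sig^4 A^2], while its primitive vanishes with
    [sig] at both ends. *)
Lemma is_derive_flux V A (A' : R -> R) (k : R) n y :
  is_derive y 1 V (A y) -> is_derive y 1 A (A' y) ->
  is_derive y 1 (fun y => sig y ^+ 4 * (V y * A y + - k * V y ^+ n.+2))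
   (4 * sig y ^+ 3 * dsig y * (V y * A y + - k * V y ^+ n.+2) +
    sig y ^+ 4 * (A y * A y + V y * A' y + - k * (n.+2%:R * V y ^+ n.+1 * A y))).
Proof.
move=> dV dA.
apply: is_derive_mul; first exact: (is_derive_pow 3 (is_derive_sig y)).
apply: is_deriveD; first exact: is_derive_mul.
exact: (is_deriveZ (- k) (is_derive_pow n.+1 dV)).
Qed.

Lemma flux_derivative_continuous V A (A' : R -> R) (k : R) n :
  continuous V -> continuous A -> continuous A' ->
  continuous (fun y => 4 * sig y ^+ 3 * dsig y * (V y * A y + - k * V y ^+ n.+2) +
    sig y ^+ 4 * (A y * A y + V y * A' y + - k * (n.+2%:R * V y ^+ n.+1 * A y))).
Proof.
move=> cV cA cA'; have cs := sig_continuous; have cds := dsig_continuous.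
have cc := @cts_cst.
have cVn m : continuous (fun y => V y ^+ m) by exact: ctsX.
have csn m : continuous (fun y => sig y ^+ m) by exact: ctsX.
apply: ctsD; apply: ctsM => //.
- by apply: ctsM => //; apply: ctsM.
- by apply: ctsD; apply: ctsM.
- by apply: ctsD; [apply: ctsD; exact: ctsM|apply: ctsM => //; apply: ctsM => //; exact: ctsM].
Qed.

(** Local because a mollified weak derivative is the derivative of the mollification only for
    centres at distance more than [h] from 0 and 1. *)
Lemma RFTC2_local (F f : R -> R) a b : a < b ->
  (forall x, a <= x <= b -> is_derive x 1 F (f x)) ->
  {within `[a, b], continuous f} ->
  \int[mu]_(x in `[a, b]) f x = F b - F a.
Proof.
move=> ab dF cf.
have cF x : a <= x <= b -> {for x, continuous F}.
  move=> xab; apply/differentiable_continuous/derivable1_diffP.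
  exact: (@ex_derive _ _ _ _ _ _ _ (dF x xab)).
rewrite /Rintegral (@continuous_FTC2 _ f F)//.
- split.
  + move=> x; rewrite in_itv/= => /andP[ax xb].
    by have H := dF x; apply: (@ex_derive _ _ _ _ _ _ _ (H _)); rewrite !ltW.
  + by apply/cvg_at_right_filter/cF; rewrite lexx ltW.
  + by apply/cvg_at_left_filter/cF; rewrite lexx ltW.
- move=> x; rewrite in_itv/= => /andP[ax xb].
  rewrite derive1E; apply/derive_val; apply: dF; by rewrite !ltW.
Qed.

Definition react (gamma : R) (delta : nat) (u : R) :=
  u * (1 - u ^+ delta) * (u ^+ delta - gamma).

Lemma react_wcts (S : set R) gamma delta f : {within S, continuous f} ->
  {within S, continuous (fun y => react gamma delta (f y))}.
Proof.
move=> cf; rewrite /react; apply: wctsM.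
  by apply: wctsM => //; apply: wctsD; [exact: wcts_cst|apply: wctsN; exact: wctsX].
by apply: wctsD; [exact: wctsX|exact: wcts_cst].
Qed.

(** * One time slice: a continuous [v] with weak derivative [g] *)

Section Fixed.
Variables (alpha beta gamma : R) (delta : nat).
Variables v g : R -> R.
Hypothesis cv : {within `[0, 1], continuous v}.
Hypothesis ig : mu.-integrable `]0, 1[ (EFin \o g).
Hypothesis wd : forall psi, test_fun 0 1 psi ->
  \int[mu]_(z in `]0, 1[) (v z * derive1 psi z) = - \int[mu]_(z in `]0, 1[) (g z * psi z).

(* If [u(t) = v] has weak derivative [g], the equation says that [Gfun h y] is the
   value of [u_t(t)] on the test function [moll h y]. *)
Definition wfun z := alpha * (v z ^+ delta * g z) - beta * react gamma delta (v z).
Definition Gfun h y := - dmollify h g y - mollify h wfun y.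
(** Half of the time derivative of [sig y ^+ 4 * <u(t), moll h y> ^+ 2] along the equation. *)
Definition flux h y := sig y ^+ 4 * (mollify h v y * Gfun h y).

Lemma v_bounded : exists2 K : R, 0 <= K & forall z, 0 <= z <= 1 -> `|v z| <= K.
Proof.
have := compact_bounded (continuous_compact cv (@segment_compact R 0 1)).
move=> [M [_ HM]]; exists (`|M| + 1) => [|z z01]; first by rewrite addr_ge0.
apply: (HM (`|M| + 1)); first by rewrite (le_lt_trans (ler_norm M))// ltrDl.
by exists z => //; rewrite /= in_itv.
Qed.

Lemma wcts_int f : {within `[0, 1], continuous f} -> mu.-integrable `]0, 1[ (EFin \o f).
Proof. exact: continuous_integrable_oo. Qed.

Lemma v_integrable : mu.-integrable `]0, 1[ (EFin \o v).
Proof. exact: wcts_int. Qed.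

Lemma vX_integrable n : mu.-integrable `]0, 1[ (EFin \o (fun z => v z ^+ n)).
Proof. by apply: wcts_int; exact: wctsX. Qed.

Lemma vXg_integrable : mu.-integrable `]0, 1[ (EFin \o (fun z => v z ^+ delta * g z)).
Proof.
have [K K0 HK] := v_bounded.
apply: (@integrable_bounded_mul _ _ _ _ _ mD _ _ (K ^+ delta)) => //.
  exact: Rintegrable_measurable (vX_integrable delta).
move=> z /=; rewrite in_itv/= => /andP[z0 z1]; rewrite normrX lerXn2r ?nnegrE//.
by apply: HK; rewrite !ltW.
Qed.

Lemma react_integrable : mu.-integrable `]0, 1[ (EFin \o (fun z => react gamma delta (v z))).
Proof. by apply: wcts_int; exact: react_wcts. Qed.

Lemma wfun_integrable : mu.-integrable `]0, 1[ (EFin \o wfun).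
Proof.
apply: RintegrableB => //; apply: RintegrableZ => //; [exact: vXg_integrable|exact: react_integrable].
Qed.

(** Two signs cancel: one from differentiating in the centre instead of [z], one from the definition
    of the weak derivative, tested with [moll h y]. *)
Lemma is_derive_mollify_weak h y : 0 < h -> h < y -> y + h < 1 ->
  is_derive y 1 (mollify h v) (mollify h g y).
Proof.
move=> h0 hy hy1.
have -> : mollify h g y = - dmollify h v y; last exact: is_derive_mollify v_integrable.
rewrite /mollify /dmollify; apply/eqP; rewrite -eqr_oppLR; apply/eqP.
transitivity (- \int[mu]_(z in `]0, 1[) (g z * moll h y z)).
  by congr (- _); apply: eq_Rintegral => z _; rewrite mulrC.
rewrite -wd; last by apply: test_moll => //; rewrite subr_gt0.
by apply: eq_Rintegral => z _; rewrite derive1_moll mulrC.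
Qed.

Lemma Gfun_continuous h : continuous (Gfun h).
Proof.
apply: ctsD; apply: ctsN; first exact: dmollify_continuous ig.
exact: mollify_continuous wfun_integrable.
Qed.

Lemma flux_continuous h : continuous (flux h).
Proof.
apply: ctsM; first by apply: ctsX; exact: sig_continuous.
by apply: ctsM; [exact: mollify_continuous v_integrable|exact: Gfun_continuous].
Qed.

Let J_h h y : 0 < h -> h <= 8^-1 -> 4^-1 <= y <= 3 / 4 -> [/\ h < y, y + h < 1, 0 <= y - h & y + h <= 1].
Proof. by move=> h0 h8 /andP[y1 y2]; split; lra. Qed.

Let cJ f : continuous f -> mu.-integrable `[4^-1, 3 / 4] (EFin \o f).
Proof. by move=> cf; apply: continuous_integrable; exact: continuous_subspaceT. Qed.

(* The free parameter [k] comes from the integral of the derivative of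
   [k sig^4 V^(n+2)], which vanishes; it makes the convection term small when
   [h -> 0]. *)
Lemma flux_by_parts h (k : R) n : 0 < h -> h <= 8^-1 ->
  \int[mu]_(y in `[4^-1, 3 / 4]) flux h y =
  \int[mu]_(y in `[4^-1, 3 / 4]) (- (4 * sig y ^+ 3 * dsig y) * (mollify h v y * mollify h g y)
     - sig y ^+ 4 * mollify h g y ^+ 2
     + k * (4 * sig y ^+ 3 * dsig y) * mollify h v y ^+ n.+2
     + sig y ^+ 4 * (mollify h v y * (k * n.+2%:R * mollify h v y ^+ n * mollify h g y - mollify h wfun y))).
Proof.
move=> h0 h8.
set V := mollify h v; set A := mollify h g; set B := mollify h wfun.
pose A' y := - dmollify h g y.
have cV : continuous V by exact: mollify_continuous v_integrable.
have cA : continuous A by exact: mollify_continuous ig.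
have cA' : continuous A' by apply: ctsN; exact: dmollify_continuous ig.
have cB : continuous B by exact: mollify_continuous wfun_integrable.
have cs := sig_continuous. have cds := dsig_continuous.
pose F' y := 4 * sig y ^+ 3 * dsig y * (V y * A y + - k * V y ^+ n.+2) +
    sig y ^+ 4 * (A y * A y + V y * A' y + - k * (n.+2%:R * V y ^+ n.+1 * A y)).
have cF' : continuous F'.
  exact: flux_derivative_continuous.
have I0 : \int[mu]_(y in `[4^-1, 3 / 4]) F' y = 0.
  have dF y : 4^-1 <= y <= 3 / 4 -> is_derive y 1 (fun y => sig y ^+ 4 * (V y * A y + - k * V y ^+ n.+2)) (F' y).
    move=> /(J_h h0 h8)[hy hy1 _ _]; apply: is_derive_flux; first exact: is_derive_mollify_weak.
    exact: is_derive_mollify ig.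
  rewrite (RFTC2_local _ dF); first last.
  - exact: continuous_subspaceT.
  - lra.
  have -> : sig (3 / 4) = 0 by rewrite /sig subrr mulr0.
  have -> : sig 4^-1 = 0 by rewrite /sig subrr mul0r.
  by rewrite (exprS 0 3) !mul0r subrr.
rewrite -[LHS]subr0 -I0 -RintegralB//; [|by apply: cJ; exact: flux_continuous|exact: cJ].
apply: eq_Rintegral => y _; rewrite /flux /Gfun -/V -/B /F' /A'.
by rewrite !exprS; ring.
Qed.

Hypothesis ig2 : mu.-integrable `]0, 1[ (EFin \o (fun z => g z ^+ 2)).

Lemma sqr_le_pow (a : R) : a ^+ 2 <= 1 + a ^+ (2 * delta.+1).
Proof.
have -> : a ^+ (2 * delta.+1) = (a ^+ 2) ^+ delta.+1 by rewrite exprM.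
have A0 := sqr_ge0 a; have [a1|a1] := leP (a ^+ 2) 1.
  by rewrite (le_trans a1)// lerDl exprn_ge0.
by rewrite ler_wpDl// -[leLHS]expr1 ler_weXn2l// ltW.
Qed.

(** Density of the majorant that is integrable in time; the summand 1 absorbs lower powers of [v]
    and [g]. *)
Definition Hfun z := 1 + g z ^+ 2 + v z ^+ (2 * delta.+1).

Lemma vq_ge0 (x : R) : 0 <= x ^+ (2 * delta.+1).
Proof. by rewrite exprM exprn_ge0// sqr_ge0. Qed.

Lemma Hfun_ge0 z : 0 <= Hfun z.
Proof. by rewrite !addr_ge0// ?sqr_ge0// vq_ge0. Qed.

Lemma Hfun_integrable : mu.-integrable `]0, 1[ (EFin \o Hfun).
Proof. by apply: RintegrableD => //; [apply: RintegrableD => //; exact: cst_integrable|exact: vX_integrable]. Qed.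

(** The two factors live at different points, [y] and [z]. Bound [|mollify h v y|] by the average of
    [|v x|] and apply the hypothesis with [a = v x] under the average: [a^(2 delta + 2)] becomes a
    mean, with no power of a mean to control. *)
Lemma mollify_mul_le h y (C : R) f z : 0 <= C -> 0 < h -> h <= 8^-1 -> 4^-1 <= y <= 3 / 4 ->
  (forall a, `|a| * `|f z| <= C * (Hfun z + a ^+ (2 * delta.+1))) ->
  `|mollify h v y| * `|f z| <= C * (Hfun z + mollify h (fun x => v x ^+ (2 * delta.+1)) y).
Proof.
move=> C0 h0 h8 yJ H; have [_ _ hy hy1] := J_h h0 h8 yJ.
apply: (@le_trans _ _ (mollify h (fun x => `|f z| * `|v x|) y)).
  rewrite mollifyZ; last by apply: Rintegrable_norm; exact: v_integrable.
  by rewrite mulrC ler_wpM2l// mollify_abs//; exact: v_integrable.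
have E : C * (Hfun z + mollify h (fun x => v x ^+ (2 * delta.+1)) y) =
   mollify h (fun x => C * (Hfun z + v x ^+ (2 * delta.+1))) y.
  rewrite mollifyZ; last by apply: RintegrableD => //; [exact: cst_integrable|exact: vX_integrable].
  congr (_ * _); rewrite mollifyD; [|exact: cst_integrable|exact: vX_integrable].
  by congr (_ + _); apply/esym; exact: mollify_const.
rewrite E; apply: le_mollify => //.
- by apply: RintegrableZ => //; apply: Rintegrable_norm; exact: v_integrable.
- by apply: RintegrableZ => //; apply: RintegrableD => //; [exact: cst_integrable|exact: vX_integrable].
- by move=> x _ _; rewrite mulrC.
Qed.

Lemma g_dominated a z : `|a| * `|g z| <= 1 * (Hfun z + a ^+ (2 * delta.+1)).
Proof.
have := sqr_le_pow a; have := vq_ge0 (v z); rewrite /Hfun => v0 a2.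
have : 0 <= (`|a| - `|g z|) ^+ 2 by exact: sqr_ge0.
rewrite sqrrB !real_normK ?num_real// mulr2n.
have : 0 <= `|a| * `|g z| by rewrite mulr_ge0.
lra.
Qed.

(** Treats the kernels [moll] and [dmoll] together. [Ck] enters twice: as bound of the kernel [k],
    and as bound of [moll h y] in the mean of [v^(2 delta + 2)] produced by [mollify_mul_le]. *)
Lemma kernel_dominated h y (k : R -> R) f (C Ck : R) : 0 <= C -> 0 < h -> h <= 8^-1 -> 4^-1 <= y <= 3 / 4 ->
  (forall z, `|k z| <= Ck) -> (forall z, `|moll h y z| <= Ck) ->
  mu.-integrable `]0, 1[ (EFin \o (fun z => k z * f z)) ->
  (forall a z, `|a| * `|f z| <= C * (Hfun z + a ^+ (2 * delta.+1))) ->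
  `|mollify h v y| * `|\int[mu]_(z in `]0, 1[) (k z * f z)| <= Ck * C * (1 + Ck) * \int[mu]_(z in `]0, 1[) Hfun z.
Proof.
move=> C0 h0 h8 yJ HC HCm ik H.
have Ck0 : 0 <= Ck by exact: le_trans (HC 0).
have iHM : mu.-integrable `]0, 1[ (EFin \o (fun z => Ck * (C * (Hfun z + mollify h (fun x => v x ^+ (2 * delta.+1)) y)))).
  by apply: RintegrableZ => //; apply: RintegrableZ => //; apply: RintegrableD => //; [exact: Hfun_integrable|exact: cst_integrable].
apply: (@le_trans _ _ (\int[mu]_(z in `]0, 1[) (Ck * (C * (Hfun z + mollify h (fun x => v x ^+ (2 * delta.+1)) y))))).
  rewrite (le_trans (ler_wpM2l _ (le_normr_Rintegral mD ik)))//.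
  rewrite -RintegralZl//; last exact: Rintegrable_norm.
  apply: le_Rintegral => //; first by apply: RintegrableZ => //; exact: Rintegrable_norm.
  move=> z _; rewrite normrM mulrCA ler_pM ?mulr_ge0//; exact: mollify_mul_le.
rewrite RintegralZl//; last first.
  by apply: RintegrableZ => //; apply: RintegrableD => //; [exact: Hfun_integrable|exact: cst_integrable].
rewrite RintegralZl//; last by apply: RintegrableD => //; [exact: Hfun_integrable|exact: cst_integrable].
rewrite RintegralD//; [|exact: Hfun_integrable|exact: cst_integrable].
rewrite -!mulrA ler_wpM2l// ler_wpM2l// mulrDl mul1r lerD2l.
rewrite Rintegral_cst// (_ : fine (mu `]0, 1[) = 1) ?mulr1; last first.
  by rewrite lebesgue_measure_itv/= lte01 oppr0 adde0.
rewrite /mollify -RintegralZl//; last exact: Hfun_integrable.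
apply: le_Rintegral => //; [by apply: moll_mul_integrable; exact: vX_integrable|by apply: RintegrableZ => //; exact: Hfun_integrable|].
move=> z _; apply: (@le_trans _ _ (Ck * v z ^+ (2 * delta.+1))).
  by rewrite ler_wpM2r ?vq_ge0// (le_trans (ler_norm _)).
by rewrite ler_wpM2l// /Hfun lerDr addr_ge0// sqr_ge0.
Qed.
End Fixed.

(** Pointwise in [y], from sup bounds of the kernels; [C] depends on [h]. It dominates the Riemann
    sums in [y] while [h] is fixed. *)
Lemma flux_bounded alpha beta gamma delta : 0 < alpha -> 0 < beta -> 0 < gamma ->
  forall h, 0 < h -> h <= 8^-1 -> exists2 C : R, 0 <= C & forall v g,
  {within `[0, 1], continuous v} ->
  mu.-integrable `]0, 1[ (EFin \o g) ->
  mu.-integrable `]0, 1[ (EFin \o (fun z => g z ^+ 2)) ->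
  forall y, 4^-1 <= y <= 3 / 4 ->
  `|flux alpha beta gamma delta v g h y| <= C * \int[mu]_(z in `]0, 1[) Hfun delta v g z.
Proof.
move=> a0 b0 g0 h h0 h8.
have [C1 C10 HC1] := @scalar_dom R alpha beta gamma delta a0 b0 g0.
have [K1 K10 HK1] := @moll_bounded R h; have [K2 K20 HK2] := @dmoll_bounded R h.
pose Ck := K1 + K2.
have Ck0 : 0 <= Ck by rewrite addr_ge0.
have k1 y z : `|moll h y z| <= Ck by rewrite (le_trans (HK1 y z))// lerDl.
have k2 y z : `|dmoll h y z| <= Ck by rewrite (le_trans (HK2 y z))// lerDr.
exists (Ck * 1 * (1 + Ck) + Ck * C1 * (1 + Ck)); first by rewrite !(addr_ge0, mulr_ge0).
move=> v g cv ig ig2 y yJ.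
have /andP[s0 s1] := sig01 yJ.
rewrite /flux normrM normrX (ger0_norm s0) (le_trans (ler_piMl _ _))//; first exact: exprn_ile1.
rewrite /Gfun normrM (le_trans (ler_wpM2l _ (ler_normB _ _)))// normrN mulrDr mulrDl lerD//.
  rewrite /dmollify; apply: (@kernel_dominated delta v g cv ig2 h y (dmoll h y) g) => //; first exact: dmoll_mul_integrable.
  by move=> a z; exact: g_dominated.
rewrite {2}/mollify; apply: (@kernel_dominated delta v g cv ig2 h y (moll h y)) => //; first by apply: moll_mul_integrable; exact: wfun_integrable.
move=> a z; rewrite /Hfun /wfun; exact: HC1.
Qed.

Lemma Rintegral_J_affine (c1 c2 : R) f : 0 <= c1 -> continuous f ->
  \int[mu]_(y in `[4^-1, 3 / 4]) (c1 + c2 * f y) <= c1 + c2 * \int[mu]_(y in `[4^-1, 3 / 4]) f y.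
Proof.
move=> c10 cf.
have cJ k : continuous k -> mu.-integrable `[4^-1, 3 / 4] (EFin \o k).
  by move=> ck; apply: continuous_integrable; exact: continuous_subspaceT.
rewrite RintegralD//; [|exact: cJ (@cts_cst _)|by apply: cJ; apply: ctsM => //; exact: cts_cst].
rewrite RintegralZl//; last exact: cJ.
rewrite lerD2r Rintegral_cst// (_ : fine (mu `[4^-1, 3 / 4]) = 2^-1); first by rewrite ler_piMr//; lra.
by rewrite lebesgue_measure_itv/= lte_fin ifT/=; lra.
Qed.

(** Here [C] is the same for all [h]. By [flux_by_parts] with [k = 0] no derivative is left on the
    mollifier, and the cross term is absorbed by the dissipation, leaving [V^2]. Jensen's inequality
    bounds this by a mean of [Hfun], the lower-order part by two such means with factor [C1], and
    [mollify_Tonelli] removes the means. *)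
Lemma flux_dominated alpha beta gamma delta : 0 < alpha -> 0 < beta -> 0 < gamma ->
  exists2 C : R, 0 <= C & forall v g,
  {within `[0, 1], continuous v} ->
  mu.-integrable `]0, 1[ (EFin \o g) ->
  mu.-integrable `]0, 1[ (EFin \o (fun z => g z ^+ 2)) ->
  (forall psi, test_fun 0 1 psi ->
    \int[mu]_(z in `]0, 1[) (v z * derive1 psi z) = - \int[mu]_(z in `]0, 1[) (g z * psi z)) ->
  forall h, 0 < h -> h <= 8^-1 ->
  \int[mu]_(y in `[4^-1, 3 / 4]) flux alpha beta gamma delta v g h y <= C * \int[mu]_(z in `]0, 1[) Hfun delta v g z.
Proof.
move=> a0 b0 g0.
have [C1 C10 HC1] := @scalar_dom R alpha beta gamma delta a0 b0 g0.
exists (1 + C1 * 2); first by rewrite addr_ge0// mulr_ge0.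
move=> v g cv ig ig2 wd h h0 h8.
have J_h y : 4^-1 <= y <= 3 / 4 -> [/\ h < y, y + h < 1, 0 <= y - h & y + h <= 1].
  by move=> /andP[y1 y2]; split; lra.
have iHH := Hfun_integrable delta cv ig2.
have iw' := wfun_integrable alpha beta gamma delta cv ig.
have cMH : continuous (mollify h (Hfun delta v g)) by exact: mollify_continuous.
apply: (@le_trans _ _ (\int[mu]_(y in `[4^-1, 3 / 4]) (0 + (1 + C1 * 2) * mollify h (Hfun delta v g) y))); last first.
  apply: le_trans (Rintegral_J_affine _ (lexx _) cMH) _.
  rewrite add0r ler_wpM2l ?addr_ge0 ?mulr_ge0//.
  by apply: mollify_Tonelli => // z; exact: Hfun_ge0.
rewrite (flux_by_parts alpha beta gamma delta cv ig wd 0 0 h0 h8).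
set V := mollify h v; set A := mollify h g; set B := mollify h _.
have cV : continuous V by apply: mollify_continuous; exact: v_integrable.
have cA : continuous A by exact: mollify_continuous ig.
have cB : continuous B by exact: mollify_continuous iw'.
have cs := sig_continuous. have cds := dsig_continuous.
have cJ k : continuous k -> mu.-integrable `[4^-1, 3 / 4] (EFin \o k).
  by move=> ck; apply: continuous_integrable; exact: continuous_subspaceT.
apply: le_Rintegral => //.
- apply: cJ; apply: ctsD; first apply: ctsD; first apply: ctsD.
  + by apply: ctsM; [apply: ctsN; apply: ctsM => //; apply: ctsM; [exact: cts_cst|exact: ctsX]|exact: ctsM].
  + by apply: ctsN; apply: ctsM; exact: ctsX.
  + apply: ctsM; last exact: ctsX.
    by apply: ctsM; [exact: cts_cst|apply: ctsM => //; apply: ctsM; [exact: cts_cst|exact: ctsX]].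
  + apply: ctsM; first exact: ctsX.
    apply: ctsM => //; apply: ctsD; last exact: ctsN.
    by apply: ctsM => //; apply: ctsM; [exact: cts_cst|exact: ctsX].
- by apply: cJ; apply: ctsD; [exact: cts_cst|apply: ctsM; [exact: cts_cst|]].
move=> y /=; rewrite in_itv/= => yJ; rewrite !mul0r addr0 !sub0r add0r.
have [_ _ hy hy1] := J_h y yJ.
have /andP[s0 s1] := sig01 yJ.
rewrite [leRHS]mulrDl mul1r lerD//.
  apply: (@le_trans _ _ (V y ^+ 2)).
    apply: (@le_trans _ _ (4 * sig y ^+ 2 * dsig y ^+ 2 * V y ^+ 2)).
      rewrite -subr_ge0.
      have -> : 4 * sig y ^+ 2 * dsig y ^+ 2 * V y ^+ 2 - (- (4 * sig y ^+ 3 * dsig y) * (V y * A y) - sig y ^+ 4 * A y ^+ 2)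
        = (2 * sig y * dsig y * V y + sig y ^+ 2 * A y) ^+ 2 by ring.
      exact: sqr_ge0.
    rewrite -[leRHS]mul1r ler_wpM2r ?sqr_ge0//.
    have s2 : dsig y ^+ 2 <= (2^-1) ^+ 2.
      by rewrite -real_normK ?num_real// lerXn2r// ?nnegrE// ?invr_ge0// dsig_le.
    have s3 : sig y ^+ 2 <= 1 by rewrite exprn_ile1.
    have : sig y ^+ 2 * dsig y ^+ 2 <= 1 * (2^-1) ^+ 2 by rewrite ler_pM ?sqr_ge0.
    by rewrite -mulrA; lra.
  apply: (le_trans (mollify_sqr h0 hy hy1 (v_integrable cv) (vX_integrable cv 2))).
  apply: le_mollify => //; first exact: vX_integrable.
  move=> z _ _; have := sqr_le_pow delta (v z); have := sqr_ge0 (g z); rewrite /Hfun; lra.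
apply: (@le_trans _ _ (`|V y| * `|B y|)).
  apply: (le_trans (ler_norm _)); rewrite normrM normrX (ger0_norm s0) normrM normrN.
  by rewrite ler_piMl ?mulr_ge0// exprn_ile1.
have iHM (k : R) : mu.-integrable `]0, 1[ (EFin \o (fun z => C1 * (Hfun delta v g z + k))).
  by apply: RintegrableZ => //; apply: RintegrableD => //; exact: cst_integrable.
have ik (f : R -> R) (k : R) : mu.-integrable `]0, 1[ (EFin \o f) -> mu.-integrable `]0, 1[ (EFin \o (fun z => k * f z)).
  exact: RintegrableZ.
apply: (@le_trans _ _ (mollify h (fun z => C1 * (Hfun delta v g z + mollify h (fun x => v x ^+ (2 * delta.+1)) y)) y)).
  apply: (@le_trans _ _ (mollify h (fun z => `|V y| * `|wfun alpha beta gamma delta v g z|) y)).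
    rewrite mollifyZ; last by apply: Rintegrable_norm.
    by rewrite ler_wpM2l// mollify_abs.
  apply: le_mollify => //; first by apply: ik; apply: Rintegrable_norm.
  move=> z _ _; apply: mollify_mul_le => // a; exact: HC1.
rewrite mollifyZ; last by apply: RintegrableD => //; exact: cst_integrable.
rewrite mollifyD//; last exact: cst_integrable.
rewrite -mulrA ler_wpM2l// mulrDl mul1r lerD2l.
rewrite [leLHS]mollify_const//.
apply: le_mollify => //; first exact: vX_integrable.
by move=> z _ _; rewrite /Hfun lerDr addr_ge0// sqr_ge0.
Qed.

(** With [k = alpha / (delta + 2)] the integration by parts subtracts the convection of the
    mollified function. What remains is the expression of [energy_pointwise] in [V] and [A], plus
    the commutator of mollification with the nonlinear terms, which tends to 0 with [h]. Only [h1]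
    depends on [v] and [g], not [C]. *)
Lemma flux_upper alpha beta gamma delta : 0 < alpha -> 0 < beta -> 0 < gamma -> (1 <= delta)%N ->
  exists2 C : R, 0 <= C & forall v g,
  {within `[0, 1], continuous v} ->
  mu.-integrable `]0, 1[ (EFin \o g) ->
  (forall psi, test_fun 0 1 psi ->
    \int[mu]_(z in `]0, 1[) (v z * derive1 psi z) = - \int[mu]_(z in `]0, 1[) (g z * psi z)) ->
  forall e, 0 < e -> exists2 h1 : R, 0 < h1 & forall h, 0 < h -> h <= 8^-1 -> h <= h1 ->
  \int[mu]_(y in `[4^-1, 3 / 4]) flux alpha beta gamma delta v g h y <= C + e.
Proof.
move=> a0 b0 g0 d1.
have [C0 C00 HC0] := @energy_pointwise R alpha beta gamma delta a0 b0 g0 d1.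
exists C0 => // v g cv ig wd e e0.
have [K K0 HK] := v_bounded cv.
have iw' := wfun_integrable alpha beta gamma delta cv ig.
pose G := \int[mu]_(z in `]0, 1[) `|g z|.
have G0 : 0 <= G by exact: Rintegral_ge0.
(* The commutator will cost at most [K * (alpha * G + beta) * eps], so [eps = e / W] suffices; the
   added 1 makes [W] positive. *)
pose W := K * (alpha * G + beta) + 1.
have W1 : 1 <= W by rewrite lerDr mulr_ge0// addr_ge0 ?mulr_ge0// ltW.
have W0 : 0 < W by exact: lt_le_trans W1.
have [eps eps0 epsW] : exists2 eps : R, 0 < eps & W * eps = e.
  by exists (e / W); [rewrite divr_gt0|rewrite mulrC divfK// gt_eqF].
have [n1 n10 Hn1] : exists2 d : R, 0 < d & forall x z, - K <= x <= K -> - K <= z <= K -> `|z - x| < d -> `|z ^+ delta - x ^+ delta| <= eps.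
  apply: segment_unif_continuous => //; apply: wctsX; apply: continuous_subspaceT; exact: cts_id.
have [n2 n20 Hn2] : exists2 d : R, 0 < d & forall x z, - K <= x <= K -> - K <= z <= K -> `|z - x| < d -> `|react gamma delta z - react gamma delta x| <= eps.
  apply: segment_unif_continuous => //; apply: react_wcts; apply: continuous_subspaceT; exact: cts_id.
pose n := Num.min n1 n2.
have n0 : 0 < n by rewrite lt_min n10.
(* Thirds, since [V y] and [v z] are each within [n / 3] of [v y], hence less than [n] apart. *)
have [h1 h10 Hh1] := segment_unif_continuous cv (divr_gt0 n0 (ltr0n R 3)).
exists h1 => // h h0 h8 hh1.
have J_h y : 4^-1 <= y <= 3 / 4 -> [/\ h < y, y + h < 1, 0 <= y - h & y + h <= 1].
  by move=> /andP[y1 y2]; split; lra.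
rewrite (flux_by_parts alpha beta gamma delta cv ig wd (alpha / delta.+2%:R) delta h0 h8).
set V := mollify h v; set A := mollify h g; set B := mollify h _.
have cV : continuous V by apply: mollify_continuous; exact: v_integrable.
have cA : continuous A by exact: mollify_continuous ig.
have cB : continuous B by exact: mollify_continuous iw'.
have cs := sig_continuous. have cds := dsig_continuous.
have cJ k : continuous k -> mu.-integrable `[4^-1, 3 / 4] (EFin \o k).
  by move=> ck; apply: continuous_integrable; exact: continuous_subspaceT.
pose Mg := mollify h (fun z => `|g z|).
have cM : continuous Mg by apply: mollify_continuous; exact: Rintegrable_norm.
have a0' := ltW a0; have b0' := ltW b0; have e0' := ltW eps0.
apply: (@le_trans _ _ (\int[mu]_(y in `[4^-1, 3 / 4]) ((C0 + K * eps * beta) + (K * eps * alpha) * Mg y))); last first.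
  have c10 : 0 <= C0 + K * eps * beta by rewrite addr_ge0// !mulr_ge0.
  apply: (le_trans (Rintegral_J_affine _ c10 cM)).
  rewrite -addrA lerD2l.
  apply: (@le_trans _ _ (K * eps * beta + K * eps * alpha * G)).
    rewrite lerD2l ler_wpM2l ?mulr_ge0//; apply: mollify_Tonelli => //; exact: Rintegrable_norm.
  have -> : K * eps * beta + K * eps * alpha * G = (K * (alpha * G + beta)) * eps by ring.
  apply: (@le_trans _ _ (W * eps)); first by rewrite ler_wpM2r// /W lerDl.
  by rewrite epsW.
apply: le_Rintegral => //.
- apply: cJ; apply: ctsD; first apply: ctsD; first apply: ctsD.
  + by apply: ctsM; [apply: ctsN; apply: ctsM => //; apply: ctsM; [exact: cts_cst|exact: ctsX]|exact: ctsM].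
  + by apply: ctsN; apply: ctsM; exact: ctsX.
  + apply: ctsM; last exact: ctsX.
    by apply: ctsM; [exact: cts_cst|apply: ctsM => //; apply: ctsM; [exact: cts_cst|exact: ctsX]].
  + apply: ctsM; first exact: ctsX.
    apply: ctsM => //; apply: ctsD; last exact: ctsN.
    by apply: ctsM => //; apply: ctsM; [exact: cts_cst|exact: ctsX].
- by apply: cJ; apply: ctsD; [exact: cts_cst|apply: ctsM; [exact: cts_cst|]].
move=> y /=; rewrite in_itv/= => yJ.
have [_ _ hy hy1] := J_h y yJ.
have s01 := sig01 yJ; have /andP[s0 s1] := s01.
have y01 : 0 <= y <= 1 by move: yJ => /andP[? ?]; apply/andP; split; lra.
have Vy : `|V y| <= K.
  apply: (le_trans (mollify_abs _ h0 (v_integrable cv))).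
  rewrite -(mollify_cst K h0 hy hy1); apply: le_mollify => //.
  - by apply: Rintegrable_norm; exact: v_integrable.
  - exact: cst_integrable.
  - by move=> z /andP[z0 z1] _; apply: HK; rewrite !ltW.
have Vv : `|V y - v y| <= n / 3.
  apply: moll_avg => //; first exact: v_integrable.
  by move=> z /andP[z0 z1] zy; apply: Hh1; rewrite ?y01 ?ltW//; exact: lt_le_trans hh1.
have near z : 0 < z < 1 -> `|z - y| < h -> [/\ - K <= V y <= K, - K <= v z <= K & `|v z - V y| < n].
  move=> /andP[z0 z1] zy; split.
  - by rewrite -ler_norml.
  - by rewrite -ler_norml HK// !ltW.
  - rewrite -(subrKA (v y)) (le_lt_trans (ler_normD _ _))//.
    have : `|v z - v y| <= n / 3 by apply: Hh1; rewrite ?y01 ?ltW//; exact: lt_le_trans hh1.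
    by rewrite (distrC (v y)); lra.
have D1 : `|alpha * (V y ^+ delta * A y) - beta * react gamma delta (V y) - B y| <= eps * (alpha * Mg y + beta).
  have i1 : mu.-integrable `]0, 1[ (EFin \o (fun z => alpha * (V y ^+ delta * g z) + - (beta * react gamma delta (V y)))).
    by apply: RintegrableD => //; [apply: RintegrableZ => //; exact: RintegrableZ|exact: cst_integrable].
  have -> : alpha * (V y ^+ delta * A y) - beta * react gamma delta (V y) - B y =
    mollify h (fun z => (alpha * (V y ^+ delta * g z) + - (beta * react gamma delta (V y))) + -1 * wfun alpha beta gamma delta v g z) y.
    rewrite mollifyD//; last exact: RintegrableZ.
    rewrite mollifyD//; [|by apply: RintegrableZ => //; exact: RintegrableZ|exact: cst_integrable].
    rewrite mollifyZ; last exact: RintegrableZ.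
    rewrite mollifyZ// mollifyZ// mulN1r; congr (_ + _ - _).
    by apply/esym; exact: mollify_const.
  have -> : eps * (alpha * Mg y + beta) = mollify h (fun z => eps * (alpha * `|g z| + beta)) y.
    rewrite mollifyZ; last by apply: RintegrableD => //; [apply: RintegrableZ => //; exact: Rintegrable_norm|exact: cst_integrable].
    rewrite mollifyD; [|by apply: RintegrableZ => //; exact: Rintegrable_norm|exact: cst_integrable].
    rewrite mollifyZ; last exact: Rintegrable_norm.
    by congr (_ * (_ + _)); apply/esym; exact: mollify_const.
  have i2 : mu.-integrable `]0, 1[ (EFin \o (fun z => (alpha * (V y ^+ delta * g z) + - (beta * react gamma delta (V y))) + -1 * wfun alpha beta gamma delta v g z)).
    by apply: RintegrableD => //; exact: RintegrableZ.
  apply: (le_trans (mollify_abs _ h0 i2)); apply: le_mollify => //.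
  - exact: Rintegrable_norm.
  - by apply: RintegrableZ => //; apply: RintegrableD => //; [apply: RintegrableZ => //; exact: Rintegrable_norm|exact: cst_integrable].
  move=> z z01 zy; have [VK vK vV] := near z z01 zy.
  have -> : alpha * (V y ^+ delta * g z) + - (beta * react gamma delta (V y)) + -1 * wfun alpha beta gamma delta v g z
    = - (alpha * ((v z ^+ delta - V y ^+ delta) * g z)) + beta * (react gamma delta (v z) - react gamma delta (V y)).
    by rewrite /wfun; ring.
  apply: (le_trans (ler_normD _ _)); rewrite normrN !normrM (gtr0_norm a0) (gtr0_norm b0) mulrDr.
  rewrite lerD//.
    rewrite [leRHS]mulrCA ler_wpM2l// ler_wpM2r// Hn1//.
    by rewrite (lt_le_trans vV)// ge_min lexx.
  rewrite [leRHS]mulrC ler_wpM2l// Hn2//.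
  by rewrite (lt_le_trans vV)// ge_min lexx orbT.
have E := HC0 (sig y) (dsig y) (V y) (A y) s01 (dsig_le yJ).
have -> : alpha / delta.+2%:R * delta.+2%:R = alpha by rewrite divfK// pnatr_eq0.
have T : sig y ^+ 4 * (V y * (alpha * (V y ^+ delta * A y) - beta * react gamma delta (V y) - B y)) <= K * (eps * (alpha * Mg y + beta)).
  apply: (le_trans (ler_norm _)); rewrite normrM normrX (ger0_norm s0) (le_trans (ler_piMl _ _))//.
    exact: exprn_ile1.
  by rewrite normrM ler_pM.
have -> : C0 + K * eps * beta + K * eps * alpha * Mg y = C0 + K * (eps * (alpha * Mg y + beta)) by ring.
apply: le_trans (lerD E T); rewrite -/(react gamma delta (V y)).
move: (V y ^+ delta.+2) => V2; move: (V y ^+ delta) => Vd; move: (react _ _ _) => r.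
by rewrite le_eqVlt; apply/orP; left; apply/eqP; ring.
Qed.
End Flux.

(** * Absolutely continuous functions of time and Riemann sums *)

Section Partition.
Context {R : realType}.
Implicit Types (x y z a b s t e : R) (f g c : R -> R).
Notation mu := (@lebesgue_measure R).

(** Under subdivision the left side obeys the triangle inequality and the right side telescopes; a
    uniform partition of mesh below [d] reduces to short intervals. *)
Lemma chain_le (Phi Gam : R -> R) a b d (K : R) : a <= b -> 0 < d ->
  (forall s t, a <= s -> s < t -> t <= b -> t - s < d -> `|Phi t - Phi s| <= K * (Gam t - Gam s)) ->
  `|Phi b - Phi a| <= K * (Gam b - Gam a).
Proof.
rewrite le_eqVlt => /predU1P[-> _ _|ab d0 H]; first by rewrite !subrr mulr0 normr0.
pose n := (Num.truncn ((b - a) / d)).+1.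
have n0 : 0 < n%:R :> R by rewrite ltr0n.
have nd : (b - a) / n%:R < d.
  rewrite ltr_pdivrMr// mulrC -ltr_pdivrMr//.
  by rewrite /n; apply: truncnS_gt.
pose p (k : nat) := a + k%:R * ((b - a) / n%:R).
have eta0 : 0 < (b - a) / n%:R by rewrite divr_gt0// subr_gt0.
have pS k : p k.+1 = p k + (b - a) / n%:R by rewrite /p -[k.+1%:R]natr1 mulrDl mul1r addrA.
have pn : p n = b by rewrite /p mulrC divfK ?gt_eqF// addrC subrK.
have ple k : (k <= n)%N -> p k <= b.
  by move=> kn; rewrite -pn /p lerD2l ler_wpM2r ?ler_nat// ltW.
have pge k : a <= p k by rewrite lerDl mulr_ge0// ltW.
suff G k : (k <= n)%N -> `|Phi (p k) - Phi a| <= K * (Gam (p k) - Gam a).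
  by have := G n (leqnn n); rewrite pn.
elim: k => [_|k IH kn]; first by rewrite /p mul0r addr0 !subrr mulr0 normr0.
rewrite -(subrKA (Phi (p k))) (le_trans (ler_normD _ _))//.
have -> : K * (Gam (p k.+1) - Gam a) = K * (Gam (p k.+1) - Gam (p k)) + K * (Gam (p k) - Gam a) by ring.
rewrite lerD// ?IH 1?ltnW//.
apply: H => //; first by rewrite pS ltrDl.
  exact: ple.
by rewrite pS addrC addKr.
Qed.

Lemma Rintegral_oo_split a b s t f : mu.-integrable `]a, b[ (EFin \o f) ->
  a <= s -> s < t -> t <= b ->
  \int[mu]_(x in `]a, t[) f x - \int[mu]_(x in `]a, s[) f x = \int[mu]_(x in `]s, t[) f x.
Proof.
move=> i1 as_ st tb.
have it : mu.-integrable `]a, t[ (EFin \o f).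
  by apply: integrableS i1 => //; apply: subset_itvl; rewrite bnd_simp.
rewrite -(@Rintegral_itvB R f (BRight a) (BLeft t) s)//.
  congr (_ - _); rewrite Rintegral_itv_bndo_bndc//.
  by apply: integrableS it => //; apply: subset_itvl; rewrite bnd_simp ltW.
Qed.

(** The chain rule for [c^2] without differentiating [c]. On a short interval the increment of
    [c^2 - 2 \int c g] is the integral of [(c t + c s - 2 c) g], at most [2 e \int |g|] by uniform
    continuity; chaining gives this bound on all of [a, b], and [e] is arbitrary. *)
Lemma weak_sqr a b c g : a < b -> {within `[a, b], continuous c} ->
  mu.-integrable `]a, b[ (EFin \o g) ->
  (forall s t, a <= s -> s < t -> t <= b -> c t - c s = \int[mu]_(x in `]s, t[) g x) ->
  mu.-integrable `]a, b[ (EFin \o (fun x => c x * g x)) /\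
  c b ^+ 2 - c a ^+ 2 = 2 * \int[mu]_(x in `]a, b[) (c x * g x).
Proof.
move=> ab cc ig H.
have mI (s t : R) : measurable (`]s, t[ : set (measurableTypeR R)) by [].
have ic := continuous_integrable_oo cc.
have [M [_ HM]] := compact_bounded (continuous_compact cc (@segment_compact R a b)).
have cb x : a <= x <= b -> `|c x| <= `|M| + 1.
  move=> xab; apply: (HM (`|M| + 1)); first by rewrite (le_lt_trans (ler_norm M))// ltrDl.
  by exists x => //; rewrite /= in_itv.
have icg : mu.-integrable `]a, b[ (EFin \o (fun x => c x * g x)).
  apply: (@integrable_bounded_mul _ _ _ _ _ (mI a b) _ _ (`|M| + 1)) => //.
    exact: Rintegrable_measurable ic.
  by move=> x /=; rewrite in_itv/= => /andP[ax xb]; apply: cb; rewrite !ltW.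
split => //.
pose Phi t := c t ^+ 2 - 2 * \int[mu]_(x in `]a, t[) (c x * g x).
pose Gam t := \int[mu]_(x in `]a, t[) `|g x|.
have key e : 0 < e -> `|Phi b - Phi a| <= 2 * e * (Gam b - Gam a).
  move=> e0; have [d d0 Hd] := segment_unif_continuous cc e0.
  apply: (@chain_le Phi Gam a b d _ (ltW ab) d0) => s t as_ st tb std.
  have sub : `]s, t[ `<=` (`]a, b[ : set (measurableTypeR R)).
    by move=> x /=; rewrite !in_itv/= => /andP[? ?]; apply/andP; split; lra.
  have ig' : mu.-integrable `]s, t[ (EFin \o g) by apply: integrableS ig.
  have icg' : mu.-integrable `]s, t[ (EFin \o (fun x => c x * g x)) by apply: integrableS icg.
  have iag := Rintegrable_norm ig.
  rewrite /Gam (Rintegral_oo_split iag)//.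
  have -> : Phi t - Phi s = \int[mu]_(x in `]s, t[) ((c t + c s) * g x - 2 * (c x * g x)).
    rewrite RintegralB//; [|exact: RintegrableZ|exact: RintegrableZ].
    rewrite !RintegralZl// -H// -(Rintegral_oo_split icg as_ st tb) /Phi; ring.
  have ii : mu.-integrable `]s, t[ (EFin \o (fun x => (c t + c s) * g x - 2 * (c x * g x))).
    by apply: RintegrableB => //; exact: RintegrableZ.
  apply: (le_trans (le_normr_Rintegral (mI s t) ii)).
  rewrite -RintegralZl//; last exact: Rintegrable_norm.
  apply: le_Rintegral => //; [exact: Rintegrable_norm|by apply: RintegrableZ => //; exact: Rintegrable_norm|].
  move=> x /=; rewrite in_itv/= => /andP[sx xt].
  have -> : (c t + c s) * g x - 2 * (c x * g x) = ((c t - c x) + (c s - c x)) * g x by ring.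
  rewrite normrM ler_wpM2r// (le_trans (ler_normD _ _))//.
  have c1 : `|c t - c x| <= e.
    by apply: Hd; [lra|lra|rewrite gtr0_norm; lra].
  have c2 : `|c s - c x| <= e.
    by apply: Hd; [lra|lra|rewrite distrC gtr0_norm; lra].
  lra.
have Phi0 : Phi b - Phi a = 0.
  apply/eqP; rewrite -normr_le0; apply/ler_addgt0Pr => e e0; rewrite add0r.
  have G0 : 0 <= Gam b - Gam a.
    by rewrite /Gam (Rintegral_oo_split (Rintegrable_norm ig))//; apply: Rintegral_ge0.
  pose G := 2 * (Gam b - Gam a) + 1.
  have G1 : 0 < G by rewrite ltr_wpDl ?mulr_ge0.
  have := key (e / G) (divr_gt0 e0 G1); move/le_trans; apply.
  have -> : 2 * (e / G) * (Gam b - Gam a) = e * (2 * (Gam b - Gam a)) / G by ring.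
  by rewrite ler_pdivrMr// ler_wpM2l ?lerDl// ltW.
move: Phi0; rewrite /Phi set_itvoo0 Rintegral_set0 mulr0 subr0; lra.
Qed.

(* Riemann sums replace Fubini in exchanging the integrals in time and space:
   nothing is known about joint measurability in [(t, x)]. *)
Definition rsum (F : R -> R) n := \sum_(k < n.+1) ((2^-1 / n.+1%:R) * F (4^-1 + k%:R * (2^-1 / n.+1%:R))).

Lemma rsum_point n (k : nat) : (k < n.+1)%N -> 4^-1 <= (4^-1 + k%:R * (2^-1 / n.+1%:R) : R) <= 3 / 4.
Proof.
move=> kn; have n0 : 0 < n.+1%:R :> R by rewrite ltr0n.
rewrite lerDl mulr_ge0 ?divr_ge0//=.
have -> : 3 / 4 = 4^-1 + 2^-1 :> R by lra.
rewrite lerD2l mulrA ler_pdivrMr// mulrC ler_wpM2l// ?invr_ge0// ler_nat ltnW//.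
Qed.

(** Left end points of [n + 1] equal cells; on each cell the error is at most [e] times its length,
    and the cells are added up by induction. *)
Lemma rsum_cvg (F : R -> R) : {within `[4^-1, 3 / 4], continuous F} ->
  rsum F n @[n --> \oo] --> \int[mu]_(x in `[4^-1, 3 / 4]) F x.
Proof.
move=> cF.
have iF := continuous_integrable cF; have iF' := continuous_integrable_oo cF.
rewrite -Rintegral_oo_cc//.
have mI (s t : R) : measurable (`]s, t[ : set (measurableTypeR R)) by [].
apply/cvgrPdist_le => e e0.
have [d d0 Hd] := segment_unif_continuous cF e0.
near=> n.
have nd : 2^-1 / n.+1%:R < d.
  rewrite ltr_pdivrMr ?ltr0n// mulrC -ltr_pdivrMr//.
  apply: (@lt_trans _ _ n%:R); last by rewrite ltr_nat.
  by near: n; exact: nbhs_infty_gtr.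
pose eta : R := 2^-1 / n.+1%:R.
have eta0 : 0 < eta by rewrite divr_gt0// ?invr_gt0// ltr0n.
pose p (k : nat) : R := 4^-1 + k%:R * eta.
have pS k : p k.+1 = p k + eta by rewrite /p -[k.+1%:R]natr1 mulrDl mul1r addrA.
have pn : p n.+1 = 3 / 4.
  by rewrite /p /eta mulrC divfK ?pnatr_eq0//; lra.
have ple k : (k <= n.+1)%N -> p k <= 3 / 4.
  by move=> kn; rewrite -pn /p lerD2l ler_wpM2r ?ler_nat// ltW.
have pge k : 4^-1 <= p k by rewrite lerDl mulr_ge0// ltW.
suff G k : (k <= n.+1)%N ->
    `|\int[mu]_(x in `]4^-1, p k[) F x - \sum_(j < k) (eta * F (p j))| <= e * (p k - 4^-1).
  have := G n.+1 (leqnn _); rewrite pn => /le_trans; apply.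
  by rewrite -[leRHS]mulr1 ler_wpM2l ?ltW//; lra.
elim: k => [_|k IH kn].
  by rewrite big_ord0 /p mul0r addr0 set_itvoo0 Rintegral_set0 !subrr mulr0 normr0.
rewrite big_ord_recr/=.
have pkS : p k < p k.+1 by rewrite pS ltrDl.
have sp := Rintegral_oo_split iF' (pge k) pkS (ple _ kn).
have -> : \int[mu]_(x in `]4^-1, p k.+1[) F x - (\sum_(i < k) eta * F (p i) + eta * F (p k)) =
   (\int[mu]_(x in `]4^-1, p k[) F x - \sum_(i < k) eta * F (p i)) + (\int[mu]_(x in `]p k, p k.+1[) F x - eta * F (p k)).
  by rewrite -sp; ring.
rewrite (le_trans (ler_normD _ _))//.
have -> : e * (p k.+1 - 4^-1) = e * (p k - 4^-1) + e * eta by rewrite pS; ring.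
rewrite lerD ?IH// 1?ltnW//.
have mlen : fine (mu `]p k, p k.+1[) = eta.
  by rewrite lebesgue_measure_itv/= lte_fin pkS/= pS addrC addKr.
have isub : mu.-integrable `]p k, p k.+1[ (EFin \o F).
  by apply: integrableS iF' => // x /=; rewrite !in_itv/= => /andP[? ?]; have := pge k; have := ple _ kn => ? ?; apply/andP; split; lra.
have ick (r : R) : mu.-integrable `]p k, p k.+1[ (EFin \o cst r).
  by apply: continuous_integrable_oo; apply: continuous_subspaceT => x; exact: cst_continuous.
have -> : eta * F (p k) = \int[mu]_(x in `]p k, p k.+1[) (cst (F (p k)) x) by rewrite Rintegral_cst// mlen mulrC.
rewrite -RintegralB//.
have ii : mu.-integrable `]p k, p k.+1[ (EFin \o (fun x => F x - cst (F (p k)) x)) by exact: RintegrableB.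
apply: (le_trans (le_normr_Rintegral (mI _ _) ii)).
have -> : e * eta = \int[mu]_(x in `]p k, p k.+1[) (cst e x) by rewrite Rintegral_cst// mlen.
apply: le_Rintegral => //; first exact: Rintegrable_norm.
move=> x /=; rewrite in_itv/= => /andP[kx xk].
have := pge k; have := ple _ kn; have := ple _ (ltnW kn) => ? ? ?.
apply: Hd; [lra|lra|rewrite gtr0_norm ?subr_gt0//].
by rewrite ltrBlDl (lt_trans xk)// pS ltrD2l.
Unshelve. all: by end_near. Qed.
End Partition.

(** * Weak derivatives and Bochner spaces *)

Section LpFacts.
Context {R : realType}.
Implicit Types (h x y z a b s t e : R) (f g c : R -> R).
Notation mu := (@lebesgue_measure R).

Lemma leb_integrable a b f : measurable_fun setT f ->
  (leb a b).-integrable setT (EFin \o f) <-> mu.-integrable `]a, b[ (EFin \o f).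
Proof.
move=> mf; split=> /integrableP[m1 i1]; apply/integrableP; split.
- by apply/measurable_EFinP; exact: measurable_funTS.
- by move: i1; rewrite leb_integral.
- exact/measurable_EFinP.
- by rewrite leb_integral.
Qed.

Lemma Lp_int a b (n : nat) f : (0 < n)%N -> Lp a b (n%:R)%:E f ->
  measurable_fun setT f /\ mu.-integrable `]a, b[ (EFin \o (fun x => `|f x| ^+ n)).
Proof.
move=> n0 Lf.
have mf : measurable_fun setT f.
  by move: (Lf); rewrite /Lp/= => /sub_Lfun_mfun; rewrite inE.
split => //.
have := @Lfun_integrable _ _ _ (leb a b) f n%:R _ Lf; rewrite ler1n => /(_ n0) H.
apply/leb_integrable.
  by apply: measurable_funX; exact: measurableT_comp.
by move: H; apply: eq_integrable => // x _ /=; rewrite powR_mulrn.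
Qed.

Lemma Lp_of_int a b (n : nat) f : (0 < n)%N -> measurable_fun setT f ->
  mu.-integrable `]a, b[ (EFin \o (fun x => `|f x| ^+ n)) -> Lp a b (n%:R)%:E f.
Proof.
move=> n0 mf /integrableP[_ i1]; rewrite /Lp/=.
apply/andP; split; first by rewrite inE.
rewrite inE/= /finite_norm unlock /Lnorm poweR_lty// leb_integral.
under eq_integral => x _ do rewrite /= powR_mulrn// -[(_ ^+ _)%R]ger0_norm ?exprn_ge0//.
exact: i1.
Qed.

Lemma Lpnorm_pow a b (n : nat) f : (0 < n)%N ->
  (Lpnorm a b (n%:R)%:E f `^ n%:R = \int[mu]_(x in `]a, b[) (`|f x| ^+ n)%:E)%E.
Proof.
move=> n0; rewrite /Lpnorm poweR_Lnorm ?pnatr_eq0 -?lt0n// leb_integral.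
by apply: eq_integral => x _ /=; rewrite powR_mulrn.
Qed.

Lemma Lpnorm_ae_eq a b (r : R) f g : {ae mu, forall x, a < x < b -> f x = g x} ->
  Lpnorm a b r%:E f = Lpnorm a b r%:E g.
Proof.
move=> H; rewrite /Lpnorm unlock /Lnorm !leb_integral; congr (_ `^ _)%E.
apply: ae_eq_integral_nonmeas; apply: (@filterS _ _ (ae_filter_ringOfSetsType mu) _ _ _ H) => x Hx.
by rewrite /= in_itv/= => xab; rewrite Hx.
Qed.

Lemma Lp2_int a b f : Lp a b 2 f -> [/\ measurable_fun setT f, mu.-integrable `]a, b[ (EFin \o f) &
  mu.-integrable `]a, b[ (EFin \o (fun x => f x ^+ 2))].
Proof.
move=> /(Lp_int (n := 2) isT)[mf i2].
have mI : measurable (`]a, b[ : set (measurableTypeR R)) by [].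
have i2' : mu.-integrable `]a, b[ (EFin \o (fun x => f x ^+ 2)).
  by move: i2; apply: eq_integrable => // x _ /=; rewrite real_normK ?num_real.
split => //.
have ic : mu.-integrable `]a, b[ (EFin \o cst (1:R)).
  by apply: continuous_integrable_oo; apply: continuous_subspaceT => x; exact: cst_continuous.
apply: (le_integrableR mI (g := fun x => 1 + f x ^+ 2)); first exact: measurable_funTS.
  move=> x _; have := sqr_ge0 (`|f x| - 1); rewrite sqrrB real_normK ?num_real// mulr1 expr1n mulr2n.
  have := sqr_ge0 (f x); have := normr_ge0 (f x); lra.
exact: RintegrableD.
Qed.

Lemma Lp2_of_bounded a b f (C : R) : measurable_fun setT f -> (forall x, `|f x| <= C) -> Lp a b 2 f.
Proof.
move=> mf fC; apply: (@Lp_of_int a b 2) => //.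
have mI : measurable (`]a, b[ : set (measurableTypeR R)) by [].
apply: (le_integrableR mI (g := cst (C ^+ 2))).
- by apply: measurable_funTS; apply: measurable_funX; exact: measurableT_comp.
- move=> x _; rewrite ger0_norm ?exprn_ge0// lerXn2r// ?nnegrE//.
  exact: le_trans (fC x).
- by apply: continuous_integrable_oo; apply: continuous_subspaceT => x; exact: cst_continuous.
Qed.

Lemma weak_deriv_int a b f g : weak_deriv a b f g <->
  (forall psi, test_fun a b psi ->
  \int[mu]_(x in `]a, b[) (f x * derive1 psi x) = - \int[mu]_(x in `]a, b[) (g x * psi x)).
Proof.
by split=> H psi /H; rewrite !leb_Rintegral.
Qed.

Lemma test_fun_bounded a b psi : test_fun a b psi -> continuous psi /\ exists C, forall x, `|psi x| <= C.
Proof.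
move=> [sp [c [d [ac db H]]]].
have cp : continuous psi.
  by move=> x; apply/differentiable_continuous/derivable1_diffP; exact: (sp 0%N x).
split => //.
have cpw : {within `[c, d], continuous psi} by exact: continuous_subspaceT.
have [M [_ HM]] := compact_bounded (continuous_compact cpw (@segment_compact R c d)).
exists (`|M| + 1) => x.
have [->|px] := eqVneq (psi x) 0; first by rewrite normr0 addr_ge0.
apply: (HM (`|M| + 1)); first by rewrite (le_lt_trans (ler_norm M))// ltrDl.
by exists x => //; rewrite /= in_itv/= H.
Qed.

(** Makes the chosen [wderiv] computable up to a null set, from any explicit weak derivative. *)
Lemma weak_deriv_unique f g1 g2 : Lp 0 1 2 g1 -> Lp 0 1 2 g2 ->
  weak_deriv 0 1 f g1 -> weak_deriv 0 1 f g2 -> {ae mu, forall x, 0 < x < 1 -> g1 x = g2 x}.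
Proof.
move=> /Lp2_int[m1 i1 _] /Lp2_int[m2 i2 _] /weak_deriv_int H1 /weak_deriv_int H2.
have mI : measurable (`]0, 1[ : set (measurableTypeR R)) by [].
have [|||] := @fundamental_lemma R 0 1 (fun x => g1 x - g2 x).
- exact: ltr01.
- exact: RintegrableB.
- move=> psi tpsi.
  have [cp [C HC]] := test_fun_bounded tpsi.
  have ip g : mu.-integrable `]0, 1[ (EFin \o g) -> mu.-integrable `]0, 1[ (EFin \o (fun x => g x * psi x)).
    move=> ig; have := @integrable_bounded_mul _ _ _ mu _ mI psi g C.
    under [X in _ -> _ -> _ -> is_true (mu.-integrable _ (EFin \o X))]eq_fun do rewrite mulrC.
    apply => //; by apply: measurable_funTS; exact: continuous_measurable_fun.
  under eq_Rintegral do rewrite mulrC mulrBl.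
  rewrite RintegralB//; [|exact: ip..].
  by have := H1 psi tpsi; rewrite H2// => /oppr_inj ->; rewrite subrr.
- move=> A [mA A0 HA]; exists A; split => // x /= nx; apply: HA => /= H.
  by apply: nx => x01; apply/eqP; rewrite -subr_eq0; apply/eqP/H.
Qed.

Lemma H1_wderiv f : H1 f -> Lp 0 1 2 (wderiv f) /\ weak_deriv 0 1 f (wderiv f).
Proof.
move=> [_ [g Lg wg]].
exact: (@xgetPex _ (cst 0) [set g | Lp 0 1 2 g /\ weak_deriv 0 1 f g] (ex_intro _ g (conj Lg wg))).
Qed.

Lemma wderiv_ae f g : Lp 0 1 2 g -> weak_deriv 0 1 f g -> Lp 0 1 2 f ->
  {ae mu, forall x, 0 < x < 1 -> wderiv f x = g x}.
Proof.
move=> Lg wg Lf; have [L1 w1] : Lp 0 1 2 (wderiv f) /\ weak_deriv 0 1 f (wderiv f).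
  by apply: H1_wderiv; split => //; exists g.
exact: weak_deriv_unique w1 wg.
Qed.

(** The derivative of [f * psi] has integral 0, because [psi] vanishes at 0 and 1. *)
Lemma abump_weak_deriv p k (c m d : R) : test_fun 0 1 (abump p k c m d) ->
  weak_deriv 0 1 (abump p k c m d) (abump (dbump p k) k.+2 (c * m) m d).
Proof.
set f := abump _ _ _ _ _; set f' := abump _ _ _ _ _ => tf; apply/weak_deriv_int => psi tpsi.
have [cp [C HC]] := test_fun_bounded tpsi.
have dpsi x : is_derive x 1 psi (derive1 psi x).
  by rewrite derive1E; apply/derivableP; exact: (tpsi.1 0%N x).
have cdpsi : continuous (derive1 psi).
  move=> x; apply/differentiable_continuous/derivable1_diffP; exact: (tpsi.1 1%N x).
have cf : continuous f by exact: abump_continuous.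
have cf' : continuous f' by exact: abump_continuous.
have df x : is_derive x 1 (f * psi) (f x *: derive1 psi x + psi x *: f' x).
  apply: is_deriveM; exact: is_derive_abump.
have cc : continuous (fun x => f x * derive1 psi x + f' x * psi x).
  by move=> x; apply: cvgD; apply: cvgM; [exact: cf|exact: cdpsi|exact: cf'|exact: cp].
have d2 x : is_derive x 1 (f * psi) (f x * derive1 psi x + f' x * psi x).
  by apply: (is_derive_eq (df x)); rewrite /GRing.scale/= (mulrC (psi x)).
have I0 : \int[mu]_(x in `[0, 1]) (f x * derive1 psi x + f' x * psi x) = 0.
  rewrite (RFTC2 ler01 d2); last exact: continuous_subspaceT.
  have [_ [c' [d' [c0 d1 H]]]] := tpsi.
  have -> : (f * psi) 1 = 0.
    rewrite -[LHS]/(f 1 * psi 1); have [->|/H/andP[? ?]] := eqVneq (psi 1) 0; first by rewrite mulr0.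
    by exfalso; lra.
  have -> : (f * psi) 0 = 0.
    rewrite -[LHS]/(f 0 * psi 0); have [->|/H/andP[? ?]] := eqVneq (psi 0) 0; first by rewrite mulr0.
    by exfalso; lra.
  by rewrite subrr.
have ii g : continuous g -> mu.-integrable `]0, 1[ (EFin \o g).
  by move=> cg; apply: continuous_integrable_oo; exact: continuous_subspaceT.
have ii2 : mu.-integrable `[0, 1] (EFin \o (fun x => f x * derive1 psi x + f' x * psi x)).
  by apply: continuous_integrable; exact: continuous_subspaceT.
apply/eqP; rewrite -addr_eq0 -RintegralD//.
- by rewrite Rintegral_oo_cc// I0.
- by apply: ii => x; apply: cvgM; [exact: cf|exact: cdpsi].
- by apply: ii => x; apply: cvgM; [exact: cf'|exact: cp].
Qed.

Lemma abump_Lp2 p k (c m d : R) : Lp 0 1 2 (abump p k c m d).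
Proof.
have [C C0 HC] := abump_bounded p k c m d.
apply: (@Lp2_of_bounded _ _ _ C) => //; apply: continuous_measurable_fun; exact: abump_continuous.
Qed.

Lemma abump_H1 p k (c m d : R) : test_fun 0 1 (abump p k c m d) -> H1 (abump p k c m d).
Proof.
move=> tf; split; first exact: abump_Lp2.
exists (abump (dbump p k) k.+2 (c * m) m d); first exact: abump_Lp2.
exact: abump_weak_deriv.
Qed.

Lemma abump_wderiv p k (c m d : R) : test_fun 0 1 (abump p k c m d) ->
  {ae mu, forall x, 0 < x < 1 -> wderiv (abump p k c m d) x = abump (dbump p k) k.+2 (c * m) m d x}.
Proof.
move=> tf; apply: wderiv_ae; [exact: abump_Lp2|exact: abump_weak_deriv|exact: abump_Lp2].
Qed.

Lemma poweR2 (x : \bar R) : (0 <= x)%E -> (x `^ 2%:R = x ^+ 2)%E.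
Proof.
case: x => [r|_|//]; first by rewrite lee_fin => r0; rewrite poweR_EFin powR_mulrn// EFin_expe.
by rewrite poweRyr ?pnatr_eq0// expe2 mulyy.
Qed.

(** A crude sup bound on an interval of length 1, used to place a small multiple of a mollifier in
    the unit ball of [H10], and with [e = 0] to see that the zero function has norm 0. *)
Lemma H1norm_abump_le p k (c m d e : R) : 0 <= e -> test_fun 0 1 (abump p k c m d) ->
  (forall x, `|abump p k c m d x| <= e) -> (forall x, `|abump (dbump p k) k.+2 (c * m) m d x| <= e) ->
  (H1norm (abump p k c m d) <= (2 * e)%:E)%E.
Proof.
move=> e0 tf b1 b2.
have N2 f : measurable_fun setT f -> (forall x, `|f x| <= e) -> (Lpnorm 0 1 2 f ^+ 2 <= (e ^+ 2)%:E)%E.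
  move=> mf fe.
  have -> : (Lpnorm 0 1 2 f ^+ 2 = Lpnorm 0 1 2 f `^ 2%:R)%E by rewrite poweR2// Lnorm_ge0.
  rewrite (@Lpnorm_pow 0 1 2)//.
  apply: (@le_trans _ _ (\int[mu]_(x in `]0%R, 1%R[) (cst (e ^+ 2)%:E) x)%E).
    apply: ge0_le_integral => //.
    - by apply/measurable_EFinP; apply: measurable_funTS; apply: measurable_funX; exact: measurableT_comp.
    - by move=> x _; rewrite lee_fin lerXn2r// ?nnegrE.
  have mI : measurable (`]0, 1[ : set (measurableTypeR R)) by [].
  have m01 : mu `]0, 1[ = 1%E by rewrite lebesgue_measure_itv/= lte_fin ltr01/= oppr0 adde0.
  by rewrite (integral_cst mu mI) [X in (_ * X)%E]m01 mule1.
rewrite /H1norm.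
rewrite (Lpnorm_ae_eq _ (abump_wderiv tf)).
have mA q n (c' : R) : measurable_fun setT (abump q n c' m d).
  by apply: continuous_measurable_fun; exact: abump_continuous.
apply: (@le_trans _ _ (((2 * e) ^+ 2)%:E `^ 2^-1)%E).
  apply: gt0_ler_poweR; rewrite ?invr_ge0// ?in_itv/= ?leey ?andbT.
  - by rewrite adde_ge0// mule_ge0// Lnorm_ge0.
  - by rewrite lee_fin sqr_ge0.
  - apply: (le_trans (leeD (N2 _ (mA _ _ _) b1) (N2 _ (mA _ _ _) b2))).
    by rewrite -EFinD lee_fin exprMn; have := sqr_ge0 e; lra.
rewrite poweR_EFin lee_fin -powR_mulrn ?mulr_ge0// -powRrM mulfV// powRr1// mulr_ge0//.
Qed.

(** A test function approximates itself. The norm of the difference 0 still needs an argument, as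
    [wderiv] is a choice; so 0 is written as an [abump] with factor 0, and any bounds for its empty
    support will do. *)
Lemma H10_abump p k (c m d : R) : test_fun 0 1 (abump p k c m d) -> H10 (abump p k c m d).
Proof.
move=> tf; split; first exact: abump_H1.
move=> e e0; exists (abump p k c m d); split => //.
have -> : abump p k c m d - abump p k c m d = abump p k 0 m d.
  by rewrite subrr; apply/funext => x; rewrite /abump mul0r.
have t0 : test_fun 0 1 (abump p k 0 m d).
  split; first exact: smooth_abump.
  by exists 3^-1, 2^-1; split; [lra|lra|move=> x; rewrite /abump mul0r eqxx].
have E (q : {poly R}) n x : `|abump q n 0 m d x| <= 0 by rewrite /abump mul0r normr0.
apply: (le_trans (H1norm_abump_le (lexx 0) t0 (E _ _) _)).
  by move=> x; rewrite mul0r; exact: E.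
by rewrite mulr0 lee_fin ltW.
Qed.
End LpFacts.

(** * Real-valued functions extracted from Bochner maps *)

Section Bochner.
Context {R : realType}.
Implicit Types (h x y z a b s t e : R) (f g c : R -> R).
Notation mu := (@lebesgue_measure R).

(** The upper limit is Borel everywhere and agrees with [f] wherever the sequence converges; [f]
    itself may fail to be Borel on the null set, hence the representative [k]. *)
Lemma ae_limit_measurable (P : R -> Prop) (F : nat -> R -> R) f :
  (forall n, measurable_fun setT (F n)) ->
  {ae mu, forall t, P t -> F n t @[n --> \oo] --> f t} ->
  exists2 k : R -> R, measurable_fun setT k & {ae mu, forall t, P t -> k t = f t}.
Proof.
move=> mF HF; exists (fun t => fine (limn_esup (fun n => (F n t)%:E))).
  apply: measurableT_comp; first exact: fine_measurable.
  apply: (@measurable_fun_limn_esup _ _ _ _ (fun n t => (F n t)%:E)) => n.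
  exact/measurable_EFinP.
apply: (@filterS _ _ (ae_filter_ringOfSetsType mu) _ _ _ HF) => t Ht Pt.
have : (EFin \o (fun n => F n t)) x @[x --> \oo] --> (f t)%:E by apply: cvg_EFin; [exact: nearW|exact: Ht].
by move=> /cvg_limn_einf_sup[_ ->].
Qed.

(** Every preimage is a finite union of level sets of [s], so [F] is arbitrary. *)
Lemma finite_range_measurable (V : Type) (F : V -> R) (s : R -> V) :
  finite_set (range s) ->
  (forall v, measurable (s @^-1` [set v] : set (measurableTypeR R))) ->
  measurable_fun setT (F \o s).
Proof.
move=> fs ms _ Y mY; rewrite setTI.
rewrite (_ : _ @^-1` Y = \bigcup_(v in range s `&` F @^-1` Y) s @^-1` [set v]).
  apply: fin_bigcup_measurable => [|v _]; last exact: ms.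
  exact: finite_setIl.
apply/seteqP; split => t /=.
  by move=> Yt; exists (s t) => //; split => //; exists t.
by move=> [v [_ Yv] /= ->].
Qed.

(** A functional [M] that is 1-Lipschitz for [N] carries the approximating simple maps to simple
    functions converging to [M (w t)]. *)
Lemma strongly_measurable_real (V : zmodType) (X : set V) (N : V -> \bar R)
    (T : R) (w : R -> V) (M : V -> R) :
  {ae leb 0 T, forall t, X (w t)} -> strongly_measurable X N T w ->
  (forall u v, X u -> X v -> (`|M u - M v|%:E <= N (u - v)%R)%E) ->
  exists2 k : R -> R, measurable_fun setT k &
    {ae mu, forall t, 0 < t < T -> k t = M (w t)}.
Proof.
move=> /leb_ae Xw [s [ss /leb_ae sc]] MN.
apply: (@ae_limit_measurable _ (fun n => M \o s n)) => [n|].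
  by have [fs _ ms] := ss n; exact: finite_range_measurable.
apply: (@filterS2 _ _ (ae_filter_ringOfSetsType mu) _ _ _ _ Xw sc) => t Xt ct t0.
have {}Xt : X (w t) by apply: Xt; rewrite /= in_itv.
have {ct} : N (w t - s n t) @[n --> \oo] --> 0%E by apply: ct; rewrite /= in_itv.
have Xs n : X (s n t) by have [_ + _] := ss n; apply; exists t.
move=> c0; apply/cvgrPdist_le => e e0.
have : \forall n \near \oo, (N (w t - s n t)%R < e%:E)%E.
  by apply: (c0 [set x | (x < e%:E)%E]); apply: open_nbhs_nbhs; split; [exact: open_ereal_lt_ereal|rewrite /= lte_fin].
apply: filterS => n /ltW; rewrite -lee_fin; exact: le_trans (MN _ _ Xt (Xs n)).
Qed.

(** Gives a measurable substitute for the norm [M (w t)]. Its integral is compared with that of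
    [N (w t)] by [ae_le_integral_nonmeas], the latter not being known to be measurable. *)
Lemma Bochner_real (V : zmodType) (X : set V) (N : V -> \bar R) (T : R)
    (w : R -> V) (M : V -> R) (n : nat) : (0 < n)%N ->
  Bochner X N T (n%:R)%:E w ->
  (forall u v, X u -> X v -> (`|M u - M v|%:E <= N (u - v)%R)%E) ->
  (forall u, X u -> 0 <= M u /\ ((M u)%:E <= N u)%E) ->
  exists k : R -> R, [/\ measurable_fun setT k,
    {ae mu, forall t, 0 < t < T -> k t = M (w t)} &
    mu.-integrable `]0, T[ (EFin \o (fun t => k t ^+ n))].
Proof.
move=> n0 [Xw sm fin] MN M0.
have [k mk kM] := strongly_measurable_real Xw sm MN.
exists k; split => //; apply/integrableP; split.
  apply/measurable_EFinP; apply: measurable_funTS; exact: measurable_funX.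
have : ('N[leb 0 T]_(n%:R)%:E[N \o w] `^ n%:R < +oo)%E by apply: poweR_lty.
rewrite poweR_Lnorm ?pnatr_eq0 -?lt0n// leb_integral; apply: le_lt_trans.
move/leb_ae: Xw => Xw.
apply: ae_le_integral_nonmeas => [t _|t _|]; [exact: abse_ge0|exact: poweR_ge0|].
apply: (@filterS2 _ _ (ae_filter_ringOfSetsType mu) _ _ _ _ Xw kM) => t Xt kt tT.
have [M0t MNt] := M0 _ (Xt tT).
rewrite /= kt; last by move: tT; rewrite /= in_itv.
rewrite ger0_norm ?exprn_ge0// -powR_mulrn// -poweR_EFin.
apply: gt0_ler_poweR; rewrite ?in_itv/= ?leey ?andbT ?lee_fin ?abse_ge0//.
by apply: le_trans MNt _; exact: lee_abs.
Qed.

Lemma LpnormN a b (r : R) f : Lpnorm a b r%:E (- f) = Lpnorm a b r%:E f.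
Proof.
rewrite /Lpnorm unlock /Lnorm; congr (_ `^ _)%E.
by apply: eq_integral => x _ /=; rewrite normrN.
Qed.

Lemma LpnormD_le a b (n : nat) f g : (0 < n)%N -> measurable_fun setT f -> measurable_fun setT g ->
  (Lpnorm a b (n%:R)%:E (f + g)%R <= Lpnorm a b (n%:R)%:E f + Lpnorm a b (n%:R)%:E g)%E.
Proof. by move=> n0 mf mg; apply: eminkowski => //; rewrite lee_fin ler1n. Qed.

Lemma Lp_meas a b (p : \bar R) f : Lp a b p f -> measurable_fun setT f.
Proof. by rewrite /Lp/= => /sub_Lfun_mfun; rewrite inE. Qed.

Lemma Lp_fin a b (p : \bar R) f : Lp a b p f -> Lpnorm a b p f \is a fin_num.
Proof.
move=> /andP[_]; rewrite inE/= /finite_norm => H.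
by rewrite ge0_fin_numE// Lnorm_ge0.
Qed.

Lemma LpB a b (n : nat) f g : (0 < n)%N -> Lp a b (n%:R)%:E f -> Lp a b (n%:R)%:E g ->
  Lp a b (n%:R)%:E (f - g).
Proof.
move=> n0 Lf Lg; have mf := Lp_meas Lf; have mg := Lp_meas Lg.
apply/andP; split; first by rewrite inE; exact: measurable_funB.
rewrite inE/= /finite_norm.
have mNg : measurable_fun setT (- g) by exact: measurableT_comp.
apply: (le_lt_trans (LpnormD_le a b n0 mf mNg)).
rewrite LpnormN lte_add_pinfty// -ge0_fin_numE ?Lnorm_ge0//; exact: Lp_fin.
Qed.

Lemma Lpnorm_lip a b (n : nat) f g : (0 < n)%N -> Lp a b (n%:R)%:E f -> Lp a b (n%:R)%:E g ->
  (`|fine (Lpnorm a b (n%:R)%:E f) - fine (Lpnorm a b (n%:R)%:E g)|%:E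
    <= Lpnorm a b (n%:R)%:E (f - g)%R)%E.
Proof.
move=> n0 Lf Lg.
have Lfg := LpB n0 Lf Lg.
rewrite -(fineK (Lp_fin Lfg)) lee_fin.
have tri f1 f2 : Lp a b (n%:R)%:E f1 -> Lp a b (n%:R)%:E f2 ->
    fine (Lpnorm a b (n%:R)%:E f1) - fine (Lpnorm a b (n%:R)%:E f2) <=
    fine (Lpnorm a b (n%:R)%:E (f1 - f2)).
  move=> L1 L2; have L12 := LpB n0 L1 L2.
  rewrite lerBlDr -lee_fin EFinD !fineK; [|exact: Lp_fin..].
  rewrite -[X in Lpnorm _ _ _ X](subrK f2); exact: (LpnormD_le a b n0 (Lp_meas L12) (Lp_meas L2)).
rewrite ler_norml; apply/andP; split; last exact: tri.
rewrite lerNl [X in X <= _](_ : _ = fine (Lpnorm a b n%:R%:E g) - fine (Lpnorm a b n%:R%:E f)); last exact: opprB.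
have -> : Lpnorm a b n%:R%:E (f - g) = Lpnorm a b n%:R%:E (g - f).
  by rewrite -LpnormN; congr Lpnorm; exact: opprB.
exact: tri.
Qed.

Lemma Lp2B a b f g : Lp a b 2 f -> Lp a b 2 g -> Lp a b 2 (f - g).
Proof. exact: (@LpB a b 2). Qed.

Lemma test_fun_derive1 a b psi : test_fun a b psi -> test_fun a b (derive1 psi).
Proof.
move=> [sp [c [d [ac db H]]]]; split.
  by move=> n x; rewrite -derive1Sn; exact: sp.
exists c, d; split => // x; apply: contraNT => xcd; apply/eqP.
have n0 : \forall z \near x, cst 0 z = psi z.
  have : open (~` `[c, d]%classic) by apply: closed_openC; exact: interval_closed.
  rewrite openE => /(_ x); rewrite /= in_itv/= => /(_ (negP xcd)); apply: filterS => z /= zcd.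
  by apply/esym/eqP/negPn/negP => /H zcd'; apply: zcd; rewrite in_itv/= zcd'.
by rewrite derive1E -(near_eq_derive _ n0) derive_cst.
Qed.

Lemma weak_derivB f g : H1 f -> H1 g -> weak_deriv 0 1 (f - g) (wderiv f - wderiv g).
Proof.
move=> H1f H1g; have [Lf wf] := H1_wderiv H1f; have [Lg wg] := H1_wderiv H1g.
apply/weak_deriv_int => psi tpsi.
move/weak_deriv_int : wf => /(_ _ tpsi) wf.
move/weak_deriv_int : wg => /(_ _ tpsi) wg.
have [_ if1 _] := Lp2_int H1f.1; have [_ ig1 _] := Lp2_int H1g.1.
have [_ if2 _] := Lp2_int Lf; have [_ ig2 _] := Lp2_int Lg.
have mI : measurable (`]0, 1[ : set (measurableTypeR R)) by [].
have [cp [C HC]] := test_fun_bounded tpsi.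
have tpsi' := test_fun_derive1 tpsi.
have [cp' [C' HC']] := test_fun_bounded tpsi'.
have ip q D u : continuous q -> (forall x, `|q x| <= D) -> mu.-integrable `]0, 1[ (EFin \o u) -> mu.-integrable `]0, 1[ (EFin \o (fun x => u x * q x)).
  move=> cq qD iu; have := @integrable_bounded_mul _ _ _ mu _ mI q u D.
  under [X in _ -> _ -> _ -> is_true (mu.-integrable _ (EFin \o X))]eq_fun do rewrite mulrC.
  apply => //; by apply: measurable_funTS; exact: continuous_measurable_fun.
rewrite (_ : \int[mu]_(x in `]0, 1[) ((f - g) x * derive1 psi x) = \int[mu]_(x in `]0, 1[) (f x * derive1 psi x - g x * derive1 psi x)); last first.
  by apply: eq_Rintegral => x _; rewrite -mulrBl.
rewrite (_ : \int[mu]_(x in `]0, 1[) ((wderiv f - wderiv g) x * psi x) =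
   \int[mu]_(x in `]0, 1[) (wderiv f x * psi x - wderiv g x * psi x)); last first.
  by apply: eq_Rintegral => x _; rewrite -mulrBl.
rewrite RintegralB//; [|exact: (ip _ C')|exact: (ip _ C')].
rewrite RintegralB//; [|exact: (ip _ C)|exact: (ip _ C)].
by rewrite wf wg opprB opprK addrC.
Qed.

Lemma wderiv_norm_le f : ((Lpnorm 0 1 2 (wderiv f)) <= H1norm f)%E.
Proof.
rewrite /H1norm poweR12_sqrt; last by rewrite adde_ge0// sqre_ge0.
rewrite -[leLHS]gee0_abs ?Lnorm_ge0// -sqrte_sqr.
by rewrite lee_sqrt ?adde_ge0 ?sqre_ge0//; apply: lee_paddl; rewrite ?sqre_ge0.
Qed.

(** [wderiv], being a choice, is linear only up to null sets, which the norm does not see; the rest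
    is the triangle inequality. *)
Lemma wderiv_norm_lip f g : H1 f -> H1 g ->
  (`|fine (Lpnorm 0 1 2 (wderiv f)) - fine (Lpnorm 0 1 2 (wderiv g))|%:E <= H1norm (f - g)%R)%E.
Proof.
move=> H1f H1g; have [Lf wf] := H1_wderiv H1f; have [Lg wg] := H1_wderiv H1g.
apply: (le_trans _ (wderiv_norm_le _)).
rewrite (@Lpnorm_ae_eq _ 0 1 2 (wderiv (f - g)) (wderiv f - wderiv g)).
  exact: (@Lpnorm_lip 0 1 2).
apply: wderiv_ae; [exact: Lp2B|exact: weak_derivB|apply: Lp2B; [exact: H1f.1|exact: H1g.1]].
Qed.

(** The left side is one of the terms of the supremum defining the dual norm. *)
Lemma Hm1_lip phi (l1 l2 : (R -> R) -> R) : H10 phi -> (H1norm phi <= 1)%E ->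
  (`|l1 phi - l2 phi|%:E <= Hm1norm (l1 - l2)%R)%E.
Proof. by move=> Hp Np; apply: ereal_sup_ubound; exists phi. Qed.

End Bochner.

(** * The energy estimate *)

Section Slices.
Context {R : realType}.
Implicit Types (h x y z a b s t e : R) (f g c v : R -> R).
Notation mu := (@lebesgue_measure R).
Let mD : measurable (`]0, 1[ : set (measurableTypeR R)).
Proof. by []. Qed.
Let mJ : measurable (`[4^-1, 3 / 4] : set (measurableTypeR R)).
Proof. by []. Qed.

(** For fixed [h], makes the time derivative of [<u(t), moll h y>] integrable in time, so that the
    increments of this pairing are integrals. *)
Lemma Gfun_bounded alpha beta gamma delta : 0 < alpha -> 0 < beta -> 0 < gamma ->
  forall h, exists2 C : R, 0 <= C & forall v g,
  {within `[0, 1], continuous v} ->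
  mu.-integrable `]0, 1[ (EFin \o g) ->
  mu.-integrable `]0, 1[ (EFin \o (fun z => g z ^+ 2)) ->
  forall y, `|Gfun alpha beta gamma delta v g h y| <= C * \int[mu]_(z in `]0, 1[) Hfun delta v g z.
Proof.
move=> a0 b0 c0 h.
have [C1 C10 HC1] := scalar_dom delta a0 b0 c0.
have [M1 M10 HM1] := @moll_bounded R h.
have [M2 M20 HM2] := @dmoll_bounded R h.
exists (M2 + M1 * (2 * C1)); first by rewrite addr_ge0// !mulr_ge0.
move=> v g cv ig ig2 y.
have iHf := Hfun_integrable delta cv ig2.
have iw' := wfun_integrable alpha beta gamma delta cv ig.
have H1 z : 1 <= Hfun delta v g z.
  by rewrite /Hfun -addrA lerDl addr_ge0 ?sqr_ge0 ?vq_ge0.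
have B (k f : R -> R) (M C : R) : 0 <= M -> 0 <= C -> (forall z, `|k z| <= M) ->
    mu.-integrable `]0, 1[ (EFin \o (fun z => k z * f z)) ->
    (forall z, `|f z| <= C * Hfun delta v g z) ->
    `|\int[mu]_(z in `]0, 1[) (k z * f z)| <= M * C * \int[mu]_(z in `]0, 1[) Hfun delta v g z.
  move=> M0 C0 kM ikf fC.
  apply: (le_trans (le_normr_Rintegral mD ikf)).
  rewrite -RintegralZl//; apply: le_Rintegral => //.
  - exact: Rintegrable_norm.
  - exact: RintegrableZ.
  - move=> z _; rewrite normrM -mulrA; apply: ler_pM => //.
rewrite /Gfun (le_trans (ler_normB _ _))// normrN mulrDl; apply: lerD.
  rewrite -[M2]mulr1; apply: (B _ _ M2 1) => //.
    exact: dmoll_mul_integrable.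
  move=> z; rewrite mul1r /Hfun.
  have := sqr_ge0 (`|g z| - 1); rewrite sqrrB real_normK ?num_real// mulr1 expr1n mulr2n.
  have := sqr_ge0 (g z); have := vq_ge0 delta (v z); have := normr_ge0 (g z); lra.
apply: B => //; first by rewrite mulr_ge0.
  exact: moll_mul_integrable.
(* Take [a = 1]: the right side is [C1 * (Hfun + 1)], at most [2 * C1 * Hfun] since [Hfun >= 1]. *)
move=> z; have := HC1 1 (v z) (g z).
rewrite normr1 mul1r expr1n /wfun /react => /le_trans; apply.
rewrite (mulrC 2) -mulrA ler_wpM2l// -/(Hfun delta v g z) mulr_natl mulr2n lerD2l.
exact: H1.
Qed.

(** The trace condition supplies the continuous representative [v], which inherits the weak
    derivative of [u] because integrals ignore null sets. *)
Lemma trace_good u a (c0 : R) : H1 u -> has_trace u a c0 -> exists v,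
  [/\ {within `[0, 1], continuous v}, {ae mu, forall x, 0 < x < 1 -> v x = u x},
   mu.-integrable `]0, 1[ (EFin \o wderiv u),
   mu.-integrable `]0, 1[ (EFin \o (fun z => wderiv u z ^+ 2)) &
   forall psi, test_fun 0 1 psi ->
    \int[mu]_(z in `]0, 1[) (v z * derive1 psi z) = - \int[mu]_(z in `]0, 1[) (wderiv u z * psi z)].
Proof.
move=> Hu [v [cv /leb_ae vu _]].
have [Lg wg] := H1_wderiv Hu; have [_ ig ig2] := Lp2_int Lg.
exists v; split => //.
move=> psi tp; move/weak_deriv_int : wg => <-//.
by apply: ae_eq_Rintegral; apply: (@filterS _ _ (ae_filter_ringOfSetsType mu) _ _ _ vu) => x + x01 => ->.
Qed.

Lemma pairing_mollify u v h y : {ae mu, forall x, 0 < x < 1 -> v x = u x} ->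
  \int[leb 0 1]_x (u x * moll h y x) = mollify h v y.
Proof.
move=> vu; rewrite leb_Rintegral /mollify; apply: ae_eq_Rintegral.
apply: (@filterS _ _ (ae_filter_ringOfSetsType mu) _ _ _ vu) => x Hx.
by rewrite /= in_itv/= => /Hx ->; rewrite mulrC.
Qed.

Lemma moll_wderiv h y : 0 < h -> 0 < y - h -> y + h < 1 ->
  {ae mu, forall x, 0 < x < 1 -> wderiv (moll h y) x = dmoll h y x}.
Proof.
move=> h0 y0 y1; have tp := test_moll h0 y0 y1.
have := @abump_wderiv R 1 0 (h^-1 * (step0 1)^-1) h^-1 (- y / h).
rewrite -mollE => /(_ tp); rewrite dmollE.
by rewrite (_ : h^-1 * (step0 1)^-1 * h^-1 = h^-1 * (h^-1 * (step0 1)^-1)) // mulrC.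
Qed.

Lemma moll_H10 h y : 0 < h -> 0 < y - h -> y + h < 1 -> H10 (moll h y).
Proof. by move=> h0 y0 y1; rewrite mollE; apply: H10_abump; rewrite -mollE; exact: test_moll. Qed.

Lemma pde_Gfun alpha beta gamma delta u v h y (l : R) :
  0 < h -> 0 < y - h -> y + h < 1 ->
  {within `[0, 1], continuous v} ->
  {ae mu, forall x, 0 < x < 1 -> v x = u x} ->
  mu.-integrable `]0, 1[ (EFin \o wderiv u) ->
  l + \int[leb 0 1]_x (wderiv u x * wderiv (moll h y) x)
    + alpha * \int[leb 0 1]_x (u x ^+ delta * wderiv u x * moll h y x)
  = beta * \int[leb 0 1]_x (u x * (1 - u x ^+ delta) * (u x ^+ delta - gamma) * moll h y x) ->
  l = Gfun alpha beta gamma delta v (wderiv u) h y.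
Proof.
move=> h0 y0 y1 cv vu ig.
have wm := moll_wderiv h0 y0 y1.
rewrite !leb_Rintegral.
have -> : \int[mu]_(x in `]0, 1[) (wderiv u x * wderiv (moll h y) x) = dmollify h (wderiv u) y.
  apply: ae_eq_Rintegral; apply: (@filterS _ _ (ae_filter_ringOfSetsType mu) _ _ _ wm) => x Hx.
  by rewrite /= in_itv/= => /Hx ->; rewrite mulrC.
have -> : \int[mu]_(x in `]0, 1[) (u x ^+ delta * wderiv u x * moll h y x) =
    mollify h (fun z => v z ^+ delta * wderiv u z) y.
  apply: ae_eq_Rintegral; apply: (@filterS _ _ (ae_filter_ringOfSetsType mu) _ _ _ vu) => x Hx.
  by rewrite /= in_itv/= => /Hx ->; rewrite mulrC.
have -> : \int[mu]_(x in `]0, 1[) (u x * (1 - u x ^+ delta) * (u x ^+ delta - gamma) * moll h y x) =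
    mollify h (fun z => react gamma delta (v z)) y.
  apply: ae_eq_Rintegral; apply: (@filterS _ _ (ae_filter_ringOfSetsType mu) _ _ _ vu) => x Hx.
  by rewrite /= in_itv/= => /Hx ->; rewrite mulrC.
have i1 := vXg_integrable delta cv ig; have i2 := react_integrable gamma delta cv.
have -> : Gfun alpha beta gamma delta v (wderiv u) h y =
    - dmollify h (wderiv u) y - (alpha * mollify h (fun z => v z ^+ delta * wderiv u z) y
      - beta * mollify h (fun z => react gamma delta (v z)) y).
  congr (_ - _); rewrite /wfun -!mollifyZ// -mulN1r -mollifyZ; last exact: RintegrableZ.
  rewrite -mollifyD; [|exact: (RintegrableZ mD _ i1)|exact: (RintegrableZ mD _ (RintegrableZ mD beta i2))].
  by congr (mollify h _ y); apply/funext => z; rewrite mulN1r.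
lra.
Qed.

(** Compare with the mollifier of mass 1 centred at 1/2 with [h = 1/8]: on its support
    [sig >= 1/16 - 1/64 >= 1/32], so it lies below [M * 32^4 * sig^4]. *)
Lemma int_sig4_gt0 : 0 < \int[mu]_(y in `[4^-1, 3 / 4]) (sig y ^+ 4).
Proof.
have [M M0 HM] := @moll_bounded R 8^-1.
have csig n : continuous (fun y : R => sig y ^+ n) by apply: ctsX; exact: sig_continuous.
have isig (k : R) : mu.-integrable `[4^-1, 3 / 4] (EFin \o (fun y => k * sig y ^+ 4)).
  by apply: continuous_integrable; apply: continuous_subspaceT; apply: ctsM; [exact: cts_cst|exact: csig].
have : 1 <= (M * 32 ^+ 4) * \int[mu]_(y in `[4^-1, 3 / 4]) (sig y ^+ 4).
  rewrite -[X in X <= _](@moll_integral R 8^-1 2^-1 4^-1 (3 / 4)); [|lra|lra|lra].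
  rewrite Rintegral_oo_cc; last first.
    by apply: continuous_integrable; apply: continuous_subspaceT; exact: moll_continuous.
  rewrite -RintegralZl//; last first.
    by apply: continuous_integrable; apply: continuous_subspaceT; exact: csig.
  apply: le_Rintegral => //.
    by apply: continuous_integrable; apply: continuous_subspaceT; exact: moll_continuous.
  move=> y; rewrite /= in_itv/= => yJ.
  have [le8|lt8] := leP 8^-1 `|y - 2^-1|.
    rewrite moll_out//; apply: mulr_ge0; first by rewrite mulr_ge0// exprn_ge0.
    by rewrite exprn_ge0// (andP (sig01 yJ)).1.
  rewrite -mulrA; apply: (le_trans (le_trans (ler_norm _) (HM _ _))).
  rewrite -[leLHS]mulr1; apply: ler_wpM2l => //.
  rewrite -exprMn -[leLHS](expr1n _ 4) lerXn2r// ?nnegrE//.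
    by rewrite mulr_ge0// (andP (sig01 yJ)).1.
  move: lt8; rewrite ltr_norml /sig => /andP[l1 l2].
  nra.
rewrite lt_neqAle => H; apply/andP; split.
  by apply: contraTneq H => <-; rewrite mulr0 -ltNge.
by apply: Rintegral_ge0 => y; rewrite /= in_itv/= => yJ; rewrite exprn_ge0// (andP (sig01 yJ)).1.
Qed.

(** Write [w = d + K] with [d] of norm at most 1; the mollification is [A + K], and
    [(A + K)^2 >= K^2 / 2 - A^2]. Jensen's inequality and [mollify_Tonelli] bound the total loss by
    [\int d^2 <= 1], for every [h <= 1/8]. *)
Lemma energy_lower w (K : R) h : 0 < h -> h <= 8^-1 -> Lp 0 1 2 w ->
  (Lpnorm 0 1 2 (w - cst K)%R <= 1%:E)%E ->
  K ^+ 2 / 2 * \int[mu]_(y in `[4^-1, 3 / 4]) (sig y ^+ 4) - 1 <=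
  \int[mu]_(y in `[4^-1, 3 / 4]) (sig y ^+ 4 * mollify h w y ^+ 2).
Proof.
move=> h0 h8 Lw wK.
have LK : Lp 0 1 2 (cst K : R -> R) by apply: (@Lp2_of_bounded _ _ _ _ `|K|).
have Ld := Lp2B Lw LK.
have [_ iw1 _] := Lp2_int Lw; have [_ id1 id2] := Lp2_int Ld.
set d := w - cst K in wK Ld id1 id2.
have d1 : \int[mu]_(z in `]0, 1[) (d z ^+ 2) <= 1.
  rewrite -lee_fin /Rintegral fineK; last first.
    by apply: integrable_fin_num => //; exact: id2.
  have := @Lpnorm_pow R 0 1 2 d isT.
  under [X in _ = X -> _]eq_integral do rewrite real_normK ?num_real//.
  move=> /= <-; rewrite -[leRHS](poweR1r 2%:R).
  by apply: gt0_ler_poweR => //; rewrite in_itv/= leey andbT ?Lnorm_ge0.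
have csig n : continuous (fun y : R => sig y ^+ n) by apply: ctsX; exact: sig_continuous.
have cm : continuous (mollify h w) by exact: mollify_continuous.
have cm2 : continuous (mollify h (fun z => d z ^+ 2)) by exact: mollify_continuous.
have ci f : continuous f -> mu.-integrable `[4^-1, 3 / 4] (EFin \o f).
  by move=> cf; apply: continuous_integrable; exact: continuous_subspaceT.
apply: (@le_trans _ _ (\int[mu]_(y in `[4^-1, 3 / 4]) (K ^+ 2 / 2 * sig y ^+ 4 - mollify h (fun z => d z ^+ 2) y))).
  rewrite RintegralB//; [|by apply: ci; apply: ctsM; [exact: cts_cst|exact: csig]|exact: ci].
  rewrite RintegralZl//; last by apply: ci; exact: csig.
  rewrite lerD2l lerN2; apply: (le_trans _ d1).
  by apply: mollify_Tonelli => // z; exact: sqr_ge0.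
apply: le_Rintegral => //.
- by apply: ci; apply: ctsD; [apply: ctsM; [exact: cts_cst|exact: csig]|exact: ctsN].
- by apply: ci; apply: ctsM; [exact: csig|exact: ctsX].
move=> y; rewrite /= in_itv/= => yJ.
have y0 : 0 <= y - h by move/andP: yJ => [? ?]; lra.
have y1 : y + h <= 1 by move/andP: yJ => [? ?]; lra.
have Ew : mollify h w y = mollify h d y + K.
  rewrite -[in RHS](mollify_cst K h0 y0 y1) -mollifyD//; last exact: cst_integrable.
  by congr (mollify h _ y); apply/funext => z; rewrite /d /= -[(w - cst K) z]/(w z - K) subrK.
have := mollify_sqr h0 y0 y1 id1 id2.
have /andP[s0 s1] := sig01 yJ.
rewrite Ew.
set A := mollify h d y; set B := mollify h _ y => AB.
have S0 : 0 <= sig y ^+ 4 by rewrite exprn_ge0.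
have S1 : sig y ^+ 4 <= 1 by rewrite exprn_ile1.
set S := sig y ^+ 4 in S0 S1 *.
have := sqr_ge0 (2 * A + K) => P1.
have : 0 <= S * ((2 * A + K) ^+ 2) by rewrite mulr_ge0.
have : 0 <= (1 - S) * A ^+ 2 by rewrite mulr_ge0 ?sqr_ge0// subr_ge0.
move=> P2 P3.
have -> : S * (A + K) ^+ 2 = K ^+ 2 / 2 * S + 2^-1 * (S * ((2 * A + K) ^+ 2)) - S * A ^+ 2 by field.
have -> : S * A ^+ 2 = A ^+ 2 - (1 - S) * A ^+ 2 by ring.
lra.
Qed.
End Slices.

(** * Integrating the energy balance in time *)

Section Energy.
Context {R : realType}.
Implicit Types (h x y z a b s t e : R).
Notation mu := (@lebesgue_measure R).

Lemma ae_le_integrable d (X : measurableType d) (m : {measure set X -> \bar R}) (D : set X)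
    (f g : X -> R) : measurable D -> measurable_fun D f ->
  {ae m, forall p, D p -> `|f p| <= g p} -> m.-integrable D (EFin \o g) ->
  m.-integrable D (EFin \o f).
Proof.
move=> mD mf fg /integrableP[mg ig]; apply/integrableP; split; first exact/measurable_EFinP.
apply: le_lt_trans ig; apply: ae_le_integral_nonmeas; [by move=> x _; exact: abse_ge0..|].
apply: (@filterS _ _ (ae_filter_ringOfSetsType m) _ _ _ fg) => x + Dx => /(_ Dx) H.
by rewrite /= lee_fin (le_trans H)// ler_norm.
Qed.

Lemma Rintegral_sum d (X : measurableType d) (m : {measure set X -> \bar R}) (D : set X) (mD : measurable D)
    n (f : 'I_n -> X -> R) : (forall i, m.-integrable D (EFin \o f i)) ->
  m.-integrable D (EFin \o (fun p => \sum_(i < n) f i p)) /\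
  \int[m]_(p in D) (\sum_(i < n) f i p) = \sum_(i < n) \int[m]_(p in D) f i p.
Proof.
elim: n f => [|n IH] f fi.
  have -> : (fun p => \sum_(i < 0) f i p) = cst 0 by apply/funext => p; rewrite big_ord0.
  rewrite big_ord0.
  by split; [exact: integrable0|rewrite /Rintegral integral0].
have [i1 e1] := IH (fun i => f (widen_ord (leqnSn n) i)) (fun i => fi _).
have -> : (fun p => \sum_(i < n.+1) f i p) = (fun p => \sum_(i < n) f (widen_ord (leqnSn n) i) p + f ord_max p).
  by apply/funext => p; rewrite big_ord_recr.
split; first exact: RintegrableD.
by rewrite RintegralD// e1 big_ord_recr.
Qed.

Lemma rsum_bound (F : R -> R) n (B : R) : 0 <= B -> (forall y, 4^-1 <= y <= 3 / 4 -> `|F y| <= B) ->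
  `|rsum F n| <= B.
Proof.
move=> B0 FB; apply: (le_trans (ler_norm_sum _ _ _)).
apply: (@le_trans _ _ (\sum_(k < n.+1) (2^-1 / n.+1%:R) * B)).
  apply: ler_sum => k _; rewrite normrM ger0_norm ?divr_ge0//.
  by apply: ler_wpM2l; [rewrite divr_ge0|apply: FB; exact: rsum_point].
rewrite sumr_const card_ord -[leLHS]mulr_natl mulrA mulrCA mulfV ?pnatr_eq0// mulr1.
by rewrite -[leRHS]mul1r ler_wpM2r//; lra.
Qed.

(** For each centre [y], [weak_sqr] gives [c y T ^+ 2 = 2 \int c y * k y]. Summing over Riemann
    nodes and refining gives the integral in [y] on both sides, the time integrals converging by
    domination with [flux_bounded]. The function [K] is a measurable version of the total flux. *)
Lemma energy_identity alpha beta gamma delta T h (c k v g : R -> R -> R) (Dm : R -> R) :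
  0 < alpha -> 0 < beta -> 0 < gamma -> 0 < T -> 0 < h -> h <= 8^-1 ->
  mu.-integrable `]0, T[ (EFin \o Dm) ->
  {ae mu, forall t, 0 < t < T -> [/\ {within `[0, 1], continuous (v t)},
     mu.-integrable `]0, 1[ (EFin \o g t),
     mu.-integrable `]0, 1[ (EFin \o (fun z => g t z ^+ 2)) &
     \int[mu]_(z in `]0, 1[) Hfun delta (v t) (g t) z <= Dm t]} ->
  (forall y, 4^-1 <= y <= 3 / 4 ->
   [/\ {within `[0, T], continuous (c y)}, c y 0 = 0 &
     {ae mu, forall t, 0 < t < T -> c y t = mollify h (v t) y}] /\
   [/\ measurable_fun setT (k y),
     {ae mu, forall t, 0 < t < T -> k y t = Gfun alpha beta gamma delta (v t) (g t) h y} &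
     forall psi, test_fun 0 T psi ->
     \int[mu]_(t in `]0, T[) (derive1 psi t * c y t) = - \int[mu]_(t in `]0, T[) (psi t * k y t)]) ->
  {within `[4^-1, 3 / 4], continuous (fun y => c y T)} ->
  exists K : R -> R, [/\ measurable_fun setT K, mu.-integrable `]0, T[ (EFin \o K),
    {ae mu, forall t, 0 < t < T -> K t =
       \int[mu]_(y in `[4^-1, 3 / 4]) flux alpha beta gamma delta (v t) (g t) h y} &
    \int[mu]_(y in `[4^-1, 3 / 4]) (sig y ^+ 4 * c y T ^+ 2) = 2 * \int[mu]_(t in `]0, T[) K t].
Proof.
move=> al0 be0 ga0 T0 h0 h8 iDm good Hy ccT.
have mI : measurable (`]0, T[ : set (measurableTypeR R)) by [].
have [C1 C10 HC1] := Gfun_bounded delta al0 be0 ga0 h.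
have [C2 C20 HC2] := flux_bounded delta al0 be0 ga0 h0 h8.
have ik y : 4^-1 <= y <= 3 / 4 -> mu.-integrable `]0, T[ (EFin \o k y).
  move=> yJ; have [_ [mk kG _]] := Hy _ yJ.
  apply: (@ae_le_integrable _ _ mu `]0, T[ (k y) (fun t => C1 * Dm t) mI).
    exact: measurable_funTS.
    apply: (@filterS2 _ _ (ae_filter_ringOfSetsType mu) _ _ _ _ good kG) => t gt kt.
    rewrite /= in_itv/= => tT; have [cv ig ig2 HD] := gt tT; rewrite kt//.
    by apply: (le_trans (HC1 _ _ cv ig ig2 y)); exact: ler_wpM2l.
    exact: (RintegrableZ mI _ iDm).
have sq y : 4^-1 <= y <= 3 / 4 -> mu.-integrable `]0, T[ (EFin \o (fun t => c y t * k y t)) /\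
   c y T ^+ 2 = 2 * \int[mu]_(t in `]0, T[) (c y t * k y t).
  move=> yJ; have [[cc c0 _] [_ _ wk]] := Hy _ yJ.
  have inc := weak_ftc cc (ik _ yJ) wk.
  have [i1 e1] := weak_sqr T0 cc (ik _ yJ) inc.
  by split => //; rewrite -e1 c0 expr0n subr0.
pose p n (i : 'I_n.+1) : R := 4^-1 + i%:R * (2^-1 / n.+1%:R).
pose F t y := sig y ^+ 4 * (c y t * k y t).
pose fl t := flux alpha beta gamma delta (v t) (g t) h.
have F_fl : {ae mu, forall t, forall n (i : 'I_n.+1), 0 < t < T -> F t (p n i) = fl t (p n i)}.
  (* There are countably many nodes in all, hence a single null set. [Q] is indexed by all of [nat],
     as [ae_foralln] requires, and holds trivially beyond [n]. *)
  apply: ae_foralln => n; pose Q (i : nat) t := forall Hi : (i < n.+1)%N, 0 < t < T -> F t (p n (Ordinal Hi)) = fl t (p n (Ordinal Hi)).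
  have : {ae mu, forall t, forall i, Q i t}.
    apply: ae_foralln => i; have [Hi|Hi] := boolP (i < n.+1)%N; last first.
      by apply: (@filterS _ _ (ae_filter_ringOfSetsType mu) _ _ _ good) => t _ H'; rewrite H' in Hi.
    have [[_ _ cm] [_ kG _]] := Hy _ (rsum_point Hi).
    apply: (@filterS2 _ _ (ae_filter_ringOfSetsType mu) _ _ _ _ cm kG) => t ct kt H' tT.
    by rewrite /F /fl /flux /p /= ct// kt.
  apply: (@filterS _ _ (ae_filter_ringOfSetsType mu)) => t Ht i tT.
  by have := Ht i (ltn_ord i) tT; rewrite (_ : Ordinal _ = i)//; exact: val_inj.
have iF n (i : 'I_n.+1) : mu.-integrable `]0, T[ (EFin \o (fun t => (2^-1 / n.+1%:R) * F t (p n i))).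
  by apply: RintegrableZ => //; apply: RintegrableZ => //; have [] := sq _ (rsum_point (ltn_ord i)).
pose q n t := rsum (F t) n.
have iq n : mu.-integrable `]0, T[ (EFin \o q n) /\ \int[mu]_(t in `]0, T[) q n t =
    rsum (fun y => 2^-1 * (sig y ^+ 4 * c y T ^+ 2)) n.
  have [i1 e1] := Rintegral_sum mI (iF n); split; first exact: i1.
  rewrite /q /rsum e1; apply: eq_bigr => i _.
  have [isq esq] := sq _ (rsum_point (ltn_ord i)).
  rewrite RintegralZl//; last exact: RintegrableZ.
  rewrite RintegralZl// -/(p n i) esq.
  by rewrite (mulrCA 2^-1) (mulrA 2^-1) mulVf ?mul1r ?pnatr_eq0.
have q_fl : {ae mu, forall t, 0 < t < T -> (forall n, q n t = rsum (fl t) n)}.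
  apply: (@filterS _ _ (ae_filter_ringOfSetsType mu) _ _ _ F_fl) => t Ft tT n.
  by apply: eq_bigr => i _; congr (_ * _); exact: Ft.
have cfl t : {within `[0, 1], continuous (v t)} -> mu.-integrable `]0, 1[ (EFin \o g t) -> continuous (fl t).
  by move=> cv ig; exact: flux_continuous.
have q_cvg : {ae mu, forall t, 0 < t < T -> q n t @[n --> \oo] --> \int[mu]_(y in `[4^-1, 3 / 4]) fl t y}.
  apply: (@filterS2 _ _ (ae_filter_ringOfSetsType mu) _ _ _ _ good q_fl) => t gt qt tT.
  have [cv ig ig2 HD] := gt tT.
  under eq_cvg do rewrite (qt tT).
  by apply: rsum_cvg; apply: continuous_subspaceT; exact: cfl.
have mq n : measurable_fun `]0, T[ (q n) by exact: Rintegrable_measurable (iq n).1.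
have [K mK KE] : exists2 K : R -> R, measurable_fun setT K & {ae mu, forall t, 0 < t < T -> K t = \int[mu]_(y in `[4^-1, 3 / 4]) fl t y}.
  apply: (@ae_limit_measurable _ (fun t => 0 < t < T) (fun n => q n \_ `]0, T[)).
    by move=> n; exact: (@measurable_restrictT _ _ _ _ _ (q n) mI).1 (mq n).
  apply: (@filterS _ _ (ae_filter_ringOfSetsType mu) _ _ _ q_cvg) => t Ht tT.
  under eq_cvg do rewrite patchE mem_set/= ?in_itv//=.
  exact: Ht.
have [iK cK] : mu.-integrable `]0, T[ (EFin \o K) /\
    \int[mu]_(t in `]0, T[) q n t @[n --> \oo] --> \int[mu]_(t in `]0, T[) K t.
  apply: (Rdominated_convergence mI (g := fun t => C2 * Dm t)) => //.
  - exact: measurable_funTS.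
  - apply: (@filterS2 _ _ (ae_filter_ringOfSetsType mu) _ _ _ _ q_cvg KE) => t H1 H2.
    by rewrite /= in_itv/= => tT; rewrite H2//; exact: H1.
  - exact: RintegrableZ.
  - apply: (@filterS2 _ _ (ae_filter_ringOfSetsType mu) _ _ _ _ good q_fl) => t gt qt.
    rewrite /= in_itv/= => tT n; have [cv ig ig2 HD] := gt tT; rewrite (qt tT).
    have HB y : 4^-1 <= y <= 3 / 4 -> `|fl t y| <= C2 * Dm t.
      by move=> yJ; apply: (le_trans (HC2 _ _ cv ig ig2 _ yJ)); exact: ler_wpM2l.
    apply: rsum_bound => //; apply: (le_trans _ (HB 4^-1 _)) => //; lra.
exists K; split => //.
have c4 : {within `[4^-1, 3 / 4], continuous (fun y => sig y ^+ 4 * c y T ^+ 2)}.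
  apply: wctsM; last exact: wctsX.
  by apply: continuous_subspaceT; apply: ctsX; exact: sig_continuous.
have lim2 : rsum (fun y => 2^-1 * (sig y ^+ 4 * c y T ^+ 2)) n @[n --> \oo] -->
   \int[mu]_(y in `[4^-1, 3 / 4]) (2^-1 * (sig y ^+ 4 * c y T ^+ 2)).
  by apply: rsum_cvg; apply: wctsM => //; exact: wcts_cst.
have E : (fun n => \int[mu]_(t in `]0, T[) q n t) = rsum (fun y => 2^-1 * (sig y ^+ 4 * c y T ^+ 2)).
  by apply/funext => n; exact: (iq n).2.
(* One sequence with two limits: Riemann sums of the final energy, and time integrals of Riemann
   sums of the flux. *)
have := cvg_lim (@Rhausdorff R) cK; rewrite E (cvg_lim (@Rhausdorff R) lim2) => <-.
rewrite RintegralZl//; last exact: continuous_integrable.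
by rewrite mulrA mulfV ?mul1r ?pnatr_eq0.
Qed.

(** A reverse Fatou lemma: the positive parts of [K_ n - C0] tend to 0 and are dominated by [|G|],
    so their integrals tend to 0; the 1 in the conclusion is the tolerance at which one index is
    picked. *)
Lemma limsup_le_integral T (K_ : nat -> R -> R) (G : R -> R) (C0 : R) : 0 < T -> 0 <= C0 ->
  (forall n, mu.-integrable `]0, T[ (EFin \o K_ n)) -> mu.-integrable `]0, T[ (EFin \o G) ->
  {ae mu, forall t, 0 < t < T -> forall n, K_ n t <= G t} ->
  {ae mu, forall t, 0 < t < T -> forall e, 0 < e -> \forall n \near \oo, K_ n t <= C0 + e} ->
  exists n, \int[mu]_(t in `]0, T[) K_ n t <= C0 * T + 1.
Proof.
move=> T0 C00 iK iG KG Kl.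
have mI : measurable (`]0, T[ : set (measurableTypeR R)) by [].
have mT : fine (mu `]0, T[) = T by rewrite lebesgue_measure_itv/= lte_fin T0/= oppr0 addr0.
have ic (r : R) : mu.-integrable `]0, T[ (EFin \o cst r).
  by apply: continuous_integrable_oo; apply: continuous_subspaceT => x; exact: cst_continuous.
pose m n t := Num.max (K_ n t - C0) 0.
have mm n : measurable_fun `]0, T[ (m n).
  apply: (@measurable_maxr _ _ _ _ (fun t => K_ n t - C0) (cst 0)) => //.
  by apply: measurable_funB => //; exact: Rintegrable_measurable (iK n).
have m0 n t : 0 <= m n t by rewrite /m le_max lexx orbT.
have [_ cm] : mu.-integrable `]0, T[ (EFin \o (cst 0 : R -> R)) /\
    \int[mu]_(t in `]0, T[) m n t @[n --> \oo] --> \int[mu]_(t in `]0, T[) (cst 0 : R -> R) t.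
  apply: (Rdominated_convergence mI (g := fun t => `|G t|)) => //.
  - apply: (@filterS _ _ (ae_filter_ringOfSetsType mu) _ _ _ Kl) => t Kt.
    rewrite /= in_itv/= => tT; apply/cvgrPdist_le => e e0.
    apply: filterS (Kt tT e e0) => n Kn.
    by rewrite sub0r normrN ger0_norm// /m ge_max (ltW e0) andbT lerBlDl.
  - exact: Rintegrable_norm.
  - apply: (@filterS _ _ (ae_filter_ringOfSetsType mu) _ _ _ KG) => t Kt.
    rewrite /= in_itv/= => tT n; rewrite ger0_norm// /m ge_max normr_ge0 andbT.
    by rewrite lerBlDr (le_trans (Kt tT n))// (le_trans (ler_norm _))// lerDl.
have im n : mu.-integrable `]0, T[ (EFin \o m n).
  apply: (le_integrableR mI (mm n) (g := fun t => `|K_ n t|)); last exact: Rintegrable_norm.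
  move=> t _; rewrite ger0_norm// /m ge_max normr_ge0 andbT lerBlDr.
  by rewrite (le_trans (ler_norm _))// lerDl.
move: cm; rewrite Rintegral_cst// mul0r => /cvgrPdist_le/(_ 1 ltr01)[N _ /(_ N (leqnn _)) /=].
rewrite sub0r normrN => HN; exists N.
apply: (@le_trans _ _ (\int[mu]_(t in `]0, T[) (cst C0 t + m N t))).
  apply: le_Rintegral => //; first exact: RintegrableD.
  by move=> t _; rewrite /m -lerBlDl le_max lexx.
rewrite RintegralD// Rintegral_cst// mT lerD2l.
exact: le_trans (ler_norm _) HN.
Qed.
End Energy.

(** * The bound independent of the controls, and the contradiction *)

Section Final.
Context {R : realType}.
Implicit Types (h x y z a b s t e : R).
Notation mu := (@lebesgue_measure R).

Lemma Lpnorm_pow_fine a b (n : nat) f : (0 < n)%N -> Lp a b (n%:R)%:E f ->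
  fine (Lpnorm a b (n%:R)%:E f) ^+ n = \int[mu]_(x in `]a, b[) (`|f x| ^+ n).
Proof.
move=> n0 Lf; rewrite /Rintegral -Lpnorm_pow// fine_poweR powR_mulrn//.
by rewrite fine_ge0// Lnorm_ge0.
Qed.

(** Evaluation at a fixed element of the unit ball of [H10] is 1-Lipschitz for the dual norm, hence
    measurable in time up to a null set. The mollifier is first scaled into this ball, and linearity
    undoes the scaling. *)
Lemma Hm1_measurable (T : R) (p : \bar R) (ut : R -> (R -> R) -> R) h y :
  0 < h -> 0 < y - h -> y + h < 1 -> Bochner Hm1 Hm1norm T p ut ->
  exists2 k : R -> R, measurable_fun setT k &
    {ae mu, forall t, 0 < t < T -> k t = ut t (moll h y)}.
Proof.
move=> h0 y0 y1 [Xut sm _].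
have tm := test_moll h0 y0 y1; have Hm := moll_H10 h0 y0 y1.
have [M1 M10 HM1] := @moll_bounded R h.
have [M2 M20 HM2] := @dmoll_bounded R h.
(* Both [s * moll] and [s * dmoll] are then at most 1/2, and [H1norm_abump_le] gives norm at most
   1. *)
have [s s0 [s1 s2]] : exists2 s : R, 0 < s & s * M1 <= 2^-1 /\ s * M2 <= 2^-1.
  have d0 : 0 < 2 * (M1 + M2 + 1) by lra.
  exists (2 * (M1 + M2 + 1))^-1; first by rewrite invr_gt0.
  by split; rewrite mulrC ler_pdivrMr//; lra.
pose phi := abump 1 0 (s * (h^-1 * (step0 1)^-1)) h^-1 (- y / h).
have phiE : phi = s *: moll h y.
  by apply/funext => z; rewrite /phi /abump -mulrA mollE.
have bphi z : `|phi z| <= 2^-1.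
  rewrite phiE -[(s *: moll h y) z]/(s * moll h y z) normrM gtr0_norm//.
  by apply: le_trans s1; rewrite ler_wpM2l// ltW.
have bdphi z : `|abump (dbump 1 0) 2 (s * (h^-1 * (step0 1)^-1) * h^-1) h^-1 (- y / h) z| <= 2^-1.
  rewrite (_ : abump _ _ _ _ _ z = s * dmoll h y z); last first.
    by rewrite dmollE /abump; ring.
  rewrite normrM gtr0_norm//.
  by apply: le_trans s2; rewrite ler_wpM2l// ltW.
have tphi : test_fun 0 1 phi.
  have [_ [c [d [c0 d1 H]]]] := tm; split; first exact: smooth_abump.
  exists c, d; split => // z; rewrite phiE -[(s *: moll h y) z]/(s * moll h y z) mulf_eq0 negb_or.
  by move=> /andP[_ /H].
have Hphi : H10 phi by exact: H10_abump.
have Nphi : (H1norm phi <= 1)%E.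
  have := H1norm_abump_le (e := 2^-1) _ tphi bphi bdphi.
  by rewrite mulfV ?pnatr_eq0//; apply; rewrite invr_ge0.
have [k mk kE] := strongly_measurable_real (M := fun l => l phi) Xut sm (fun l1 l2 _ _ => Hm1_lip l1 l2 Hphi Nphi).
exists (fun t => s^-1 * k t); first exact: measurable_funM.
move/leb_ae : Xut => Xut.
apply: (@filterS2 _ _ (ae_filter_ringOfSetsType mu) _ _ _ _ kE Xut) => t kt Xt tT.
have [lin _] : Hm1 (ut t) by apply: Xt; rewrite /= in_itv.
(* Linearity is stated for [c *: phi + psi]; with [c = s - 1] and both arguments equal to the
   mollifier it yields homogeneity directly. *)
have := lin (s - 1) _ _ Hm Hm.
rewrite (_ : (s - 1) *: moll h y + moll h y = phi); last by rewrite phiE scalerBl scale1r subrK.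
by rewrite kt// => ->; rewrite mulrBl mul1r subrK mulrA mulVf ?mul1r// gt_eqF.
Qed.

Lemma initial_value (F : R -> R) (T l : R) : 0 < T -> {within `[0, T], continuous F} ->
  F t @[t --> 0^'+] --> l -> F 0 = l.
Proof.
move=> T0 /(continuous_within_itvP _ T0)[_ c0 _] cl.
exact: (cvg_unique _ c0 cl).
Qed.

(** [C] is fixed before [T], the controls and the solution; [h] may depend on the solution. The
    factor 2 is that of [(c^2)' = 2 c c'], and the 1 comes from [limsup_le_integral]. *)
Lemma energy_bound (alpha beta gamma : R) (delta : nat) : 0 < alpha -> 0 < beta -> 0 < gamma ->
  (1 <= delta)%N -> exists2 C : R, 0 <= C & forall (T : R) f1 f2 u, 0 < T ->
  solution alpha beta gamma delta T f1 f2 (cst 0) u ->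
  exists h, [/\ 0 < h, h <= 8^-1 &
    \int[mu]_(y in `[4^-1, 3 / 4]) (sig y ^+ 4 * mollify h (u T) y ^+ 2) <= 2 * (C * T + 1)].
Proof.
move=> al0 be0 ga0 d1.
have [C0 C00 HC0] := flux_upper al0 be0 ga0 d1.
have [C1 C10 HC1] := flux_dominated delta al0 be0 ga0.
exists C0 => // T f1 f2 u T0 [B1 B2 B3 [Lu cu] [tr0 _ [ut [But tdu pde]] init]].
have mI : measurable (`]0, T[ : set (measurableTypeR R)) by [].
pose q := (2 * delta.+1)%N; have q0 : (0 < q)%N by [].
pose gd t (w : R -> R) := [/\ {within `[0, 1], continuous w}, {ae mu, forall x, 0 < x < 1 -> w x = u t x},
   mu.-integrable `]0, 1[ (EFin \o wderiv (u t)),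
   mu.-integrable `]0, 1[ (EFin \o (fun z => wderiv (u t) z ^+ 2)) &
   forall psi, test_fun 0 1 psi ->
    \int[mu]_(z in `]0, 1[) (w z * derive1 psi z) = - \int[mu]_(z in `]0, 1[) (wderiv (u t) z * psi z)].
(* A continuous representative is chosen for each time separately, with 0 at bad times;
   measurability in time will come from the pairings instead. *)
have [v Hv] : {v : R -> R -> R & forall t, H1 (u t) -> has_trace (u t) 0 (f1 t) -> gd t (v t)}.
  apply: (@choice _ _ (fun t w => H1 (u t) -> has_trace (u t) 0 (f1 t) -> gd t w)) => t.
  have [[Ht tr]|nt] := pselect (H1 (u t) /\ has_trace (u t) 0 (f1 t)).
    by have [w Hw] := trace_good Ht tr; exists w.
  by exists (cst 0) => Ht tr; exfalso; apply: nt.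
pose g t := wderiv (u t).
have H1u : {ae mu, forall t, 0 < t < T -> H1 (u t)} by have [/leb_ae H _ _] := B2.
have Lqu : {ae mu, forall t, 0 < t < T -> Lp 0 1 (q%:R)%:E (u t)} by have [/leb_ae H _ _] := B3.
move/leb_ae : tr0 => tr0.
have good0 : {ae mu, forall t, 0 < t < T -> gd t (v t)}.
  apply: (@filterS2 _ _ (ae_filter_ringOfSetsType mu) _ _ _ _ H1u tr0) => t Ht tt tT.
  by apply: Hv; [exact: Ht|apply: tt; rewrite /= in_itv].
have [kg [mkg kgE ikg]] : exists k : R -> R, [/\ measurable_fun setT k,
    {ae mu, forall t, 0 < t < T -> k t = fine (Lpnorm 0 1 2 (wderiv (u t)))} &
    mu.-integrable `]0, T[ (EFin \o (fun t => k t ^+ 2))].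
  apply: (@Bochner_real _ _ H1 H1norm T u (fun f => fine (Lpnorm 0 1 2 (wderiv f))) 2 isT B2).
    by move=> f1' f2' Hf1 Hf2; exact: wderiv_norm_lip.
  move=> f Hf; split; first by rewrite fine_ge0// Lnorm_ge0.
  by rewrite fineK ?wderiv_norm_le//; apply: Lp_fin; have [] := H1_wderiv Hf.
have [ku [mku kuE iku]] : exists k : R -> R, [/\ measurable_fun setT k,
    {ae mu, forall t, 0 < t < T -> k t = fine (Lpnorm 0 1 (q%:R)%:E (u t))} &
    mu.-integrable `]0, T[ (EFin \o (fun t => k t ^+ q))].
  apply: (@Bochner_real _ _ (Lp 0 1 (q%:R)%:E) (Lpnorm 0 1 (q%:R)%:E) T u (fun f => fine (Lpnorm 0 1 (q%:R)%:E f)) q q0 B3).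
    by move=> f1' f2' Hf1 Hf2; exact: Lpnorm_lip.
  move=> f Hf; split; first by rewrite fine_ge0// Lnorm_ge0.
  by rewrite fineK//; exact: Lp_fin.
(* Built from the measurable versions [kg] and [ku] of the norms; it equals [\int Hfun] for a.e.
   [t]. *)
pose Dm t := 1 + kg t ^+ 2 + ku t ^+ q.
have iDm : mu.-integrable `]0, T[ (EFin \o Dm).
  apply: (RintegrableD mI) => //; apply: (RintegrableD mI) => //.
  by apply: continuous_integrable_oo; apply: continuous_subspaceT => x; exact: cst_continuous.
have HDm : {ae mu, forall t, 0 < t < T -> \int[mu]_(z in `]0, 1[) Hfun delta (v t) (g t) z <= Dm t}.
  have := @filterI _ _ (ae_filter_ringOfSetsType mu) _ _ (@filterI _ _ (ae_filter_ringOfSetsType mu) _ _ good0 Lqu) (@filterI _ _ (ae_filter_ringOfSetsType mu) _ _ H1u (@filterI _ _ (ae_filter_ringOfSetsType mu) _ _ kgE kuE)).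
  apply: (@filterS _ _ (ae_filter_ringOfSetsType mu)) => t [[gt Lt] [Ht [kgt kut]]] tT.
  have [cv vu ig ig2 _] := gt tT.
  have mD : measurable (`]0, 1[ : set (measurableTypeR R)) by [].
  have i1 := cst_integrable (1 : R).
  have ivq := vX_integrable cv q.
  rewrite /Hfun RintegralD//; last by apply: (RintegrableD mD).
  rewrite RintegralD// Rintegral_cst// /Dm.
  have -> : fine (mu `]0, 1[) = 1 by rewrite lebesgue_measure_itv/= lte_fin ltr01/= oppr0 addr0.
  rewrite mulr1 -!addrA lerD2l kgt// kut//.
  have [L2 _] := H1_wderiv (Ht tT).
  rewrite (Lpnorm_pow_fine q0 (Lt tT)) (@Lpnorm_pow_fine 0 1 2 (wderiv (u t)) isT L2).
  apply: lerD; rewrite le_eqVlt; apply/orP; left; apply/eqP.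
    by apply: eq_Rintegral => x _; rewrite real_normK ?num_real.
  apply: ae_eq_Rintegral; apply: (@filterS _ _ (ae_filter_ringOfSetsType mu) _ _ _ vu) => x Hx.
  by rewrite /= in_itv/= => /Hx ->; rewrite /q !exprM real_normK ?num_real.
have good1 : {ae mu, forall t, 0 < t < T -> [/\ {within `[0, 1], continuous (v t)},
     mu.-integrable `]0, 1[ (EFin \o g t),
     mu.-integrable `]0, 1[ (EFin \o (fun z => g t z ^+ 2)) &
     \int[mu]_(z in `]0, 1[) Hfun delta (v t) (g t) z <= Dm t]}.
  apply: (@filterS2 _ _ (ae_filter_ringOfSetsType mu) _ _ _ _ good0 HDm) => t gt Ht tT.
  by have [? ? ? ? ?] := gt tT; split => //; exact: Ht.
have step h : 0 < h -> h <= 8^-1 -> exists K : R -> R, [/\ measurable_fun setT K, mu.-integrable `]0, T[ (EFin \o K),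
    {ae mu, forall t, 0 < t < T -> K t =
       \int[mu]_(y in `[4^-1, 3 / 4]) flux alpha beta gamma delta (v t) (g t) h y} &
    \int[mu]_(y in `[4^-1, 3 / 4]) (sig y ^+ 4 * mollify h (u T) y ^+ 2) = 2 * \int[mu]_(t in `]0, T[) K t].
  move=> h0 h8.
  have Jy y : 4^-1 <= y <= 3 / 4 -> 0 < y - h /\ y + h < 1 by move=> /andP[? ?]; split; lra.
  have [k Hk] : {k : R -> R -> R & forall y, 4^-1 <= y <= 3 / 4 -> measurable_fun setT (k y) /\
      {ae mu, forall t, 0 < t < T -> k y t = ut t (moll h y)}}.
    apply: (@choice _ _ (fun y k => 4^-1 <= y <= 3 / 4 -> measurable_fun setT k /\
      {ae mu, forall t, 0 < t < T -> k t = ut t (moll h y)})) => y.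
    have [yJ|nJ] := boolP (4^-1 <= y <= 3 / 4); last by exists (cst 0).
    have [y0 y1] := Jy _ yJ.
    by have [k mk kE] := Hm1_measurable h0 y0 y1 But; exists k.
  pose c y t := \int[leb 0 1]_x (u t x * moll h y x).
  have cE y t : c y t = mollify h (u t) y.
    by apply: pairing_mollify; exact: nearW.
  have [_ iuT _] : [/\ measurable_fun setT (u T), mu.-integrable `]0, 1[ (EFin \o u T) &
     mu.-integrable `]0, 1[ (EFin \o (fun x => u T x ^+ 2))].
    by apply: Lp2_int; apply: Lu; rewrite in_itv/= lexx andbT ltW.
  have ccT : {within `[4^-1, 3 / 4], continuous (fun y => c y T)}.
    apply: continuous_subspaceT; rewrite (_ : (fun y => _) = mollify h (u T)); last exact/funext.
    exact: mollify_continuous.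
  have [|K [mK iK KE EK]] := @energy_identity _ alpha beta gamma delta T h c k v g Dm al0 be0 ga0 T0 h0 h8 iDm good1 _ ccT.
  - move=> y yJ; have [y0 y1] := Jy _ yJ; have [mk kE] := Hk _ yJ.
    have Hm := moll_H10 h0 y0 y1; have Lm : Lp 0 1 2 (moll h y) by have [[]] := Hm.
    have cc := cu _ Lm.
    split; split => //.
    (* The initial condition is a limit at 0+; weak continuity on [0, T] turns it into the value at
       0. *)
    + have c0 : c y 0 = \int[leb 0 1]_x (cst 0 x * moll h y x) := initial_value T0 cc (init _ Hm).
      rewrite c0 /Rintegral; under eq_integral do rewrite mul0r.
      by rewrite integral0.
    + apply: (@filterS _ _ (ae_filter_ringOfSetsType mu) _ _ _ good0) => t gt tT.
      by have [_ vu _ _ _] := gt tT; exact: pairing_mollify.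
    + have /leb_ae Ht := pde _ Hm.
      have := @filterI _ _ (ae_filter_ringOfSetsType mu) _ _ good0 (@filterI _ _ (ae_filter_ringOfSetsType mu) _ _ kE Ht).
      apply: (@filterS _ _ (ae_filter_ringOfSetsType mu)) => t [gt [kt pt]] tT.
      have [cv vu ig _ _] := gt tT.
      rewrite kt//; apply: (pde_Gfun h0 y0 y1 cv vu ig).
      by apply: pt; rewrite /= in_itv.
    + move=> psi tpsi; have := tdu _ _ Hm tpsi; rewrite !leb_Rintegral => ->; congr (- _).
      apply: ae_eq_Rintegral; apply: (@filterS _ _ (ae_filter_ringOfSetsType mu) _ _ _ kE) => t kt.
      by rewrite /= in_itv/= => tT; rewrite kt.
  - exists K; split; [exact: mK|exact: iK|exact: KE|rewrite -EK].
    apply: eq_Rintegral => y _; by rewrite (cE y T).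
(* The shift by 8 keeps [hn n <= 1/8] for all [n]. *)
pose hn (n : nat) : R := (n + 8)%:R^-1.
have n8 n : 0 < (n + 8)%:R :> R by rewrite ltr0n addnS.
have hn0 n : 0 < hn n by rewrite invr_gt0.
have hn8 n : hn n <= 8^-1 by rewrite lef_pV2 ?posrE// ler_nat leq_addl.
have [K_ HK] := choice (fun n => step (hn n) (hn0 n) (hn8 n)).
have KE : {ae mu, forall t, forall n, 0 < t < T -> K_ n t =
       \int[mu]_(y in `[4^-1, 3 / 4]) flux alpha beta gamma delta (v t) (g t) (hn n) y}.
  by apply: ae_foralln => n; have [] := HK n.
have [||||n Hn] := @limsup_le_integral _ T K_ (fun t => C1 * Dm t) C0 T0 C00.
- by move=> n; have [] := HK n.
- exact: (RintegrableZ mI).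
- have := @filterI _ _ (ae_filter_ringOfSetsType mu) _ _ KE (@filterI _ _ (ae_filter_ringOfSetsType mu) _ _ good0 HDm).
  apply: (@filterS _ _ (ae_filter_ringOfSetsType mu)) => t [Kt [gt Ht]] tT n.
  have [cv vu ig ig2 wd] := gt tT; rewrite Kt//.
  apply: (le_trans (HC1 _ _ cv ig ig2 wd _ (hn0 n) (hn8 n))).
  by apply: ler_wpM2l => //; exact: Ht.
- apply: (@filterS2 _ _ (ae_filter_ringOfSetsType mu) _ _ _ _ KE good0) => t Kt gt tT e e0.
  have [cv vu ig ig2 wd] := gt tT.
  have [h1 h10 Hh1] := HC0 _ _ cv ig wd _ e0.
  near=> n; rewrite Kt//; apply: Hh1 => //.
  rewrite /hn -[h1]invrK lef_pV2 ?posrE ?invr_gt0//.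
  apply: (@le_trans _ _ n%:R); last by rewrite ler_nat leq_addr.
  by near: n; exact: nbhs_infty_ger.
- exists (hn n); split => //; have [_ _ _ ->] := HK n.
  by rewrite ler_pM2l.
Unshelve. all: by end_near. Qed.

Lemma Lp2_cst (K : R) : Lp 0 1 2 (cst K : R -> R).
Proof. by apply: (@Lp2_of_bounded _ _ _ _ `|K|). Qed.

End Final.

Theorem theorem1p3 (R : realType) (alpha beta gamma : R) (delta : nat) (T : R)
  (halpha : 0 < alpha) (hbeta : 0 < beta) (hgamma : 0 < gamma)
  (hdelta : (1 <= delta)%N) (hT : 0 < T) :
  ~ approximately_controllable alpha beta gamma delta T.
Proof.
move=> AC.
have [C C0 HC] := energy_bound halpha hbeta hgamma hdelta.
set I0 := \int[@lebesgue_measure R]_(y in `[4^-1, 3 / 4]) (sig y ^+ 4).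
have I00 : 0 < I0 := int_sig4_gt0.
(* With [B = 2 (C T + 1) + 1], this [K] gives [K / 2 * I0 = B + I0 / 2 > B]; [K >= 1] allows
   replacing [K] by [K^2] at the end. *)
have [K K1 HK] : exists2 K : R, 1 <= K & 2 * (C * T + 1) + 1 < K / 2 * I0.
  exists (1 + 2 / I0 * (2 * (C * T + 1) + 1)).
    by rewrite lerDl mulr_ge0 ?divr_ge0 ?(ltW I00)// addr_ge0// mulr_ge0// addr_ge0// mulr_ge0// ltW.
  set B := 2 * (C * T + 1) + 1.
  have -> : (1 + 2 / I0 * B) / 2 * I0 = B + I0 / 2 by field; rewrite gt_eqF.
  by rewrite ltrDl divr_gt0.
(* From 0 towards the constant [K] with tolerance 1, the one built into [energy_lower]. *)
have [f1 [f2 [u [_ _ sol uK]]]] := AC _ _ (Lp2_cst 0) (Lp2_cst K) 1 ltr01.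
have [h [h0 h8 Hh]] := HC _ _ _ _ hT sol.
have LuT : Lp 0 1 2 (u T).
  by have [_ _ _ [Lu _] _] := sol; apply: Lu; rewrite in_itv/= lexx andbT ltW.
have := energy_lower h0 h8 LuT uK; rewrite -/I0 => lo.
have : K / 2 * I0 <= K ^+ 2 / 2 * I0.
  by rewrite ler_pM2r// ler_pM2r ?invr_gt0// expr2 ler_peMr// (le_trans ler01).
lra.
Qed.
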